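(* Let $M^n$ ($n=2m-1$) be a real hypersurface of $\mathbb{CQ}^m(4c)$, $c=\pm1$. Then for every tangent vector field $X$ of $M$, $$(\Delta A)X=3c\,[\langle AU-fU,X\rangle U+\langle U,X\rangle AU]-6c\,SASX+cfX+[f_2-c(n+3)]AX-fA^2X-\nabla_X(\nabla f),$$ and, with respect to any local orthonormal frame $\{e_i\}$ of $TM$, $$\tfrac12\Delta(\operatorname{tr}A^2)=6c\langle AU,AU\rangle-3cf\langle AU,U\rangle-6c\operatorname{tr}(SA)^2+cf^2+[f_2-c(n+3)]f_2-ff_3-\|\nabla A\|^2-\sum_i\operatorname{Hess}_f(Ae_i,e_i).$$
   Context: $\mathbb{CQ}^m(4c)$ denotes the complex projective space $\mathbb{CP}^m(4)$ ($c=1$) or the complex hyperbolic space $\mathbb{CH}^m(-4)$ ($c=-1$), of constant holomorphic sectional curvature $4c$, with complex structure $J$. $M^n$ is an isometrically immersed real hypersurface with Levi-Civita connection $\nabla$, local unit normal $\xi$ and shape operator $A$ (so $\overline\nabla_XY=\nabla_XY+\langle AX,Y\rangle\xi$, where $\overline\nabla$ is the Levi-Civita connection of $\mathbb{CQ}^m$). $U=-J\xi$, and for tangent $X$, $SX$ is the tangential part of $JX$, i.e. $SX=JX-\langle X,U\rangle\xi$. Write $f_k=\operatorname{tr}A^k$, $f=f_1=\operatorname{tr}A$. $\nabla f$ is the gradient, $\operatorname{Hess}_f(X,Y)=\langle\nabla_X(\nabla f),Y\rangle$, and the Laplacian on functions is $\Delta=-\operatorname{tr}\operatorname{Hess}$.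 The trace Laplacian of the shape operator is $\Delta A=\sum_i[\nabla_{\nabla_{e_i}e_i}A-\nabla_{e_i}(\nabla_{e_i}A)]$ for a local orthonormal frame $\{e_i\}$, and $\|\nabla A\|^2=\sum_{i,j}\langle(\nabla_{e_j}A)e_i,(\nabla_{e_j}A)e_i\rangle$. $\operatorname{tr}(SA)^2$ means the trace of the endomorphism $SASA$. *)

(* Defs.v *)
From HB Require Import structures.
From mathcomp Require Import all_boot all_order all_algebra.
From mathcomp Require Import all_classical all_reals all_analysis.
From mathcomp Require Import complex.

Set Implicit Arguments.
Unset Strict Implicit.
Unset Printing Implicit Defensive.

Import Order.TTheory GRing.Theory Num.Theory.
Import numFieldNormedType.Exports.

Local Open Scope classical_set_scope.
Local Open Scope ring_scope.
Local Open Scope complex_scope.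

Section Smooth.
Variables (R : realType) (E W : normedModType R).

(* The derivatives at the points of an open set V only depend on f on V. *)
Fixpoint Ck (k : nat) (V : set E) (f : E -> W) : Prop :=
  match k with
  | 0 => forall x, V x -> {for x, continuous f}
  | k'.+1 => (forall x v, V x -> derivable f x v) /\
             (forall v, Ck k' V ('D_v f))
  end.

Definition smooth_on (V : set E) (f : E -> W) : Prop := forall k, Ck k V f.

End Smooth.

Section Manifold.
Variables (R : realType) (M : topologicalType) (n : nat).

(* cinv is only meaningful on the image of cdom under cmap. *)
Record chart := Chart {
  cdom : set M ;
  cmap : M -> 'rV[R]_n ;
  cinv : 'rV[R]_n -> M }.

Definition cimg (a : chart) : set 'rV[R]_n := cmap a @` cdom a.

Definition is_chart (a : chart) : Prop :=
  [/\ open (cdom a), open (cimg a),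
      (forall p, cdom a p -> cinv a (cmap a p) = p),
      {within cdom a, continuous (cmap a)} &
      {within cimg a, continuous (cinv a)}].

Definition smooth_manifold (atlas : set chart) : Prop :=
  [/\ hausdorff_space M, @second_countable M,
      (forall a, atlas a -> is_chart a),
      (forall p, exists2 a, atlas a & cdom a p) &
      (forall a b, atlas a -> atlas b ->
         smooth_on (cmap a @` (cdom a `&` cdom b)) (cmap b \o cinv a))].

End Manifold.

(* Vector fields on R^N are functions into 'rV_N, and a metric is given by its
   Gram matrix.  A matrix T stands for the endomorphism u |-> u *m T, so
   compositions read from left to right. *)
Section Riemannian.
Variables (R : realType) (N : nat) (G : 'rV[R]_N -> 'M[R]_N).

Local Notation field := ('rV[R]_N -> 'rV[R]_N).

Definition inner (x u v : 'rV[R]_N) : R := (u *m G x *m v^T) 0 0.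

Definition pderiv (i : 'I_N) (f : 'rV[R]_N -> R) (x : 'rV[R]_N) : R :=
  'D_(delta_mx 0 i) f x.

Definition christoffel (x : 'rV[R]_N) (k i j : 'I_N) : R :=
  2^-1 * \sum_l invmx (G x) k l *
    (pderiv i (fun y => G y j l) x + pderiv j (fun y => G y i l) x
     - pderiv l (fun y => G y i j) x).

Definition conn (x u v : 'rV[R]_N) : 'rV[R]_N :=
  \row_k \sum_i \sum_j christoffel x k i j * u 0 i * v 0 j.

(* The Levi-Civita connection of G. *)
Definition nabla (X Y : field) : field :=
  fun x => 'D_(X x) Y x + conn x (X x) (Y x).

Definition grad (f : 'rV[R]_N -> R) : field :=
  fun x => (\row_i pderiv i f x) *m invmx (G x).

Definition hess (f : 'rV[R]_N -> R) (x u v : 'rV[R]_N) : R :=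
  inner x (nabla (cst u) (grad f) x) v.

(* Minus the trace of Hess f, i.e. of the endomorphism u |-> nabla_u (grad f). *)
Definition laplacian (f : 'rV[R]_N -> R) (x : 'rV[R]_N) : R :=
  - \tr (\matrix_i nabla (cst (delta_mx 0 i)) (grad f) x).

(* Endomorphism fields T are seen as operators on vector fields. *)
Definition nabla_end (X : field) (T : field -> field) : field -> field :=
  fun Y x => nabla X (T Y) x - T (nabla X Y) x.

Definition orthonormal_frame (V : set 'rV[R]_N) (e : 'I_N -> field) : Prop :=
  (forall i, smooth_on V (e i)) /\
  (forall x i j, V x -> inner x (e i x) (e j x) = (i == j)%:R).

Definition trace_laplacian (e : 'I_N -> field) (T : field -> field) :
    field -> field :=
  fun X x => \sum_i (nabla_end (nabla (e i) (e i)) T X x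
                     - nabla_end (e i) (nabla_end (e i) T) X x).

Definition norm2_nabla_end (e : 'I_N -> field) (T : field -> field)
    (x : 'rV[R]_N) : R :=
  \sum_i \sum_j inner x (nabla_end (e j) T (e i) x) (nabla_end (e j) T (e i) x).

End Riemannian.

(* Local geometry of an immersion phi into R^N with metric G and almost
   complex structure J, with normal field xi along phi. *)
Section Hypersurface.
Variables (R : realType) (n N : nat).
Variables (G : 'rV[R]_N -> 'M[R]_N) (J : 'M[R]_N).
Variables (phi : 'rV[R]_n -> 'rV[R]_N) (xi : 'rV[R]_n -> 'rV[R]_N).

Definition dmap (x : 'rV[R]_n) : 'M[R]_(n, N) :=
  \matrix_i 'D_(delta_mx 0 i) phi x.

Definition induced_metric (x : 'rV[R]_n) : 'M[R]_n :=
  dmap x *m G (phi x) *m (dmap x)^T.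

Definition unit_normal (V : set 'rV[R]_n) : Prop :=
  smooth_on V xi /\
  (forall x, V x -> inner G (phi x) (xi x) (xi x) = 1 /\
     forall u : 'rV[R]_n, inner G (phi x) (u *m dmap x) (xi x) = 0).

(* The ambient Levi-Civita connection, on vector fields Y along phi. *)
Definition nabla_along (X : 'rV[R]_n -> 'rV[R]_n) (Y : 'rV[R]_n -> 'rV[R]_N) :
    'rV[R]_n -> 'rV[R]_N :=
  fun x => 'D_(X x) Y x + conn G (phi x) (X x *m dmap x) (Y x).

Definition second_form (x : 'rV[R]_n) : 'M[R]_n :=
  \matrix_(i, j) inner G (phi x)
    (nabla_along (cst (delta_mx 0 i)) (fun y => row j (dmap y)) x) (xi x).

(* <A u, v> = <ambient nabla_u v, xi>, the normal part of the Gauss formula. *)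
Definition shape_operator (x : 'rV[R]_n) : 'M[R]_n :=
  second_form x *m invmx (induced_metric x).

(* The u with <u, v> = <w, dphi v> for all v. *)
Definition tangential (x : 'rV[R]_n) (w : 'rV[R]_N) : 'rV[R]_n :=
  w *m G (phi x) *m (dmap x)^T *m invmx (induced_metric x).

Definition structure_vector (x : 'rV[R]_n) : 'rV[R]_n :=
  tangential x (- (xi x *m J)).

Definition structure_tensor (x : 'rV[R]_n) : 'M[R]_n :=
  \matrix_i tangential x (delta_mx 0 i *m dmap x *m J).

End Hypersurface.

(* CQ^m(4c) as the complex lines of C^(m+1) on which c <z, z> > 0, where
   <z, w> = c z_0 (w_0)^* + z_1 (w_1)^* + ... + z_m (w_m)^*: all the lines for
   c = 1, the negative lines of the form of signature (m, 1) for c = -1. *)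
Section SpaceForm.
Variables (R : realType) (c : R) (m : nat).

Definition herm (z w : 'rV[R[i]]_m.+1) : R[i] :=
  c%:C * z 0 ord0 * (w 0 ord0)^*
  + \sum_(k < m) z 0 (lift ord0 k) * (w 0 (lift ord0 k))^*.

Definition CQ : set {vspace 'rV[R[i]]_m.+1} :=
  [set L | \dim L = 1%N /\
           forall z, z \in L -> z != 0 -> 0 < c * complex.Re (herm z z)].

(* Affine charts [z] |-> (z_k / z_j)_(k <> j), with C^m identified with R^(2m)
   through (real parts, imaginary parts). *)
Definition CQdom (j : 'I_m.+1) : set {vspace 'rV[R[i]]_m.+1} :=
  [set L | CQ L /\ vpick L 0 j != 0].

Definition CQchart (j : 'I_m.+1) (L : {vspace 'rV[R[i]]_m.+1}) :
    'rV[R]_(m + m) :=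
  let z := (vpick L 0 j)^-1 *: vpick L in
  row_mx (\row_k complex.Re (z 0 (lift j k)))
         (\row_k complex.Im (z 0 (lift j k))).

(* The vector of C^(m+1) with j-th coordinate a and the others given by v. *)
Definition hcoord (j : 'I_m.+1) (a : R[i]) (v : 'rV[R]_(m + m)) :
    'rV[R[i]]_m.+1 :=
  \row_k if unlift j k is Some k'
         then v 0 (lshift m k') +i* v 0 (rshift m k') else a.

(* The Fubini-Study (c = 1) or Bergman (c = -1) metric in the chart CQchart j:
   with Z a lift of the point, V and W lifts of the tangent vectors,
   c Re (<V, W> / <Z, Z> - <V, Z> <Z, W> / <Z, Z>^2).  It makes z |-> [z] a
   Riemannian submersion from the unit sphere <z, z> = 1 (resp. the anti-de
   Sitter space <z, z> = -1), hence has holomorphic sectional curvature 4c. *)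
Definition CQmetric (j : 'I_m.+1) (x : 'rV[R]_(m + m)) : 'M[R]_(m + m) :=
  \matrix_(a, b)
    let Z := hcoord j 1 x in
    let V := hcoord j 0 (delta_mx 0 a) in
    let W := hcoord j 0 (delta_mx 0 b) in
    c * complex.Re (herm V W / herm Z Z
                    - herm V Z * herm Z W / herm Z Z ^+ 2).

(* Multiplication by the imaginary unit, (x, y) |-> (- y, x). *)
Definition Jmx : 'M[R]_(m + m) := block_mx 0 1%:M (- 1%:M) 0.

Variables (M : topologicalType) (n : nat) (F : M -> {vspace 'rV[R[i]]_m.+1}).

Definition local_dom (a : chart R M n) (j : 'I_m.+1) : set 'rV[R]_n :=
  cmap a @` (cdom a `&` F @^-1` CQdom j).

Definition local_map (a : chart R M n) (j : 'I_m.+1) :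
    'rV[R]_n -> 'rV[R]_(m + m) :=
  fun x => CQchart j (F (cinv a x)).

(* The openness condition amounts to the continuity of F in the presence of
   the smoothness of its local expressions. *)
Definition immersion (atlas : set (chart R M n)) : Prop :=
  (forall p, CQ (F p)) /\
  forall a j, atlas a ->
    [/\ open (F @^-1` CQdom j),
        smooth_on (local_dom a j) (local_map a j) &
        forall x, local_dom a j x -> \rank (dmap (local_map a j) x) = n].

End SpaceForm.

(* Main.v *)
(* In an affine chart the metric of CQ^m is c times the real part of the complex
   Hessian d' d'' ln |<Z, Z>|, its Levi-Civita connection is
   u, v |-> - (al(u) v + al(v) u) with al = <., Z> / <Z, Z>, and differentiating
   once more gives the curvature tensor of constant holomorphic sectional
   curvature 4c.  Decomposing the covariant derivatives of phi, xi and
   J phi along the hypersurface into tangential and normal parts yields the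
   equations of Gauss, Weingarten and Codazzi and the formulas
   nabla_X U = S A X and (nabla_X S) Y = <Y, U> A X - <A X, Y> U.

   In sum_i (nabla^2_(e_i, e_i) A) X, the Codazzi equation moves X to the second
   differentiation slot, the Ricci identity to the first one, and the Codazzi
   equation again leaves nabla_X (grad tr A), up to curvature terms and covariant
   derivatives of the Codazzi defect, which are traces of products of A and S.
   The second formula is the trace of the first one against A, since
   Hess (tr A^2)(u, v) = 2 tr (A nabla^2_(u, v) A) + 2 tr (nabla_u A nabla_v A). *)

(* Smoothness is a statement about iterated directional derivatives, so linearity in the direction
   and symmetry of second derivatives must be extracted from the mean value theorem before any
   tensor calculus can start.

   All tensors are differentiated along constant coordinate directions. Their brackets vanish, so
   torsion-freeness becomes the symmetry [v *m Gam u x = u *m Gam v x] of the connection matrices,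
   and curvature is an expression in these matrices and their derivatives. The operators on
   arbitrary fields that occur in the statement are reduced to this calculus separately: there the
   derivatives of the frame fields cancel.

   The ambient chart enters only up to the structure equations. The Simons computation sees the
   hypersurface through the identities between [g], [A], [S] and [U] listed as hypotheses of its
   section. It is pointwise algebra, apart from one differentiation of the Codazzi equation. *)
Require Import Defs.
From HB Require Import structures.
From mathcomp Require Import all_boot all_order all_algebra.
From mathcomp Require Import all_classical all_reals all_analysis.
From mathcomp Require Import complex.
From mathcomp Require Import ring lra.

Set Implicit Arguments.
Unset Strict Implicit.
Unset Printing Implicit Defensive.

Import Order.TTheory GRing.Theory Num.Theory.
Import numFieldNormedType.Exports.

Local Open Scope classical_set_scope.
Local Open Scope ring_scope.
Local Open Scope complex_scope.

(** * Calculus of smooth maps *)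

Section DirectionalDerivatives.
Variables (R : realType) (E : normedModType R).
Implicit Types (f : E -> R) (x u v : E).

Lemma is_derive_line f x v t :
  derivable f (x + t *: v) v ->
  is_derive t 1 (fun s : R => f (x + s *: v)) ('D_v f (x + t *: v)).
Proof.
have eqq : (fun h : R => h^-1 *: (f (x + (h *: 1 + t) *: v) - f (x + t *: v))) =
   (fun h => h^-1 *: (f (h *: v + (x + t *: v)) - f (x + t *: v))).
  apply/funext => h; congr (_ *: (f _ - _)).
  by rewrite scalerDl addrCA [h *: 1]mulr1.
move=> df; split; first by rewrite /derivable /= eqq.
by rewrite /derive /= eqq.
Qed.

(** Precomposing [h |-> f (h *: v + x)] with [h |-> h * k] reduces the claim to the chain rule in
    one variable. *)
Lemma derivable_scaledir f x v (k : R) :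
  derivable f x v -> is_derive x (k *: v) f (k * 'D_v f x).
Proof.
move=> df; have [->|k0] := eqVneq k 0.
  by rewrite scale0r mul0r; exact: is_derive0.
have /derivable1P/derivableP := df => d1.
have : is_derive (0 : R) 1 (fun h : R => f ((h * k) *: v + x)) (k * 'D_v f x).
  have d2 : is_derive (0 : R) 1 (fun h : R => h * k) k.
    have := @is_deriveM _ _ id (cst k) 0 1 _ _ (is_derive_id _ _) (is_derive_cst _ _ _).
    by rewrite scaler0 add0r [_ *: 1]mulr1.
  have isd : is_derive ((fun h : R => h * k) 0) 1 (fun h : R => f (h *: v + x)) ('D_v f x).
    rewrite mul0r; have := @is_derive_line f x v 0.
    rewrite scale0r addr0 => /(_ df).
    by under eq_fun do rewrite addrC.
  have := @is_derive1_comp _ (fun h : R => f (h *: v + x)) (fun h : R => h * k) 0 _ _ isd d2.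
  by rewrite mulrC.
move=> [d3 e3].
have eqq : (fun h : R => h^-1 *: (f (h *: (k *: v) + x) - f x)) =
   (fun h : R => h^-1 *: (f (((h *: 1 + 0) * k) *: v + x) - f ((0 * k) *: v + x))).
  by apply/funext => h; rewrite mul0r scale0r add0r addr0 [h *: 1]mulr1 scalerA.
split; first by rewrite /derivable /= eqq.
by rewrite -e3 /derive /= eqq.
Qed.

Lemma is_derive_scaled_line f x v (h t : R) :
  derivable f (x + t *: (h *: v)) v ->
  is_derive t 1 (fun s : R => f (x + s *: (h *: v)))
    (h * 'D_v f (x + t *: (h *: v))).
Proof.
by move=> /(derivable_scaledir h)[d <-]; exact: is_derive_line.
Qed.

(** The increment is along [h *: v] but the derivative along [v], so that the factor [h] stands
    outside, ready to be cancelled in difference quotients. *)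
Lemma MVT_line f x v (h : R) :
  (forall t : R, 0 <= t <= 1 -> derivable f (x + t *: (h *: v)) v) ->
  exists2 t : R, 0 <= t <= 1 &
    f (x + h *: v) - f x = h * 'D_v f (x + t *: (h *: v)).
Proof.
move=> df.
have isd (t : R) : 0 <= t <= 1 ->
    is_derive t 1 (fun s : R => f (x + s *: (h *: v)))
      (h * 'D_v f (x + t *: (h *: v))).
  by move=> /df; exact: is_derive_scaled_line.
have [||c] := @MVT_segment R (fun s => f (x + s *: (h *: v)))
  (fun t => h * 'D_v f (x + t *: (h *: v))) 0 1 ler01.
- by move=> t; rewrite in_itv /= => /andP[t0 t1]; apply: isd; rewrite !ltW.
- apply: derivable_within_continuous => t; rewrite in_itv /= => t01.
  by have [] := isd _ t01.
by rewrite in_itv /= => c01; rewrite scale1r scale0r addr0 subr0 mulr1; exists c.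
Qed.

(** Two successive mean value steps produce intermediate points anywhere in this parallelogram, so a
    single bound on [h] has to serve all [s] and [t]. *)
Lemma near_parallelogram x u v (B : set E) : nbhs x B ->
  \forall h \near (0 : R), forall s t : R, 0 <= s <= 1 -> 0 <= t <= 1 ->
    B (x + s *: (h *: u) + t *: (h *: v)).
Proof.
move=> /nbhs_ballP[e /= e0 eB].
(* The summand 1 keeps [M] positive when [u] and [v] both vanish. *)
pose M := `|u| + `|v| + 1.
have M0 : 0 < M by rewrite ltr_wpDl ?addr_ge0.
have nM : \forall h \near (0 : R), `|h| < e / M.
  exists (e / M); first by rewrite /= divr_gt0.
  by move=> h /=; rewrite sub0r normrN.
near=> h => s t /andP[s0 s1] /andP[t0 t1].
apply: eB; rewrite -ball_normE /ball_ /=.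
rewrite -addrA opprD addNKr normrN (le_lt_trans (ler_normD _ _))//.
have hM : `|h| * M < e.
  by rewrite -ltr_pdivlMr//; near: h; exact: nM.
apply: le_lt_trans hM; rewrite !normrZ (ger0_norm s0) (ger0_norm t0).
have hu : 0 <= `|h| * `|u| by rewrite mulr_ge0.
have hv : 0 <= `|h| * `|v| by rewrite mulr_ge0.
have h0 : 0 <= `|h| by [].
have := ler_wpM2r hu s1; have := ler_wpM2r hv t1.
rewrite /M; nra.
Unshelve. all: by end_near. Qed.

(* Split the increment along [u + v] into one along [u] and one along [v] and
   apply the mean value theorem to each. *)
Lemma derive_adddir f x u v :
  (\forall y \near x, derivable f y u) -> (\forall y \near x, derivable f y v) ->
  {for x, continuous ('D_u f)} -> {for x, continuous ('D_v f)} ->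
  'D_(u + v) f x = 'D_u f x + 'D_v f x.
Proof.
move=> du dv cu cv; apply: cvg_lim => //=.
apply/cvgrPdist_le => e e0.
have e20 : 0 < e / 2 by rewrite divr_gt0.
have Hu : \forall y \near x, `|'D_u f x - 'D_u f y| <= e / 2.
  by move/cvgrPdist_le : cu => /(_ _ e20).
have Hv : \forall y \near x, `|'D_v f x - 'D_v f y| <= e / 2.
  by move/cvgrPdist_le : cv => /(_ _ e20).
have H4 := near_parallelogram u v (@filterI _ (nbhs x) _ _ _ (@filterI _ (nbhs x) _ _ _ du dv)
  (@filterI _ (nbhs x) _ _ _ Hu Hv)).
rewrite near_withinE; near=> h => hn0.
have /= P4 : forall s t : R, 0 <= s <= 1 -> 0 <= t <= 1 ->
    (derivable f (x + s *: (h *: u) + t *: (h *: v)) u /\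
     derivable f (x + s *: (h *: u) + t *: (h *: v)) v) /\
    `|'D_u f x - 'D_u f (x + s *: (h *: u) + t *: (h *: v))| <= e / 2 /\
    `|'D_v f x - 'D_v f (x + s *: (h *: u) + t *: (h *: v))| <= e / 2.
  by near: h; exact: H4.
have z01 : 0 <= (0 : R) <= 1 by rewrite lexx ler01.
have o01 : 0 <= (1 : R) <= 1 by rewrite lexx ler01.
have [|s s01 Es] := @MVT_line f x u h.
  by move=> s s01; have [[+ _] _] := P4 s 0 s01 z01; rewrite scale0r addr0.
have [|t t01 Et] := @MVT_line f (x + h *: u) v h.
  by move=> t t01; have [[_ +] _] := P4 1 t o01 t01; rewrite scale1r.
have [_ [bs _]] := P4 s 0 s01 z01; rewrite scale0r addr0 in bs.
have [_ [_ bt]] := P4 1 t o01 t01; rewrite scale1r in bt.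
have -> : h^-1 *: (f (h *: (u + v) + x) - f x) =
   'D_u f (x + s *: (h *: u)) + 'D_v f (x + h *: u + t *: (h *: v)).
  rewrite [_ + x]addrC (scalerDr h) addrA -(subrKA (f (x + h *: u))) Es Et addrC -mulrDr.
  by rewrite [_ *: _]mulrA mulVf// mul1r.
rewrite opprD addrACA (le_trans (ler_normD _ _))// [leRHS]splitr.
exact: lerD.
Unshelve. all: by end_near. Qed.

(** The mean value theorem is applied to the difference of [f] on two parallel sides of the
    parallelogram, then to ['D_u f] along [v]. The left side is symmetric in [u] and [v], which is
    what links the two mixed derivatives. *)
Lemma second_difference f x u v (h : R) :
  (forall s t : R, 0 <= s <= 1 -> 0 <= t <= 1 ->
    derivable f (x + s *: (h *: u) + t *: (h *: v)) u /\
    derivable ('D_u f) (x + s *: (h *: u) + t *: (h *: v)) v) ->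
  exists s t : R, [/\ 0 <= s <= 1, 0 <= t <= 1 &
    f (x + h *: u + h *: v) - f (x + h *: u) - (f (x + h *: v) - f x) =
    h * (h * 'D_v ('D_u f) (x + s *: (h *: u) + t *: (h *: v)))].
Proof.
move=> H.
have z01 : 0 <= (0 : R) <= 1 by rewrite lexx ler01.
have o01 : 0 <= (1 : R) <= 1 by rewrite lexx ler01.
pose g (s : R) := f (x + h *: v + s *: (h *: u)) - f (x + s *: (h *: u)).
pose dg (s : R) := h * 'D_u f (x + h *: v + s *: (h *: u))
                   - h * 'D_u f (x + s *: (h *: u)).
have isd (s : R) : 0 <= s <= 1 -> is_derive s 1 g (dg s).
  move=> s01; apply: is_deriveB; apply: is_derive_scaled_line.
    by have [d _] := H s 1 s01 o01; rewrite scale1r addrAC in d.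
  by have [d _] := H s 0 s01 z01; rewrite scale0r addr0 in d.
have [||s] := @MVT_segment R g dg 0 1 ler01.
- by move=> t; rewrite in_itv /= => /andP[t0 t1]; apply: isd; rewrite !ltW.
- apply: derivable_within_continuous => t; rewrite in_itv /= => t01.
  by have [] := isd _ t01.
rewrite in_itv /= => s01; rewrite /g /dg !scale1r !scale0r !addr0 subr0 mulr1 => Es.
have [|t t01 Et] := @MVT_line ('D_u f) (x + s *: (h *: u)) v h.
  by move=> t t01; have [] := H s t s01 t01.
exists s, t; split=> //.
rewrite -Et mulrBr (addrAC x (s *: (h *: u))) -Es (addrAC x (h *: v)).
by [].
Qed.

(** Schwarz's theorem: the same second difference is [h * h] times either mixed derivative at some
    nearby point. Cancelling [h] twice and using continuity at [x] bounds the discrepancy by any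
    [e > 0]. *)
Lemma derive_comm f x u v :
  (\forall y \near x, [/\ derivable f y u, derivable f y v,
     derivable ('D_u f) y v & derivable ('D_v f) y u]) ->
  {for x, continuous ('D_v ('D_u f))} -> {for x, continuous ('D_u ('D_v f))} ->
  'D_v ('D_u f) x = 'D_u ('D_v f) x.
Proof.
move=> D cu cv; apply/eqP; rewrite -subr_eq0 -normr_le0; apply/ler_addgt0Pr => e e0.
rewrite add0r.
have e20 : 0 < e / 2 by rewrite divr_gt0.
have Hu : \forall y \near x, `|'D_v ('D_u f) x - 'D_v ('D_u f) y| <= e / 2.
  by move/cvgrPdist_le : cu => /(_ _ e20).
have Hv : \forall y \near x, `|'D_u ('D_v f) x - 'D_u ('D_v f) y| <= e / 2.
  by move/cvgrPdist_le : cv => /(_ _ e20).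
have NB : nbhs x (fun y => [/\ derivable f y u, derivable f y v,
     derivable ('D_u f) y v & derivable ('D_v f) y u] /\
   `|'D_v ('D_u f) x - 'D_v ('D_u f) y| <= e / 2 /\
   `|'D_u ('D_v f) x - 'D_u ('D_v f) y| <= e / 2).
  exact: (@filterI _ (nbhs x) _ _ _ D (@filterI _ (nbhs x) _ _ _ Hu Hv)).
have [h h0 P] : exists2 h : R, h != 0 & forall s t : R, 0 <= s <= 1 -> 0 <= t <= 1 ->
   let y := x + s *: (h *: u) + t *: (h *: v) in
   [/\ derivable f y u, derivable f y v,
     derivable ('D_u f) y v & derivable ('D_v f) y u] /\
   `|'D_v ('D_u f) x - 'D_v ('D_u f) y| <= e / 2 /\
   `|'D_u ('D_v f) x - 'D_u ('D_v f) y| <= e / 2.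
  have /nbhs_ballP[d /= d0 dP] := near_parallelogram u v NB; exists (d / 2).
    by rewrite gt_eqF ?divr_gt0.
  apply: dP; rewrite -ball_normE /ball_ /= sub0r normrN gtr0_norm ?divr_gt0//.
  by rewrite ltr_pdivrMr// ltr_pMr// ltr1n.
have [|s1 [t1 [s101 t101 E1]]] := @second_difference f x u v h.
  by move=> s t s01 t01; have [[]] := P s t s01 t01.
have [|s2 [t2 [s201 t201 E2]]] := @second_difference f x v u h.
  move=> s t s01 t01; have [[_ d2 _ d4] _] := P t s t01 s01.
  apply: (eq_ind _ (fun y => derivable f y v /\ derivable ('D_v f) y u) _ _
    (addrAC _ _ _)).
  exact: (conj d2 d4).
have [_ [B1 _]] := P _ _ s101 t101.
have [_ [_ B2]] := P _ _ t201 s201.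
rewrite (addrAC x (t2 *: (h *: u))) in B2.
have : h * (h * 'D_v ('D_u f) (x + s1 *: (h *: u) + t1 *: (h *: v))) =
    h * (h * 'D_u ('D_v f) (x + s2 *: (h *: v) + t2 *: (h *: u))).
  apply: etrans (esym E1) (etrans _ E2).
  have -> : f (x + h *: v + h *: u) = f (x + h *: u + h *: v).
    by congr f; exact: addrAC.
  by rewrite !opprD !opprK !addrA; congr (_ + _); exact: addrAC.
move=> /(mulfI h0)/(mulfI h0) E12; rewrite E12 in B1.
move: B1 B2; move: ('D_v ('D_u f) x) ('D_u ('D_v f) x) => p q.
move: ('D_u ('D_v f) _) => r B1 B2.
clear -B1 B2; rewrite -(subrKA r); apply: le_trans (ler_normD _ _) _.
by rewrite [leRHS]splitr; apply: lerD; rewrite // distrC.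
Qed.

End DirectionalDerivatives.

(** * Algebra and calculus rules for smooth real functions on an open set *)

Section SmoothFunctions.
Variables (R : realType) (E : normedModType R) (V : set E).
Hypothesis Vo : open V.
Implicit Types (f g : E -> R) (x u v : E).

Lemma open_near x : V x -> \forall y \near x, V y.
Proof. by move=> Vx; exact: open_nbhs_nbhs. Qed.

Lemma derive_eq_on (W : normedModType R) (f g : E -> W) x v :
  (forall y, V y -> f y = g y) -> V x -> 'D_v f x = 'D_v g x.
Proof.
move=> fg Vx; apply: near_eq_derive; near=> y; apply: fg.
by near: y; exact: open_near.
Unshelve. all: by end_near. Qed.

Lemma Ck_eq_on (W : normedModType R) k (f g : E -> W) :
  (forall y, V y -> f y = g y) -> Ck k V f -> Ck k V g.
Proof.
elim: k f g => [|k IH] f g fg /=.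
  move=> cf x Vx; rewrite /prop_for /continuous_at -(fg _ Vx).
  apply: cvg_trans (cf x Vx); apply: near_eq_cvg; near=> y; apply: fg.
  by near: y; exact: open_near.
move=> [df kf]; split.
  move=> x v Vx; apply: (@near_eq_derivable _ _ _ f); last exact: df.
  by near=> y; apply: fg; near: y; exact: open_near.
move=> v; apply: IH (kf v) => y Vy; exact: derive_eq_on.
Unshelve. all: by end_near. Qed.

Lemma smooth_eq_on (W : normedModType R) (f g : E -> W) :
  (forall y, V y -> f y = g y) -> smooth_on V f -> smooth_on V g.
Proof. by move=> fg sf k; exact: Ck_eq_on (sf k). Qed.

Lemma smooth_derivable (W : normedModType R) (f : E -> W) x v :
  smooth_on V f -> V x -> derivable f x v.
Proof. by move=> sf; have [+ _] := sf 1; exact. Qed.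

Lemma smooth_continuous (W : normedModType R) (f : E -> W) x :
  smooth_on V f -> V x -> {for x, continuous f}.
Proof. by move=> sf; exact: (sf 0). Qed.

Lemma smooth_derive (W : normedModType R) (f : E -> W) v :
  smooth_on V f -> smooth_on V ('D_v f).
Proof. by move=> sf k; have [_] := sf k.+1; exact. Qed.

Lemma smooth_cst (W : normedModType R) (w : W) : smooth_on V (cst w).
Proof.
move=> k; elim: k w => [|k IH] w; first by move=> x _; exact: cvg_cst.
split=> [x v _|v]; first exact: derivable_cst.
by apply: Ck_eq_on (IH 0) => y _; rewrite derive_cst.
Qed.

Lemma CkD k f g : Ck k V f -> Ck k V g -> Ck k V (fun x => f x + g x).
Proof.
elim: k f g => [|k IH] f g /=.
  by move=> cf cg x Vx; apply: cvgD; [exact: cf|exact: cg].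
move=> [df kf] [dg kg]; split=> [x v Vx|v].
  by apply: derivableD; [exact: df|exact: dg].
apply: (@Ck_eq_on _ _ (fun x => 'D_v f x + 'D_v g x)).
  by move=> y Vy; rewrite -deriveD//; [exact: df|exact: dg].
exact: IH.
Qed.

Lemma smoothD f g :
  smooth_on V f -> smooth_on V g -> smooth_on V (fun x => f x + g x).
Proof. by move=> sf sg k; apply: CkD. Qed.

(** The factors are taken smooth because the product rule leaves one factor undifferentiated: the
    induction on [k] then applies to [f * 'D_v g] without having to compare the classes [Ck k] and
    [Ck k.+1]. *)
Lemma CkM k f g : smooth_on V f -> smooth_on V g -> Ck k V (fun x => f x * g x).
Proof.
elim: k f g => [|k IH] f g sf sg.
  by move=> x Vx; apply: cvgM; exact: smooth_continuous.
split=> [x v Vx|v].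
  by apply: derivableM; exact: smooth_derivable.
apply: (@Ck_eq_on _ _ (fun x => f x * 'D_v g x + g x * 'D_v f x)).
  by move=> y Vy; rewrite deriveM//; exact: smooth_derivable.
by apply: CkD; apply: IH => //; exact: smooth_derive.
Qed.

Lemma smoothM f g :
  smooth_on V f -> smooth_on V g -> smooth_on V (fun x => f x * g x).
Proof. by move=> sf sg k; apply: CkM. Qed.

Lemma smoothN f : smooth_on V f -> smooth_on V (fun x => - f x).
Proof.
move=> sf; apply: (@smooth_eq_on _ (fun x => (cst (-1) x) * f x)).
  by move=> y _; rewrite mulN1r.
by apply: smoothM => //; exact: smooth_cst.
Qed.

Lemma smooth_sum (I : Type) (r : seq I) (P : pred I) (F : I -> E -> R) :
  (forall i, P i -> smooth_on V (F i)) ->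
  smooth_on V (fun x => \sum_(i <- r | P i) F i x).
Proof.
move=> sF; elim: r => [|i r IH].
  by apply: smooth_eq_on (smooth_cst 0) => y _; rewrite big_nil.
under eq_fun do rewrite big_cons.
case Pi: (P i) => //; apply: smoothD => //; exact: sF.
Qed.

Lemma smooth_prod (I : Type) (r : seq I) (P : pred I) (F : I -> E -> R) :
  (forall i, P i -> smooth_on V (F i)) ->
  smooth_on V (fun x => \prod_(i <- r | P i) F i x).
Proof.
move=> sF; elim: r => [|i r IH].
  by apply: smooth_eq_on (@smooth_cst R (1 : R)) => y _; rewrite big_nil.
under eq_fun do rewrite big_cons.
case Pi: (P i) => //; apply: smoothM => //; exact: sF.
Qed.

(** The family [g / f ^ p], over all [g] and [p], is closed under differentiation up to sums; the
    reciprocal alone would not give an induction hypothesis strong enough. *)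
Lemma CkV k p f g : smooth_on V g -> smooth_on V f ->
  (forall x, V x -> f x != 0) -> Ck k V (fun x => g x * (f x)^-1 ^+ p).
Proof.
move=> + sf f0; elim: k p g => [|k IH] p g sg.
  move=> x Vx; apply: cvgM; first exact: smooth_continuous.
  have cV : {for x, continuous (fun y => (f y)^-1)}.
    by apply: cvgV; [exact: f0|exact: smooth_continuous].
  elim: p => [|p IHp]; first exact: cvg_cst.
  by under eq_fun do rewrite exprS; rewrite /prop_for /continuous_at exprS; exact: (cvgM cV IHp).
have dfV x v : V x -> is_derive x v (fun y => (f y)^-1) (- (f x) ^- 2 *: 'D_v f x).
  move=> Vx; have df : derivable f x v by exact: smooth_derivable.
  by split; [exact: derivableV (f0 _ Vx) df|rewrite deriveV//; exact: f0].
have D x v : V x -> is_derive x v (fun y => g y * (f y)^-1 ^+ p)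
    ('D_v g x * (f x)^-1 ^+ p + - p%:R * (g x * 'D_v f x) * (f x)^-1 ^+ p.+1).
  move=> Vx; have dg : is_derive x v g ('D_v g x).
    by apply: derivableP; exact: smooth_derivable.
  have dV := dfV x v Vx.
  have -> : (fun y => g y * (f y)^-1 ^+ p) = g * (fun y => (f y)^-1) ^+ p.
    by apply/funext => y; rewrite /GRing.mul /= exprfctE.
  apply: (is_derive_eq (is_deriveM dg (is_deriveX p dV))).
  rewrite /GRing.scale /= -exprVn.
  case: p {IH} => [|p]; first by rewrite /= !mul0r oppr0 !mul0r mulr0 add0r addr0 expr0 mulr1 mul1r.
  rewrite /= !exprfctE. rewrite !exprS; ring.
split=> [x v Vx|v]; first by have [] := D x v Vx.
apply: (@Ck_eq_on _ _ (fun x => 'D_v g x * (f x)^-1 ^+ p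
    + - p%:R * (g x * 'D_v f x) * (f x)^-1 ^+ p.+1)).
  by move=> y Vy; have [_ ->] := D y v Vy.
apply: CkD; apply: IH; first exact: smooth_derive.
by apply: smoothM; [exact: smooth_cst|apply: smoothM => //; exact: smooth_derive].
Qed.

Lemma smoothV f : smooth_on V f -> (forall x, V x -> f x != 0) ->
  smooth_on V (fun x => (f x)^-1).
Proof.
move=> sf f0 k; apply: Ck_eq_on (@CkV k 1 f (cst 1) (smooth_cst _) sf f0).
by move=> y _ /=; rewrite mul1r expr1.
Qed.

Lemma smooth_derive_adddir f x u v : smooth_on V f -> V x ->
  'D_(u + v) f x = 'D_u f x + 'D_v f x.
Proof.
move=> sf Vx; apply: derive_adddir.
- by near=> y; apply: smooth_derivable => //; near: y; exact: open_near.
- by near=> y; apply: smooth_derivable => //; near: y; exact: open_near.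
- by apply: smooth_continuous Vx; exact: smooth_derive.
- by apply: smooth_continuous Vx; exact: smooth_derive.
Unshelve. all: by end_near. Qed.

Lemma smooth_derive_scaledir f x v (k : R) : smooth_on V f -> V x ->
  'D_(k *: v) f x = k * 'D_v f x.
Proof.
move=> sf Vx; have df : derivable f x v by exact: smooth_derivable.
by have [] := derivable_scaledir k df.
Qed.

Lemma smooth_derive_comm f x u v : smooth_on V f -> V x ->
  'D_v ('D_u f) x = 'D_u ('D_v f) x.
Proof.
move=> sf Vx; apply: derive_comm.
- near=> y; have Vy : V y by near: y; exact: open_near.
  by split; apply: (@smooth_derivable _ _ _ _ _ Vy) => //; exact: smooth_derive.
- by apply: smooth_continuous Vx; do 2 apply: smooth_derive.
- by apply: smooth_continuous Vx; do 2 apply: smooth_derive.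
Unshelve. all: by end_near. Qed.

End SmoothFunctions.

(** * Smooth matrix-valued maps *)

Section SmoothMatrices.
Variables (R : realType) (E : normedModType R) (V : set E).
Hypothesis Vo : open V.

(** Entrywise smoothness reduces every matrix rule to the scalar case; [smooth_on_mx] converts the
    hypotheses of the theorem to this form. *)
Definition smooth_mx p q (F : E -> 'M[R]_(p, q)) : Prop :=
  forall i j, smooth_on V (fun x => F x i j).

Lemma Ck_entry p q k (F : E -> 'M[R]_(p, q)) i j :
  Ck k V F -> Ck k V (fun x => F x i j).
Proof.
elim: k F => [|k IH] F /=.
  move=> cF x Vx; rewrite /prop_for.
  apply: (@continuous_comp _ _ _ F (fun M : 'M[R]_(p, q) => M i j)); first exact: cF.
  exact: coord_continuous.
move=> [dF kF]; split=> [x v Vx|v].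
  by move/derivable_mxP : (dF x v Vx).
apply: (@Ck_eq_on _ _ _ Vo _ _ (fun x => 'D_v F x i j)); last exact: IH.
by move=> y Vy; rewrite derive_mx ?mxE//; exact: dF.
Qed.

Lemma smooth_on_mx p q (F : E -> 'M[R]_(p, q)) : smooth_on V F -> smooth_mx F.
Proof. by move=> sF i j k; exact: Ck_entry. Qed.

Section Rules.
Variables (p q : nat).
Implicit Types (F G : E -> 'M[R]_(p, q)) (a : E -> R) (x u v : E).

Lemma smooth_mx_eq_on F G :
  (forall y, V y -> F y = G y) -> smooth_mx F -> smooth_mx G.
Proof.
by move=> FG sF i j; apply: (smooth_eq_on Vo) (sF i j) => y Vy; rewrite FG.
Qed.

Lemma smooth_mx_derivable F x v : smooth_mx F -> V x -> derivable F x v.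
Proof.
by move=> sF Vx; apply/derivable_mxP => i j; apply: smooth_derivable Vx.
Qed.

Lemma derive_entry F x v i j : smooth_mx F -> V x ->
  'D_v F x i j = 'D_v (fun y => F y i j) x.
Proof.
by move=> sF Vx; rewrite derive_mx ?mxE//; exact: smooth_mx_derivable.
Qed.

Lemma smooth_mx_derive F v : smooth_mx F -> smooth_mx ('D_v F).
Proof.
move=> sF i j; apply: (smooth_eq_on Vo) (smooth_derive v (sF i j)) => y Vy.
by rewrite derive_entry.
Qed.

Lemma smooth_mx_cst (C : 'M[R]_(p, q)) : smooth_mx (cst C).
Proof. by move=> i j; exact: smooth_cst. Qed.

Lemma smooth_mxD F G : smooth_mx F -> smooth_mx G -> smooth_mx (fun x => F x + G x).
Proof.
move=> sF sG i j; under eq_fun do rewrite mxE.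
exact: smoothD.
Qed.

Lemma smooth_mxN F : smooth_mx F -> smooth_mx (fun x => - F x).
Proof. by move=> sF i j; under eq_fun do rewrite mxE; exact: smoothN. Qed.

Lemma smooth_mxZ a F :
  smooth_on V a -> smooth_mx F -> smooth_mx (fun x => a x *: F x).
Proof. by move=> sa sF i j; under eq_fun do rewrite mxE; exact: smoothM. Qed.

Lemma smooth_mx_tr F : smooth_mx F -> smooth_mx (fun x => (F x)^T).
Proof. by move=> sF i j; under eq_fun do rewrite mxE; exact: sF. Qed.

Lemma derive_mxD F G x v : smooth_mx F -> smooth_mx G -> V x ->
  'D_v (fun y => F y + G y) x = 'D_v F x + 'D_v G x.
Proof. by move=> sF sG Vx; apply: deriveD; exact: smooth_mx_derivable. Qed.

Lemma derive_mxN F x v : smooth_mx F -> V x ->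
  'D_v (fun y => - F y) x = - 'D_v F x.
Proof. by move=> sF Vx; apply: deriveN; exact: smooth_mx_derivable. Qed.

Lemma derive_mxZ a F x v : smooth_on V a -> smooth_mx F -> V x ->
  'D_v (fun y => a y *: F y) x = 'D_v a x *: F x + a x *: 'D_v F x.
Proof.
move=> sa sF Vx; apply/matrixP => i j.
rewrite derive_entry//; last exact: smooth_mxZ.
under eq_fun do rewrite mxE.
rewrite deriveM; [|exact: smooth_derivable Vx|exact: smooth_derivable Vx].
rewrite !mxE (derive_entry v i j sF Vx) addrC.
by congr (_ + _); exact: mulrC.
Qed.

Lemma derive_mx_adddir F x u v : smooth_mx F -> V x ->
  'D_(u + v) F x = 'D_u F x + 'D_v F x.
Proof.
move=> sF Vx; apply/matrixP => i j.
rewrite mxE [X in X = _](derive_entry _ i j sF Vx) (derive_entry u i j sF Vx).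
rewrite (derive_entry v i j sF Vx).
exact: (smooth_derive_adddir Vo).
Qed.

Lemma derive_mx_scaledir F x v (k : R) : smooth_mx F -> V x ->
  'D_(k *: v) F x = k *: 'D_v F x.
Proof.
move=> sF Vx; apply/matrixP => i j.
rewrite mxE (derive_entry _ i j sF Vx) (derive_entry v i j sF Vx).
exact: (smooth_derive_scaledir (V := V)).
Qed.

Lemma derive_mx_comm F x u v : smooth_mx F -> V x ->
  'D_v ('D_u F) x = 'D_u ('D_v F) x.
Proof.
move=> sF Vx; apply/matrixP => i j.
rewrite [LHS](derive_entry v i j (smooth_mx_derive u sF) Vx).
rewrite [RHS](derive_entry u i j (smooth_mx_derive v sF) Vx).
transitivity ('D_v ('D_u (fun y => F y i j)) x).
  by apply: (derive_eq_on Vo) Vx => y Vy; exact: derive_entry.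
rewrite (smooth_derive_comm Vo u v (sF i j) Vx).
by apply: (derive_eq_on Vo) Vx => y Vy; rewrite (derive_entry v i j sF Vy).
Qed.

Lemma derive_mx_sumdir F x (I : Type) (r : seq I) (k : I -> R) (w : I -> E) :
  smooth_mx F -> V x ->
  'D_(\sum_(i <- r) k i *: w i) F x = \sum_(i <- r) k i *: 'D_(w i) F x.
Proof.
move=> sF Vx; elim: r => [|i r IH]; first by rewrite !big_nil derive0.
by rewrite !big_cons derive_mx_adddir// derive_mx_scaledir// IH.
Qed.

End Rules.

Lemma derive_mx_tr p q (F : E -> 'M[R]_(p, q)) x v : smooth_mx F -> V x ->
  'D_v (fun y => (F y)^T) x = ('D_v F x)^T.
Proof.
move=> sF Vx; apply/matrixP => i j.
rewrite derive_entry//; last exact: smooth_mx_tr.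
by under eq_fun do rewrite mxE; rewrite mxE derive_entry.
Qed.

Lemma smooth_mulmx p q r (F : E -> 'M[R]_(p, q)) (G : E -> 'M[R]_(q, r)) :
  smooth_mx F -> smooth_mx G -> smooth_mx (fun x => F x *m G x).
Proof.
move=> sF sG i j; under eq_fun do rewrite mxE.
by apply: (smooth_sum Vo) => k _; exact: smoothM.
Qed.

Lemma derive_real_sum (I : Type) (r : seq I) (F : I -> E -> R) x v :
  (forall i, smooth_on V (F i)) -> V x ->
  'D_v (fun y => \sum_(i <- r) F i y) x = \sum_(i <- r) 'D_v (F i) x.
Proof.
move=> sF Vx; elim: r => [|i r IH].
  by under eq_fun do rewrite big_nil; rewrite big_nil derive_cst.
under eq_fun do rewrite big_cons.
rewrite big_cons -IH; apply: deriveD; first exact: smooth_derivable Vx.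
by apply: smooth_derivable Vx; exact: (smooth_sum Vo).
Qed.

Lemma derive_mulmx p q r (F : E -> 'M[R]_(p, q)) (G : E -> 'M[R]_(q, r)) x v :
  smooth_mx F -> smooth_mx G -> V x ->
  'D_v (fun y => F y *m G y) x = 'D_v F x *m G x + F x *m 'D_v G x.
Proof.
move=> sF sG Vx; apply/matrixP => i j.
rewrite derive_entry//; last exact: smooth_mulmx.
under eq_fun do rewrite mxE.
rewrite derive_real_sum//; last by move=> k; exact: smoothM.
rewrite !mxE -big_split; apply: eq_bigr => k _ /=.
rewrite deriveM; [|exact: smooth_derivable Vx|exact: smooth_derivable Vx].
rewrite (derive_entry v i k sF Vx) (derive_entry v k j sG Vx) addrC.
by congr (_ + _); exact: mulrC.
Qed.

Lemma smooth_mxtrace p (F : E -> 'M[R]_p) :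
  smooth_mx F -> smooth_on V (fun x => \tr (F x)).
Proof. by move=> sF; apply: (smooth_sum Vo) => i _; exact: sF. Qed.

Lemma derive_mxtrace p (F : E -> 'M[R]_p) x v : smooth_mx F -> V x ->
  'D_v (fun y => \tr (F y)) x = \tr ('D_v F x).
Proof.
move=> sF Vx; rewrite derive_real_sum//; apply: eq_bigr => i _.
by rewrite derive_entry.
Qed.

Lemma smooth_det p (F : E -> 'M[R]_p) :
  smooth_mx F -> smooth_on V (fun x => \det (F x)).
Proof.
move=> sF; apply: (smooth_sum Vo) => s _; apply: (smoothM Vo); first exact: smooth_cst.
by apply: (smooth_prod Vo) => i _; exact: sF.
Qed.

(** By Cramer's rule the inverse is the adjugate over the determinant, both polynomial in the
    entries. *)
Lemma smooth_invmx p (F : E -> 'M[R]_p) : smooth_mx F ->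
  (forall x, V x -> F x \in unitmx) -> smooth_mx (fun x => invmx (F x)).
Proof.
move=> sF uF.
apply: (@smooth_mx_eq_on _ _ (fun x => (\det (F x))^-1 *: \adj (F x))).
  by move=> y Vy; rewrite /invmx uF.
apply: smooth_mxZ.
  apply: (smoothV Vo); first exact: smooth_det.
  by move=> x Vx; have := uF x Vx; rewrite unitmxE unitfE.
move=> i j; under eq_fun do rewrite mxE.
apply: (smoothM Vo); first exact: smooth_cst.
apply: smooth_det => k l; under eq_fun do rewrite !mxE.
exact: sF.
Qed.

End SmoothMatrices.

(** * The curvature of complex space forms in affine charts *)

Section Entries.
Variables (R : pzRingType) (p q : nat).
Implicit Types (A B : 'M[R]_(p, q)).

Lemma entryD A B i j : (A + B) i j = A i j + B i j. Proof. by rewrite mxE. Qed.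
Lemma entryN A i j : (- A) i j = - A i j. Proof. by rewrite mxE. Qed.
Lemma entryZ a A i j : (a *: A) i j = a * A i j. Proof. by rewrite mxE. Qed.

End Entries.

Definition entryE := (entryD, entryN, entryZ).

Section BilinearForms.
Variables (R : comUnitRingType) (N : nat).
Implicit Types (B : 'M[R]_N) (u v w : 'rV[R]_N).

Definition form B u v : R := (u *m B *m v^T) 0 0.

Lemma formDl B u v w : form B (u + v) w = form B u w + form B v w.
Proof. by rewrite /form !mulmxDl mxE. Qed.

Lemma formDr B u v w : form B u (v + w) = form B u v + form B u w.
Proof. by rewrite /form linearD mulmxDr mxE. Qed.

Lemma formZl B a u v : form B (a *: u) v = a * form B u v.
Proof. by rewrite /form -!scalemxAl mxE. Qed.

Lemma formZr B a u v : form B u (a *: v) = a * form B u v.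
Proof. by rewrite /form linearZ -scalemxAr mxE. Qed.

Lemma formNl B u v : form B (- u) v = - form B u v.
Proof. by rewrite -scaleN1r formZl mulN1r. Qed.

Lemma formNr B u v : form B u (- v) = - form B u v.
Proof. by rewrite -scaleN1r formZr mulN1r. Qed.

Lemma form0l B v : form B 0 v = 0.
Proof. by rewrite /form !mul0mx mxE. Qed.

Lemma form0r B v : form B v 0 = 0.
Proof. by rewrite /form trmx0 mulmx0 mxE. Qed.

Lemma form_sym B u v : B^T = B -> form B u v = form B v u.
Proof.
move=> sB; rewrite /form -[in LHS]sB.
by rewrite -[u *m _ *m _]trmxK mxE !trmx_mul !trmxK mulmxA.
Qed.

Lemma form_suml B (I : Type) (r : seq I) (F : I -> 'rV[R]_N) v :
  form B (\sum_(i <- r) F i) v = \sum_(i <- r) form B (F i) v.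
Proof.
by elim: r => [|i r IH]; rewrite ?big_nil ?form0l // !big_cons formDl IH.
Qed.

Lemma form_sumr B (I : Type) (r : seq I) (F : I -> 'rV[R]_N) v :
  form B v (\sum_(i <- r) F i) = \sum_(i <- r) form B v (F i).
Proof.
by elim: r => [|i r IH]; rewrite ?big_nil ?form0r // !big_cons formDr IH.
Qed.

Lemma form_delta B i j : form B (delta_mx 0 i) (delta_mx 0 j) = B i j.
Proof. by rewrite /form trmx_delta -rowE -colE !mxE. Qed.

Lemma form_nondeg B u v : B \in unitmx ->
  (forall w, form B u w = form B v w) -> u = v.
Proof.
move=> uB H; apply: (can_inj (mulmxK uB)).
apply/rowP => j; have := H (delta_mx 0 j).
by rewrite /form trmx_delta -!colE !mxE.
Qed.

End BilinearForms.

(* An affine chart of the space of complex lines: [potential z] is <Z, Z> for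
   the lift [Z] of [z] with constant coordinate, and [q] is the real part of the
   Hermitian form on the vectors tangent to the chart. *)
Section ProjectiveModel.
Variables (R : realType) (N : nat) (Q J : 'M[R]_N) (c kap : R).
Hypotheses (cc : c * c = 1) (Qsym : Q^T = Q) (JQ : J *m Q = Q *m J).
Hypotheses (JJ : J *m J = - 1%:M) (Jskew : J^T = - J).

Local Notation q := (form Q).
Local Notation "u ^J" := (u *m J) (at level 2, format "u ^J").
Implicit Types (u v w z f p s y : 'rV[R]_N).

Definition potential z : R := kap + q z z.

(* Half the differential of [ln |potential|]. *)
Definition dlogpot z v : R := q v z * (potential z)^-1.

Definition model_metric z : 'M[R]_N :=
  c *: ((potential z)^-1 *: Q - (potential z)^-1 ^+ 2 *:
    (Q *m z^T *m (z *m Q) + J *m Q *m z^T *m (z *m Q *m J^T))).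

(* With [al v] the complex number <v, Z> / <Z, Z>, this is
   [- (al u * v + al v * u)]: [dlogpot] is the real part of [al], and its
   imaginary part at [v] is [- dlogpot z v^J]. *)
Definition model_conn z u v : 'rV[R]_N :=
  - (dlogpot z u *: v - dlogpot z u^J *: v^J + dlogpot z v *: u - dlogpot z v^J *: u^J).

(** The curvature R(u, v) w of a complex space form. The normalisation can be read off a unit [u]
    with [v = w = u^J]: the first, fourth and fifth terms give (1 + 1 + 2) [u], the others vanish,
    hence holomorphic sectional curvature 4c. *)
Definition model_curv z u v w : 'rV[R]_N :=
  let B := model_metric z in
  c *: (form B v w *: u - form B u w *: v - form B w^J v *: u^J
        + form B w^J u *: v^J - (2 * form B u^J v) *: w^J).

Lemma mulJJ v : v^J^J = - v.
Proof. by rewrite -mulmxA JJ mulmxN mulmx1. Qed.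

Lemma modelC u v : q u v = q v u. Proof. exact: form_sym. Qed.

Lemma model_Jskew u v : q u^J v = - q u v^J.
Proof.
rewrite /form trmx_mul Jskew mulNmx mulmxN [in RHS]mxE opprK.
by rewrite -!mulmxA [J *m (Q *m _)]mulmxA JQ -!mulmxA.
Qed.

Lemma model_JJ u v : q u^J v^J = q u v.
Proof. by rewrite model_Jskew mulJJ formNr opprK. Qed.

(** The two products form the real part of al(u) times the conjugate of al(v), al being the
    complex-valued form <., Z> / <Z, Z>. *)
Lemma form_model_metric z u v : form (model_metric z) u v =
  c * (q u v * (potential z)^-1 - dlogpot z u * dlogpot z v
       - dlogpot z u^J * dlogpot z v^J).
Proof.
have mx11 (a b : 'M[R]_1) : (a *m b) 0 0 = a 0 0 * b 0 0.
  by rewrite mxE big_ord1.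
rewrite /form /model_metric -scalemxAr -scalemxAl entryZ; congr (_ * _).
rewrite mulmxBr mulmxBl -!scalemxAr -!scalemxAl mulmxDr mulmxDl !entryE.
have -> : u *m (Q *m z^T *m (z *m Q)) *m v^T = (u *m Q *m z^T) *m (z *m Q *m v^T).
  by rewrite !mulmxA.
have -> : u *m (J *m Q *m z^T *m (z *m Q *m J^T)) *m v^T
   = (u^J *m Q *m z^T) *m (z *m Q *m (v^J)^T).
  by rewrite trmx_mul !mulmxA.
rewrite !mx11 -!/(form _ _ _) (modelC z v) (modelC z v^J) /dlogpot; ring.
Qed.

Lemma model_metric_sym z : (model_metric z)^T = model_metric z.
Proof.
apply/matrixP => i j; rewrite mxE -!form_delta !form_model_metric.
rewrite (modelC (delta_mx 0 i)); ring.
Qed.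

Lemma dlogpotD z u v : dlogpot z (u + v) = dlogpot z u + dlogpot z v.
Proof. by rewrite /dlogpot formDl mulrDl. Qed.
Lemma dlogpotZ z a v : dlogpot z (a *: v) = a * dlogpot z v.
Proof. by rewrite /dlogpot formZl mulrA. Qed.
Lemma dlogpotN z v : dlogpot z (- v) = - dlogpot z v.
Proof. by rewrite /dlogpot formNl mulNr. Qed.

Lemma model_metric_J z u v : form (model_metric z) u^J v^J = form (model_metric z) u v.
Proof. by rewrite !form_model_metric !mulJJ !dlogpotN model_JJ; ring. Qed.

Lemma model_conn_sym z u v : model_conn z u v = model_conn z v u.
Proof. by apply/rowP=> k; rewrite !entryE; ring. Qed.

(** Complex bilinearity of the connection makes [J] parallel: the Kähler property. *)
Lemma model_conn_J z u v : model_conn z u v^J = (model_conn z u v)^J.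
Proof.
rewrite /model_conn mulJJ dlogpotN mulNmx !(mulmxDl, mulNmx) -!scalemxAl !mulJJ.
by apply/rowP=> k; rewrite !entryE; ring.
Qed.

(* Writing [r] for [1 / potential f], [- 2 q(p, f) r^2] is the derivative of [r]
   in the direction [p]. *)
Lemma model_compat f p y z y' z' :
  let r := (potential f)^-1 in
  let r' := - (2 * q p f * r ^+ 2) in
  let a := fun v => q v f in
  let a' := fun v v' => q v' f + q v p in
  c * ((q y' z + q y z') * r + q y z * r'
    - ((a' y y' * r + a y * r') * (a z * r) + (a y * r) * (a' z z' * r + a z * r'))
    - ((a' y^J y'^J * r + a y^J * r') * (a z^J * r)
       + (a y^J * r) * (a' z^J z'^J * r + a z^J * r'))) =
  form (model_metric f) (y' + model_conn f p y) z
  + form (model_metric f) y (z' + model_conn f p z).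
Proof.
move=> r r' a a'; rewrite formDl formDr !form_model_metric.
rewrite -!model_conn_J /model_conn !mulJJ.
rewrite !(dlogpotD, dlogpotN, dlogpotZ) !(formDl, formNl, formZl, formDr, formNr, formZr).
rewrite /a' /a /r' /dlogpot -/r. rewrite ?mulJJ ?formNl ?model_Jskew ?mulJJ ?formNr.
have -> : q z p^J = - q p z^J by rewrite modelC model_Jskew.
rewrite (modelC z p); ring.
Qed.

(* The [*_u], [*_v] variables stand for derivatives. *)
Lemma model_curvature f p s w s_u w_u w_v w_uv :
  let r := (potential f)^-1 in
  let al := dlogpot f in
  let d p v := q v p * r - 2 * q p f * q v f * r ^+ 2 in
  let conn_u p s s_u w w_u :=
    - ((d p s + al s_u) *: w + al s *: w_u
       - ((d p s^J + al s_u^J) *: w^J + al s^J *: w_u^J)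
       + ((d p w + al w_u) *: s + al w *: s_u)
       - ((d p w^J + al w_u^J) *: s^J + al w^J *: s_u^J)) in
  (w_uv + conn_u p s s_u w w_u + model_conn f p (w_v + model_conn f s w))
  - (w_uv + conn_u s p s_u w w_v + model_conn f s (w_u + model_conn f p w))
  = model_curv f p s w.
Proof.
move=> r al d conn_u; rewrite /model_curv /conn_u /d !form_model_metric.
rewrite {conn_u d} /model_conn.
rewrite !(mulmxDl, mulNmx) -!scalemxAl !mulJJ.
rewrite !(dlogpotD, dlogpotN, dlogpotZ).
apply/rowP => k; rewrite !entryE.
rewrite /al /dlogpot -/r.
rewrite ?mulJJ ?formNl ?model_Jskew ?mulJJ ?formNr.
have -> : q s p^J = - q p s^J by rewrite modelC model_Jskew.
(* The right side carries [c] twice, once in [model_curv] and once in the metric, so the left side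
   is multiplied by [c * c = 1]. *)
rewrite (modelC s p) (modelC w s) (modelC w p) -[LHS]mul1r -[X in X * _ = _]cc; ring.
Qed.

End ProjectiveModel.

Section DerivativeRules.
Variables (R : realType) (E : normedModType R) (V : set E).
Hypothesis Vo : open V.
Implicit Types (f g : E -> R) (x u v : E).

Lemma smooth_deriveD f g x v : smooth_on V f -> smooth_on V g -> V x ->
  'D_v (fun y => f y + g y) x = 'D_v f x + 'D_v g x.
Proof.
move=> sf sg Vx; apply: deriveD.
  exact: smooth_derivable sf Vx.
exact: smooth_derivable sg Vx.
Qed.

Lemma smooth_deriveN f x v : smooth_on V f -> V x ->
  'D_v (fun y => - f y) x = - 'D_v f x.
Proof. move=> sf Vx; apply: deriveN; exact: smooth_derivable sf Vx. Qed.

Lemma smooth_deriveM f g x v : smooth_on V f -> smooth_on V g -> V x ->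
  'D_v (fun y => f y * g y) x = 'D_v f x * g x + f x * 'D_v g x.
Proof.
move=> sf sg Vx; rewrite deriveM.
- by rewrite addrC; congr (_ + _); exact: mulrC.
- exact: smooth_derivable sf Vx.
- exact: smooth_derivable sg Vx.
Qed.

Lemma smooth_deriveV f x v : smooth_on V f -> V x -> f x != 0 ->
  'D_v (fun y => (f y)^-1) x = - ('D_v f x * (f x)^-1 ^+ 2).
Proof.
move=> sf Vx f0; rewrite deriveV//; last exact: smooth_derivable sf Vx.
by rewrite /GRing.scale /= mulNr mulrC exprVn.
Qed.

Lemma derive_const_on f (a : R) x v : (forall y, V y -> f y = a) -> V x ->
  'D_v f x = 0.
Proof. by move=> fa Vx; rewrite (derive_eq_on Vo v fa Vx) derive_cst. Qed.

Lemma derive_mulmxr p q r (F : E -> 'M[R]_(p, q)) (C : 'M[R]_(q, r)) x v :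
  smooth_mx V F -> V x -> 'D_v (fun y => F y *m C) x = 'D_v F x *m C.
Proof.
move=> sF Vx; rewrite (derive_mulmx Vo _ sF (smooth_mx_cst Vo C) Vx).
by rewrite derive_cst mulmx0 addr0.
Qed.

Lemma derive_mulmxl p q r (C : 'M[R]_(p, q)) (F : E -> 'M[R]_(q, r)) x v :
  smooth_mx V F -> V x -> 'D_v (fun y => C *m F y) x = C *m 'D_v F x.
Proof.
move=> sF Vx; rewrite (derive_mulmx Vo _ (smooth_mx_cst Vo C) sF Vx).
by rewrite derive_cst mul0mx add0r.
Qed.

Lemma smooth_mulmxr p q r (F : E -> 'M[R]_(p, q)) (C : 'M[R]_(q, r)) :
  smooth_mx V F -> smooth_mx V (fun y => F y *m C).
Proof. by move=> sF; apply: (smooth_mulmx Vo sF (smooth_mx_cst Vo C)). Qed.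

Lemma smooth_mulmxl p q r (C : 'M[R]_(p, q)) (F : E -> 'M[R]_(q, r)) :
  smooth_mx V F -> smooth_mx V (fun y => C *m F y).
Proof. by move=> sF; apply: (smooth_mulmx Vo (smooth_mx_cst Vo C) sF). Qed.

Section Form.
Variables (N : nat) (B : E -> 'M[R]_N) (Y Z : E -> 'rV[R]_N).
Hypotheses (sB : smooth_mx V B) (sY : smooth_mx V Y) (sZ : smooth_mx V Z).

Lemma smooth_form : smooth_on V (fun x => form (B x) (Y x) (Z x)).
Proof.
have sYB := smooth_mulmx Vo sY sB.
exact: (smooth_mulmx Vo sYB (smooth_mx_tr sZ) 0 0).
Qed.

Lemma derive_form x v : V x ->
  'D_v (fun x => form (B x) (Y x) (Z x)) x =
  form ('D_v B x) (Y x) (Z x) + form (B x) ('D_v Y x) (Z x)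
  + form (B x) (Y x) ('D_v Z x).
Proof.
move=> Vx; have sYB := smooth_mulmx Vo sY sB.
have sZt := smooth_mx_tr sZ.
have := derive_entry v 0 0 (smooth_mulmx Vo sYB sZt) Vx.
rewrite -/(form _ _ _) => <-.
rewrite (derive_mulmx Vo _ sYB sZt Vx) (derive_mulmx Vo _ sY sB Vx).
rewrite (derive_mx_tr _ sZ Vx) mulmxDl !entryD /form.
by congr (_ + _); rewrite addrC.
Qed.

End Form.

Lemma derive_form_cst N (B : 'M[R]_N) (Y Z : E -> 'rV[R]_N) x v :
  smooth_mx V Y -> smooth_mx V Z -> V x ->
  'D_v (fun x => form B (Y x) (Z x)) x =
  form B ('D_v Y x) (Z x) + form B (Y x) ('D_v Z x).
Proof.
move=> sY sZ Vx; rewrite (derive_form (smooth_mx_cst Vo B) sY sZ _ Vx).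
by rewrite derive_cst /form mulmx0 mul0mx mxE add0r.
Qed.

Lemma derive_form_fixed N (B : E -> 'M[R]_N) (a b : 'rV[R]_N) x v :
  smooth_mx V B -> V x -> 'D_v (fun x => form (B x) a b) x = form ('D_v B x) a b.
Proof.
move=> sB Vx; have := derive_form sB (smooth_mx_cst Vo a) (smooth_mx_cst Vo b) v Vx.
by rewrite (derive_cst a) (derive_cst b) form0l form0r !addr0.
Qed.

Lemma smooth_form_cst N (B : 'M[R]_N) (Y Z : E -> 'rV[R]_N) :
  smooth_mx V Y -> smooth_mx V Z -> smooth_on V (fun x => form B (Y x) (Z x)).
Proof. exact: smooth_form (smooth_mx_cst Vo B). Qed.

End DerivativeRules.

(** * Covariant differentiation of ambient vector fields along a map *)

Section FieldsAlong.
Variables (R : realType) (N : nat) (Q J : 'M[R]_N) (c kap : R).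
Hypotheses (cc : c * c = 1) (Qsym : Q^T = Q) (JQ : J *m Q = Q *m J).
Hypotheses (JJ : J *m J = - 1%:M) (Jskew : J^T = - J).
Variables (E : normedModType R) (V : set E) (phi : E -> 'rV[R]_N).
Hypotheses (Vo : open V) (sphi : smooth_mx V phi).
Hypothesis pot0 : forall x, V x -> potential Q kap (phi x) != 0.

Local Notation q := (form Q).
Local Notation pot := (potential Q kap).
Local Notation al := (dlogpot Q kap).
Local Notation G := (model_metric Q J c kap).
Local Notation conn := (model_conn Q J kap).
Implicit Types (x u v : E) (Y Z W : E -> 'rV[R]_N).

(** The pulled-back connection, for a map [phi] with arbitrary source: [phi = id] serves to identify
    the ambient Levi-Civita connection, and the local expression of the immersion gives the geometry
    of the hypersurface. *)
Definition along u W x : 'rV[R]_N := 'D_u W x + conn (phi x) ('D_u phi x) (W x).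

Lemma smooth_potential : smooth_on V (fun x => pot (phi x)).
Proof. apply: smoothD => //; [exact: smooth_cst|exact: smooth_form_cst]. Qed.

Lemma smooth_inv_potential : smooth_on V (fun x => (pot (phi x))^-1).
Proof. exact: (smoothV Vo smooth_potential pot0). Qed.

Lemma derive_inv_potential x u : V x ->
  'D_u (fun x => (pot (phi x))^-1) x =
  - (2 * q ('D_u phi x) (phi x) * (pot (phi x))^-1 ^+ 2).
Proof.
move=> Vx; rewrite (smooth_deriveV _ smooth_potential Vx (pot0 Vx)).
rewrite (smooth_deriveD _ (smooth_cst Vo kap) (smooth_form_cst Vo Q sphi sphi) Vx).
rewrite derive_cst add0r (derive_form_cst Vo _ _ sphi sphi Vx).
by rewrite (form_sym (phi x) _ Qsym); ring.
Qed.

Lemma smooth_dlogpot W : smooth_mx V W -> smooth_on V (fun x => al (phi x) (W x)).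
Proof.
move=> sW; apply: (smoothM Vo); first exact: smooth_form_cst.
exact: smooth_inv_potential.
Qed.

Lemma derive_dlogpot W x u : smooth_mx V W -> V x ->
  'D_u (fun x => al (phi x) (W x)) x =
  q (W x) ('D_u phi x) * (pot (phi x))^-1
  - 2 * q ('D_u phi x) (phi x) * q (W x) (phi x) * (pot (phi x))^-1 ^+ 2
  + al (phi x) ('D_u W x).
Proof.
move=> sW Vx.
rewrite (smooth_deriveM _ (smooth_form_cst Vo Q sW sphi) smooth_inv_potential Vx).
rewrite (derive_form_cst Vo _ _ sW sphi Vx) (derive_inv_potential _ Vx).
rewrite /dlogpot; move: (q ('D_u W x) _) (q (W x) ('D_u phi x)) (q (W x) (phi x)).
move: (q ('D_u phi x) _) (_^-1) => *; ring.
Qed.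

Lemma smooth_metric_form Y Z : smooth_mx V Y -> smooth_mx V Z ->
  smooth_on V (fun x => form (G (phi x)) (Y x) (Z x)).
Proof.
move=> sY sZ.
under eq_fun do rewrite (form_model_metric J c kap Qsym).
apply: (smoothM Vo); first exact: smooth_cst.
have sYJ := smooth_mulmxr Vo J sY; have sZJ := smooth_mulmxr Vo J sZ.
have sr := smooth_inv_potential.
by repeat first [exact: smooth_form_cst | exact: smooth_dlogpot | exact: sr
  | apply: (smoothD Vo) | apply: (smoothN Vo) | apply: (smoothM Vo)].
Qed.

Lemma derive_metric_form Y Z x u : smooth_mx V Y -> smooth_mx V Z -> V x ->
  'D_u (fun x => form (G (phi x)) (Y x) (Z x)) x =
  form (G (phi x)) (along u Y x) (Z x) + form (G (phi x)) (Y x) (along u Z x).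
Proof.
move=> sY sZ Vx.
have sYJ := smooth_mulmxr Vo J sY; have sZJ := smooth_mulmxr Vo J sZ.
have sr := smooth_inv_potential.
have s1 := smoothM Vo (smooth_form_cst Vo Q sY sZ) sr.
have s2 := smoothN Vo (smoothM Vo (smooth_dlogpot sY) (smooth_dlogpot sZ)).
have s3 := smoothN Vo (smoothM Vo (smooth_dlogpot sYJ) (smooth_dlogpot sZJ)).
under eq_fun do rewrite (form_model_metric J c kap Qsym).
rewrite (smooth_deriveM _ (smooth_cst Vo c) (smoothD Vo (smoothD Vo s1 s2) s3) Vx).
rewrite derive_cst mul0r add0r.
rewrite (smooth_deriveD _ (smoothD Vo s1 s2) s3 Vx) (smooth_deriveD _ s1 s2 Vx).
rewrite (smooth_deriveM _ (smooth_form_cst Vo Q sY sZ) sr Vx).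
rewrite (smooth_deriveN _ (smoothM Vo (smooth_dlogpot sY) (smooth_dlogpot sZ)) Vx).
rewrite (smooth_deriveN _ (smoothM Vo (smooth_dlogpot sYJ) (smooth_dlogpot sZJ)) Vx).
rewrite (smooth_deriveM _ (smooth_dlogpot sY) (smooth_dlogpot sZ) Vx).
rewrite (smooth_deriveM _ (smooth_dlogpot sYJ) (smooth_dlogpot sZJ) Vx).
rewrite (derive_form_cst Vo _ _ sY sZ Vx) (derive_inv_potential _ Vx).
rewrite (derive_dlogpot _ sY Vx) (derive_dlogpot _ sZ Vx).
rewrite (derive_dlogpot _ sYJ Vx) (derive_dlogpot _ sZJ Vx).
rewrite (derive_mulmxr Vo _ _ sY Vx) (derive_mulmxr Vo _ _ sZ Vx).
rewrite /along; clear s1 s2 s3 sYJ sZJ sr sY sZ.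
move: ('D_u phi x) ('D_u Y x) ('D_u Z x) (phi x) (Y x) (Z x) => p y' z' f y z.
rewrite -(model_compat c kap Qsym JQ JJ Jskew) /dlogpot /cst.
move: (potential _ _ _)^-1 => r; ring.
Qed.

Lemma smooth_model_conn Y Z : smooth_mx V Y -> smooth_mx V Z ->
  smooth_mx V (fun x => conn (phi x) (Y x) (Z x)).
Proof.
move=> sY sZ; have sYJ := smooth_mulmxr Vo J sY; have sZJ := smooth_mulmxr Vo J sZ.
apply: (smooth_mxN Vo); apply: (smooth_mxD Vo); last first.
  by apply: (smooth_mxN Vo); apply: (smooth_mxZ Vo) => //; exact: smooth_dlogpot.
apply: (smooth_mxD Vo); last by apply: (smooth_mxZ Vo) => //; exact: smooth_dlogpot.
apply: (smooth_mxD Vo); first by apply: (smooth_mxZ Vo) => //; exact: smooth_dlogpot.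
by apply: (smooth_mxN Vo); apply: (smooth_mxZ Vo) => //; exact: smooth_dlogpot.
Qed.

Lemma smooth_along u W : smooth_mx V W -> smooth_mx V (along u W).
Proof.
move=> sW; apply: (smooth_mxD Vo); first exact: smooth_mx_derive.
by apply: smooth_model_conn => //; exact: smooth_mx_derive.
Qed.

Lemma derive_dlogpotZ Y Z x u : smooth_mx V Y -> smooth_mx V Z -> V x ->
  'D_u (fun x => al (phi x) (Y x) *: Z x) x =
  (q (Y x) ('D_u phi x) * (pot (phi x))^-1
  - 2 * q ('D_u phi x) (phi x) * q (Y x) (phi x) * (pot (phi x))^-1 ^+ 2
  + al (phi x) ('D_u Y x)) *: Z x + al (phi x) (Y x) *: 'D_u Z x.
Proof.
move=> sY sZ Vx.
by rewrite (derive_mxZ Vo _ (smooth_dlogpot sY) sZ Vx) (derive_dlogpot _ sY Vx).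
Qed.

Lemma derive_model_conn Y Z x u : smooth_mx V Y -> smooth_mx V Z -> V x ->
  'D_u (fun x => conn (phi x) (Y x) (Z x)) x =
  - (((q (Y x) ('D_u phi x) * (pot (phi x))^-1
    - 2 * q ('D_u phi x) (phi x) * q (Y x) (phi x) * (pot (phi x))^-1 ^+ 2
    + al (phi x) ('D_u Y x)) *: Z x + al (phi x) (Y x) *: 'D_u Z x)
   - ((q (Y x *m J) ('D_u phi x) * (pot (phi x))^-1
    - 2 * q ('D_u phi x) (phi x) * q (Y x *m J) (phi x) * (pot (phi x))^-1 ^+ 2
    + al (phi x) ('D_u Y x *m J)) *: (Z x *m J) + al (phi x) (Y x *m J) *: ('D_u Z x *m J))
   + ((q (Z x) ('D_u phi x) * (pot (phi x))^-1
    - 2 * q ('D_u phi x) (phi x) * q (Z x) (phi x) * (pot (phi x))^-1 ^+ 2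
    + al (phi x) ('D_u Z x)) *: Y x + al (phi x) (Z x) *: 'D_u Y x)
   - ((q (Z x *m J) ('D_u phi x) * (pot (phi x))^-1
    - 2 * q ('D_u phi x) (phi x) * q (Z x *m J) (phi x) * (pot (phi x))^-1 ^+ 2
    + al (phi x) ('D_u Z x *m J)) *: (Y x *m J) + al (phi x) (Z x *m J) *: ('D_u Y x *m J))).
Proof.
move=> sY sZ Vx; have sYJ := smooth_mulmxr Vo J sY; have sZJ := smooth_mulmxr Vo J sZ.
have s1 := smooth_mxZ Vo (smooth_dlogpot sY) sZ.
have s2 := smooth_mxN Vo (smooth_mxZ Vo (smooth_dlogpot sYJ) sZJ).
have s3 := smooth_mxZ Vo (smooth_dlogpot sZ) sY.
have s4 := smooth_mxN Vo (smooth_mxZ Vo (smooth_dlogpot sZJ) sYJ).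
rewrite (derive_mxN _ (smooth_mxD Vo (smooth_mxD Vo (smooth_mxD Vo s1 s2) s3) s4) Vx).
rewrite (derive_mxD _ (smooth_mxD Vo (smooth_mxD Vo s1 s2) s3) s4 Vx).
rewrite (derive_mxD _ (smooth_mxD Vo s1 s2) s3 Vx) (derive_mxD _ s1 s2 Vx).
rewrite (derive_mxN _ (smooth_mxZ Vo (smooth_dlogpot sYJ) sZJ) Vx).
rewrite (derive_mxN _ (smooth_mxZ Vo (smooth_dlogpot sZJ) sYJ) Vx).
rewrite (derive_dlogpotZ _ sY sZ Vx) (derive_dlogpotZ _ sYJ sZJ Vx).
rewrite (derive_dlogpotZ _ sZ sY Vx) (derive_dlogpotZ _ sZJ sYJ Vx).
by rewrite (derive_mulmxr Vo _ _ sY Vx) (derive_mulmxr Vo _ _ sZ Vx).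
Qed.

Lemma along_curvature W x u v : smooth_mx V W -> V x ->
  along u (along v W) x - along v (along u W) x =
  model_curv Q J c kap (phi x) ('D_u phi x) ('D_v phi x) (W x).
Proof.
move=> sW Vx.
have sDu := smooth_mx_derive Vo u sphi; have sDv := smooth_mx_derive Vo v sphi.
have sWu := smooth_mx_derive Vo u sW; have sWv := smooth_mx_derive Vo v sW.
have along2 a b : smooth_mx V ('D_b phi) -> smooth_mx V ('D_b W) ->
    along a (along b W) x = 'D_a ('D_b W) x
      + 'D_a (fun y => conn (phi y) ('D_b phi y) (W y)) x
      + conn (phi x) ('D_a phi x) (along b W x).
  move=> sDb sWb; have := derive_mxD a sWb (smooth_model_conn sDb sW) Vx.
  by rewrite {1}/along => <-.
have Au := etrans (along2 u v sDv sWv) (congr1 (fun t => 'D_u ('D_v W) x + t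
  + conn (phi x) ('D_u phi x) (along v W x)) (derive_model_conn u sDv sW Vx)).
have Av := etrans (along2 v u sDu sWu) (congr1 (fun t => 'D_v ('D_u W) x + t
  + conn (phi x) ('D_v phi x) (along u W x)) (derive_model_conn v sDu sW Vx)).
rewrite {along2} Au Av {Au Av}.
(* Once the mixed derivatives of [phi] and of [W] agree, all derivatives can be replaced by
   independent variables, and the algebraic identity [model_curvature] remains. *)
have -> : 'D_v ('D_u phi) x = 'D_u ('D_v phi) x by exact: (derive_mx_comm Vo _ _ sphi Vx).
have -> : 'D_v ('D_u W) x = 'D_u ('D_v W) x by exact: (derive_mx_comm Vo _ _ sW Vx).
rewrite /along.
move: ('D_u ('D_v W) x) ('D_u ('D_v phi) x) ('D_u W x) ('D_v W x) => wuv su wu wv.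
exact: (model_curvature kap cc Qsym JQ JJ Jskew).
Qed.

Lemma along_torsion x u v : V x -> along u ('D_v phi) x = along v ('D_u phi) x.
Proof.
move=> Vx; rewrite /along (derive_mx_comm Vo u v sphi Vx).
by rewrite (model_conn_sym Q J kap).
Qed.

Lemma along_J W x u : smooth_mx V W -> V x ->
  along u (fun y => W y *m J) x = along u W x *m J.
Proof.
move=> sW Vx; rewrite /along (derive_mulmxr Vo _ _ sW Vx) mulmxDl.
by rewrite (model_conn_J Q kap JJ).
Qed.

End FieldsAlong.

(** * Uniqueness of the Levi-Civita connection at a point *)

Section LeviCivita.
Variables (R : realType) (N : nat) (G : 'rV[R]_N -> 'M[R]_N) (x : 'rV[R]_N).
Variable (C : 'rV[R]_N -> 'rV[R]_N -> 'rV[R]_N).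
Hypotheses (Gsym : (G x)^T = G x) (Gunit : G x \in unitmx).
Hypotheses (Clin : forall a u u' v, C (a *: u + u') v = a *: C u v + C u' v).
Hypotheses (Csym : forall u v, C u v = C v u).
Hypothesis Cmetric : forall i j k, pderiv k (fun y => G y i j) x =
  form (G x) (C (delta_mx 0 k) (delta_mx 0 i)) (delta_mx 0 j)
  + form (G x) (delta_mx 0 i) (C (delta_mx 0 k) (delta_mx 0 j)).

Local Notation d i := (delta_mx (0 : 'I_1) i : 'rV[R]_N).

(** Koszul's argument: in the alternating sum of three instances of [Cmetric], symmetry of [C]
    cancels all but twice one term. It is used for the ambient metric and again for the induced
    one. *)
Lemma christoffel_unique k i j : christoffel G x k i j = C (d i) (d j) 0 k.
Proof.
have E l : pderiv i (fun y => G y j l) x + pderiv j (fun y => G y i l) x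
     - pderiv l (fun y => G y i j) x = 2 * form (G x) (C (d i) (d j)) (d l).
  rewrite !Cmetric (Csym (d l) (d i)) (Csym (d l) (d j)) (Csym (d j) (d i)).
  rewrite (form_sym (d j) _ Gsym) (form_sym (d i) _ Gsym); ring.
rewrite /christoffel.
under eq_bigr do rewrite E mulrCA.
rewrite -mulr_sumr mulrA mulVf ?mul1r ?pnatr_eq0//.
have sV : (invmx (G x))^T = invmx (G x) by rewrite trmx_inv Gsym.
rewrite -[in RHS](mulmxK Gunit (C (d i) (d j))) [RHS]mxE.
apply: eq_bigr => l _; rewrite -[in LHS]sV mxE mulrC; congr (_ * _).
by rewrite /form trmx_delta -colE mxE.
Qed.

Lemma conn_unique u v : conn G x u v = C u v.
Proof.
have C0 w : C 0 w = 0.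
  have := Clin 1 0 0 w; rewrite scaler0 addr0 scale1r => /eqP.
  by rewrite -subr_eq0 opprD addNKr oppr_eq0 => /eqP.
have Csum (I : Type) (r : seq I) (k : I -> R) (w : I -> 'rV[R]_N) v' :
    C (\sum_(i <- r) k i *: w i) v' = \sum_(i <- r) k i *: C (w i) v'.
  by elim: r => [|i r IH]; rewrite ?big_nil// !big_cons Clin IH.
apply/rowP => k; rewrite mxE.
rewrite [in RHS](row_sum_delta u) Csum summxE; apply: eq_bigr => i _.
rewrite mxE Csym [in RHS](row_sum_delta v) Csum summxE mulr_sumr.
apply: eq_bigr => j _; rewrite mxE christoffel_unique Csym; ring.
Qed.

End LeviCivita.

Section ConnectionMatrix.
Variables (R : realType) (N : nat) (G : 'rV[R]_N -> 'M[R]_N).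

(** The endomorphism [v |-> conn G x u v] as a matrix acting on rows, so that covariant derivatives
    of endomorphisms become commutators. *)
Definition conn_mx (u x : 'rV[R]_N) : 'M[R]_N :=
  \matrix_j conn G x u (delta_mx 0 j).

Lemma mul_conn_mx u v x : v *m conn_mx u x = conn G x u v.
Proof.
apply/rowP => k; rewrite !mxE exchange_big; apply: eq_bigr => j _ /=.
rewrite !mxE mulr_sumr; apply: eq_bigr => i _.
rewrite (bigD1 j)//= big1 => [|l lj]; last by rewrite mxE eqxx (negPf lj) mulr0.
by rewrite mxE !eqxx mulr1 addr0 mulrC.
Qed.

Lemma conn_mx_linear a u v x :
  conn_mx (a *: u + v) x = a *: conn_mx u x + conn_mx v x.
Proof.
apply/matrixP => j k; rewrite !mxE mulr_sumr -big_split; apply: eq_bigr => i _ /=.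
rewrite mulr_sumr -big_split; apply: eq_bigr => l _ /=.
rewrite !mxE; ring.
Qed.

(** The signs of the commutator follow the row convention: [w *m covder u T x] is the derivative of
    [w *m T] minus [T] applied to the derivative of [w]. *)
Definition covder (u : 'rV[R]_N) (T : 'rV[R]_N -> 'M[R]_N) (x : 'rV[R]_N) : 'M[R]_N :=
  'D_u T x + T x *m conn_mx u x - conn_mx u x *m T x.

(* [w *m riem_mx u v x] is R(u, v) w, with R(u, v) = [nabla_u, nabla_v] for
   commuting [u] and [v]. *)
Definition riem_mx (u v x : 'rV[R]_N) : 'M[R]_N :=
  'D_u (conn_mx v) x - 'D_v (conn_mx u) x
  + (conn_mx v x *m conn_mx u x - conn_mx u x *m conn_mx v x).

End ConnectionMatrix.

Section SmoothIdentity.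
Variables (R : realType) (N : nat) (V : set 'rV[R]_N).
Hypothesis Vo : open V.

Lemma smooth_mx_id : smooth_mx V (id : 'rV[R]_N -> 'rV[R]_N).
Proof.
apply: smooth_on_mx => // k; case: k => [|k] /=.
  by move=> x _; exact: cvg_id.
split=> [x v _|v]; first exact: derivable_id.
by apply: (Ck_eq_on Vo) (smooth_cst Vo v k) => y _; rewrite derive_id.
Qed.

End SmoothIdentity.

Section ModelConnection.
Variables (R : realType) (N : nat) (Q J : 'M[R]_N) (c kap : R).
Hypotheses (cc : c * c = 1) (Qsym : Q^T = Q) (JQ : J *m Q = Q *m J).
Hypotheses (JJ : J *m J = - 1%:M) (Jskew : J^T = - J).
Local Notation G := (model_metric Q J c kap).

Lemma model_conn_linear z a u u' v :
  model_conn Q J kap z (a *: u + u') v =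
  a *: model_conn Q J kap z u v + model_conn Q J kap z u' v.
Proof.
rewrite /model_conn !(mulmxDl, dlogpotD, dlogpotZ) -!scalemxAl !dlogpotZ.
by apply/rowP => k; rewrite !entryE; ring.
Qed.

Lemma model_conn_linearr z a u w w' :
  model_conn Q J kap z u (a *: w + w') =
  a *: model_conn Q J kap z u w + model_conn Q J kap z u w'.
Proof. by rewrite !(model_conn_sym Q J kap z u) model_conn_linear. Qed.

Lemma model_connN z u v : model_conn Q J kap z u (- v) = - model_conn Q J kap z u v.
Proof.
rewrite /model_conn mulNmx !dlogpotN.
by apply/rowP => k; rewrite !entryE; ring.
Qed.

Lemma open_potential : open [set z | potential Q kap z != 0].
Proof.
have cpot : continuous (fun z : 'rV[R]_N => potential Q kap z).
  move=> z; have sid := smooth_mx_id (@openT 'rV[R]_N).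
  exact: (smooth_continuous (smooth_potential Q kap openT sid) I).
rewrite (_ : [set z | _] = potential Q kap @^-1` [set r | r != 0])//.
by apply: open_comp; [move=> z _; exact: cpot|exact: open_neq].
Qed.

(** For [phi = id] and constant fields, [along] reduces to [model_conn]; its compatibility with the
    metric is then precisely the hypothesis [Cmetric] of the uniqueness lemma. *)
Lemma conn_model z u v : potential Q kap z != 0 -> G z \in unitmx ->
  conn G z u v = model_conn Q J kap z u v.
Proof.
move=> z0 uG; apply: conn_unique uG _ _ _ _ _.
- exact: model_metric_sym.
- exact: model_conn_linear.
- exact: model_conn_sym.
move=> i j k; rewrite /pderiv.
have sid := smooth_mx_id open_potential.
have sC w := smooth_mx_cst open_potential (w : 'rV[R]_N).
have := derive_metric_form c Qsym JQ JJ Jskew open_potential sid (fun _ => id)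
  (delta_mx 0 k) (sC (delta_mx 0 i)) (sC (delta_mx 0 j)) z0.
under eq_fun do rewrite /cst form_delta.
by move=> ->; rewrite /along !derive_cst derive_id !add0r.
Qed.

End ModelConnection.

(** * The equations of Gauss, Weingarten and Codazzi *)

Section BilinearFormMatrix.
Variables (R : realType) (N : nat) (B : 'M[R]_N).
Variable (H : 'rV[R]_N -> 'rV[R]_N -> R).
Hypotheses (Hlin : forall a u u' v, H (a *: u + u') v = a * H u v + H u' v).
Hypotheses (Hsym : forall u v, H u v = H v u).
Hypothesis HB : forall i j, B i j = H (delta_mx 0 i) (delta_mx 0 j).

Lemma form_matrix u v : form B u v = H u v.
Proof.
have H0 w : H 0 w = 0.
  have := Hlin 1 0 0 w; rewrite scaler0 addr0 mul1r => /eqP.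
  by rewrite -subr_eq0 opprD addNKr oppr_eq0 => /eqP.
have Hsum (I : Type) (r : seq I) (k : I -> R) (w : I -> 'rV[R]_N) v' :
    H (\sum_(i <- r) k i *: w i) v' = \sum_(i <- r) k i * H (w i) v'.
  by elim: r => [|i r IH]; rewrite ?big_nil// !big_cons Hlin IH.
rewrite (row_sum_delta u) (row_sum_delta v) Hsum form_suml.
apply: eq_bigr => i _; rewrite formZl Hsym Hsum form_sumr; congr (_ * _).
by apply: eq_bigr => j _; rewrite formZr form_delta HB Hsym.
Qed.

End BilinearFormMatrix.

Section HypersurfaceEquations.
Variables (R : realType) (N n : nat) (Q J : 'M[R]_N) (c kap : R).
Hypotheses (cc : c * c = 1) (Qsym : Q^T = Q) (JQ : J *m Q = Q *m J).
Hypotheses (JJ : J *m J = - 1%:M) (Jskew : J^T = - J).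
Hypothesis (codim1 : n.+1 = N).
Variables (V : set 'rV[R]_n) (phi xi : 'rV[R]_n -> 'rV[R]_N).
Hypotheses (Vo : open V) (sphi : smooth_mx V phi) (sxi : smooth_mx V xi).
Hypothesis pot0 : forall x, V x -> potential Q kap (phi x) != 0.
Local Notation G := (model_metric Q J c kap).
Local Notation g := (induced_metric G phi).
Local Notation P := (dmap phi).
Local Notation nab := (along Q J kap phi).
Hypothesis xi_unit : forall x, V x -> form (G (phi x)) (xi x) (xi x) = 1.
Hypothesis xi_normal : forall x u, V x -> form (G (phi x)) (u *m P x) (xi x) = 0.
Variable F : 'rV[R]_n -> 'M[R]_n.
Hypothesis F_orth : forall x, V x -> F x *m g x *m (F x)^T = 1%:M.

Implicit Types (x u v w : 'rV[R]_n) (W : 'rV[R]_N).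

Local Notation h := (second_form G phi xi).
Local Notation A := (shape_operator G phi xi).
Local Notation S := (structure_tensor G J phi).
Local Notation U := (structure_vector G J phi xi).

Lemma mul_dmap x u : V x -> u *m P x = 'D_u phi x.
Proof.
move=> Vx; rewrite [in RHS](row_sum_delta u) (derive_mx_sumdir Vo) //.
by rewrite mulmx_sum_row; apply: eq_bigr => i _; rewrite rowK.
Qed.

Lemma smooth_dmap : smooth_mx V P.
Proof.
move=> i j; under eq_fun do rewrite mxE.
exact: (smooth_mx_derive Vo (delta_mx 0 i) sphi 0 j).
Qed.

Lemma form_induced x u v :
  form (g x) u v = form (G (phi x)) (u *m P x) (v *m P x).
Proof. by rewrite /form /induced_metric trmx_mul !mulmxA. Qed.

Lemma induced_sym x : (g x)^T = g x.
Proof.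
by rewrite /induced_metric !trmx_mul trmxK (model_metric_sym J c kap Qsym) mulmxA.
Qed.

Lemma smooth_model_metric : smooth_mx V (fun x => G (phi x)).
Proof.
move=> i j; under eq_fun do rewrite -form_delta.
by apply: (smooth_metric_form J c Qsym Vo sphi pot0); exact: smooth_mx_cst.
Qed.

Lemma smooth_induced : smooth_mx V g.
Proof.
apply: (smooth_mulmx Vo); last exact: smooth_mx_tr smooth_dmap.
exact: (smooth_mulmx Vo smooth_dmap smooth_model_metric).
Qed.

Lemma induced_unit x : V x -> g x \in unitmx.
Proof.
move=> Vx; have := F_orth Vx; rewrite -mulmxA => /mulmx1_unit[uF].
by rewrite unitmx_mul => /andP[].
Qed.

(* By [codim1] this is an orthonormal basis of the ambient space, so both
   metrics are nondegenerate, whatever their signature. *)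
Definition adapted x : 'M[R]_(n + 1, N) := col_mx (F x *m P x) (xi x).

Lemma adapted_orth x : V x -> adapted x *m G (phi x) *m (adapted x)^T = 1%:M.
Proof.
move=> Vx; rewrite /adapted tr_col_mx mul_col_mx mul_col_row.
have -> : F x *m P x *m G (phi x) *m (F x *m P x)^T = 1%:M.
  by rewrite trmx_mul -(F_orth Vx) /induced_metric !mulmxA.
have N0 : F x *m P x *m G (phi x) *m (xi x)^T = 0.
  apply/matrixP => i j; rewrite ord1 [RHS]mxE.
  have := xi_normal (row i (F x)) Vx.
  by rewrite /form -!row_mul mxE.
rewrite N0.
have -> : xi x *m G (phi x) *m (F x *m P x)^T = 0.
  rewrite -[LHS]trmxK (trmx_mul (xi x *m _)) (trmx_mul (xi x)) trmxK (model_metric_sym J c kap Qsym).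
  by rewrite mulmxA N0 trmx0.
have -> : xi x *m G (phi x) *m (xi x)^T = 1%:M.
  by apply/matrixP => i j; rewrite !ord1 -/(form _ _ _) mxE; exact: xi_unit.
by rewrite -scalar_mx_block.
Qed.

Lemma adapted_rank x : V x ->
  \rank (adapted x *m G (phi x) *m (adapted x)^T) = n.+1.
Proof. by move=> Vx; rewrite adapted_orth// mxrank1 addn1. Qed.

(** [G (phi x)] is a factor of a product of rank [n.+1 = N], so it has full rank. *)
Lemma model_metric_unit x : V x -> G (phi x) \in unitmx.
Proof.
move=> Vx; rewrite -row_full_unit -col_leq_rank -[leqLHS]codim1.
rewrite -(adapted_rank Vx).
by rewrite -mulmxA (leq_trans (mxrankM_maxr _ _))// mxrankM_maxl.
Qed.

Lemma tangential_mul x u : V x -> tangential G phi x (u *m P x) = u.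
Proof.
move=> Vx; rewrite /tangential -2![u *m _ *m _]mulmxA.
by rewrite -/(induced_metric _ _ _) mulmxK// induced_unit.
Qed.

Lemma tangential_normal x : V x -> tangential G phi x (xi x) = 0.
Proof.
move=> Vx; rewrite /tangential.
suff -> : xi x *m G (phi x) *m (P x)^T = 0 by rewrite mul0mx.
apply/rowP => i; have := xi_normal (delta_mx 0 i) Vx.
rewrite (form_sym _ _ (model_metric_sym J c kap Qsym (phi x))) /form.
by rewrite trmx_mul mulmxA trmx_delta -colE !mxE.
Qed.

Lemma tangentialD x W W' :
  tangential G phi x (W + W') = tangential G phi x W + tangential G phi x W'.
Proof. by rewrite /tangential !mulmxDl. Qed.

Lemma tangentialZ x a W :
  tangential G phi x (a *: W) = a *: tangential G phi x W.
Proof. by rewrite /tangential -!scalemxAl. Qed.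

(** The rows of [adapted x] span the ambient space, so [W] is a combination of tangent rows and
    [xi x]; projecting that combination identifies its coefficients. *)
Lemma tangent_normal x W : V x ->
  W = tangential G phi x W *m P x + form (G (phi x)) W (xi x) *: xi x.
Proof.
move=> Vx.
have full : row_full (adapted x).
  rewrite -col_leq_rank -[leqLHS]codim1 -(adapted_rank Vx).
  by rewrite -mulmxA mxrankM_maxl.
have /submxP[D ->] := submx_full W full.
rewrite -[D]hsubmxK /adapted mul_row_col.
set u := lsubmx D; have [a ->] : exists a : R, rsubmx D = a%:M.
  by exists (rsubmx D 0 0); rewrite -mx11_scalar.
rewrite mul_scalar_mx mulmxA tangentialD tangentialZ tangential_normal//.
rewrite scaler0 addr0 tangential_mul// formDl formZl xi_unit// mulr1.
by rewrite xi_normal// add0r.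
Qed.

Lemma form_tangential x W v : V x ->
  form (g x) (tangential G phi x W) v = form (G (phi x)) W (v *m P x).
Proof.
move=> Vx; rewrite form_induced {2}(tangent_normal W Vx) formDl formZl.
rewrite (form_sym (xi x) _ (model_metric_sym J c kap Qsym (phi x))).
by rewrite xi_normal// mulr0 addr0.
Qed.

Lemma tangent_normal_eq x u v a b : V x ->
  u *m P x + a *: xi x = v *m P x + b *: xi x -> u = v /\ a = b.
Proof.
move=> Vx e; split.
  have := congr1 (tangential G phi x) e.
  rewrite !tangentialD !tangentialZ (tangential_normal Vx) !scaler0 !addr0.
  by rewrite !(tangential_mul _ Vx).
have := congr1 (fun W => form (G (phi x)) W (xi x)) e.
by rewrite !formDl !formZl (xi_unit Vx) !mulr1 !(xi_normal _ Vx) !add0r.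
Qed.


Lemma along_eq_on u (W1 W2 : 'rV[R]_n -> 'rV[R]_N) x : (forall y, V y -> W1 y = W2 y) -> V x ->
  nab u W1 x = nab u W2 x.
Proof. by move=> W12 Vx; rewrite /along (derive_eq_on Vo u W12 Vx) (W12 _ Vx). Qed.

Lemma along_lineardir a u v (W : 'rV[R]_n -> 'rV[R]_N) x : smooth_mx V W -> V x ->
  nab (a *: u + v) W x = a *: nab u W x + nab v W x.
Proof.
move=> sW Vx; rewrite /along.
rewrite (derive_mx_adddir Vo _ _ sW Vx) (derive_mx_scaledir _ _ sW Vx).
rewrite (derive_mx_adddir Vo _ _ sphi Vx) (derive_mx_scaledir _ _ sphi Vx).
by rewrite model_conn_linear scalerDr; exact: addrACA.
Qed.

Lemma along_linear (a : 'rV[R]_n -> R) u (W W' : 'rV[R]_n -> 'rV[R]_N) x :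
  smooth_on V a -> smooth_mx V W -> smooth_mx V W' -> V x ->
  nab u (fun y => a y *: W y + W' y) x =
  'D_u a x *: W x + a x *: nab u W x + nab u W' x.
Proof.
move=> sa sW sW' Vx; rewrite /along.
rewrite (derive_mxD _ (smooth_mxZ Vo sa sW) sW' Vx) (derive_mxZ Vo _ sa sW Vx).
by rewrite model_conn_linearr scalerDr -!addrA; congr (_ + (_ + _)); rewrite addrCA.
Qed.

Definition second_fundamental x u v : R :=
  form (G (phi x)) (nab u ('D_v phi) x) (xi x).

Lemma along_phi_linear x a u u' v : V x ->
  nab (a *: u + u') ('D_v phi) x =
  a *: nab u ('D_v phi) x + nab u' ('D_v phi) x.
Proof. by move=> Vx; apply: along_lineardir Vx; exact: smooth_mx_derive. Qed.

Lemma along_phi_sym x u v : V x -> nab u ('D_v phi) x = nab v ('D_u phi) x.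
Proof. by move=> Vx; exact: (along_torsion Q J kap Vo sphi). Qed.

(** The tangential part of the ambient derivative is symmetric and compatible with the induced
    metric, so uniqueness identifies it with the connection of [g]. *)
Lemma conn_induced x u v : V x ->
  conn g x u v = tangential G phi x (nab u ('D_v phi) x).
Proof.
move=> Vx; apply: (@conn_unique _ _ g x
  (fun u v => tangential G phi x (nab u ('D_v phi) x)) (induced_sym x) (induced_unit Vx)).
- move=> a w w' w2; rewrite along_phi_linear// tangentialD tangentialZ//.
- by move=> w w'; rewrite along_phi_sym.
move=> i j k; rewrite /pderiv form_tangential//.
rewrite (form_sym (delta_mx 0 i) _ (induced_sym x)) form_tangential//.
rewrite [X in _ + X](form_sym _ _ (model_metric_sym J c kap Qsym (phi x))).
rewrite (mul_dmap (delta_mx 0 j) Vx) (mul_dmap (delta_mx 0 i) Vx).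
have sD w := smooth_mx_derive Vo w sphi.
apply: etrans (derive_metric_form c Qsym JQ JJ Jskew Vo sphi pot0 _
  (sD (delta_mx 0 i)) (sD (delta_mx 0 j)) Vx).
apply: (derive_eq_on Vo) Vx => y Vy.
by rewrite -form_delta form_induced !mul_dmap.
Qed.

Lemma gauss_formula x u v : V x ->
  nab u ('D_v phi) x =
  conn g x u v *m P x + second_fundamental x u v *: xi x.
Proof. by move=> Vx; rewrite (conn_induced _ _ Vx); exact: tangent_normal. Qed.

Lemma second_fundamental_sym x u v : V x ->
  second_fundamental x u v = second_fundamental x v u.
Proof. by move=> Vx; rewrite /second_fundamental along_phi_sym. Qed.

Lemma form_second_form x u v : V x -> form (h x) u v = second_fundamental x u v.
Proof.
move=> Vx; apply: (@form_matrix _ _ _ (second_fundamental x)).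
- move=> a w w' w2; rewrite /second_fundamental along_phi_linear//.
  by rewrite formDl formZl.
- by move=> w w'; exact: second_fundamental_sym.
move=> i j; rewrite mxE /second_fundamental /nabla_along.
under eq_fun do rewrite rowK.
rewrite rowK /cst conn_model//; [|exact: pot0|exact: model_metric_unit].
by rewrite mul_dmap.
Qed.

Lemma form_shape x u v : V x ->
  form (g x) (u *m A x) v = second_fundamental x u v.
Proof.
move=> Vx; rewrite -form_second_form// /shape_operator /form mulmxA.
by rewrite mulmxKV// induced_unit.
Qed.

Lemma shape_sym x u v : V x -> form (g x) (u *m A x) v = form (g x) u (v *m A x).
Proof.
move=> Vx; rewrite form_shape// second_fundamental_sym// -form_shape//.
by rewrite (form_sym _ _ (induced_sym x)).
Qed.

Lemma derive_metric_along x u (Y Z : 'rV[R]_n -> 'rV[R]_N) :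
  smooth_mx V Y -> smooth_mx V Z -> V x ->
  'D_u (fun y => form (G (phi y)) (Y y) (Z y)) x =
  form (G (phi x)) (nab u Y x) (Z x) + form (G (phi x)) (Y x) (nab u Z x).
Proof. exact: (derive_metric_form c Qsym JQ JJ Jskew Vo sphi pot0). Qed.

Lemma model_metricC x W W' : form (G (phi x)) W W' = form (G (phi x)) W' W.
Proof. exact: (form_sym _ _ (model_metric_sym J c kap Qsym (phi x))). Qed.

(** The normal part vanishes on differentiating <xi, xi> = 1; the tangential part comes from
    differentiating <dphi w, xi> = 0. *)
Lemma weingarten x u : V x -> nab u xi x = - (u *m A x *m P x).
Proof.
move=> Vx.
have xn : form (G (phi x)) (nab u xi x) (xi x) = 0.
  have := derive_metric_along u sxi sxi Vx.
  rewrite (model_metricC x (xi x)) -mulr2n.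
  rewrite (derive_const_on Vo u xi_unit Vx) => /esym/eqP.
  by rewrite mulrn_eq0 => /eqP.
rewrite [LHS](tangent_normal _ Vx) xn scale0r addr0 -mulNmx; congr (_ *m _).
apply: (form_nondeg (induced_unit Vx)) => w.
rewrite form_tangential// formNl form_shape// mul_dmap//.
have sDw := smooth_mx_derive Vo w sphi.
have := derive_metric_along u sDw sxi Vx.
rewrite (@derive_const_on _ _ _ Vo _ 0 _ _ _ Vx); last first.
  by move=> y Vy; rewrite -(mul_dmap w Vy); exact: xi_normal.
rewrite (model_metricC x ('D_w phi x)) -/(second_fundamental x u w).
by move=> /esym/eqP; rewrite addrC addr_eq0 => /eqP.
Qed.

Lemma along_tangent x u (Y : 'rV[R]_n -> 'rV[R]_n) : smooth_mx V Y -> V x ->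
  nab u (fun y => Y y *m P y) x =
  ('D_u Y x + conn g x u (Y x)) *m P x + second_fundamental x u (Y x) *: xi x.
Proof.
move=> sY Vx; have sP := smooth_dmap.
rewrite /along (derive_mulmx Vo _ sY sP Vx) mulmxDl -addrA -addrA; congr (_ + _).
rewrite -gauss_formula// /along mul_dmap//; congr (_ + _).
rewrite -(derive_mulmxl Vo _ _ sP Vx).
by apply: (derive_eq_on Vo) Vx => y Vy; rewrite mul_dmap.
Qed.


Lemma mul_structure_tensor x u :
  u *m S x = tangential G phi x (u *m P x *m J).
Proof.
rewrite [in LHS](row_sum_delta u) mulmx_suml [in RHS](row_sum_delta u).
rewrite !mulmx_suml /tangential !mulmx_suml; apply: eq_bigr => i _.
by rewrite -!scalemxAl -rowE rowK /tangential.
Qed.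

Lemma metricJ x W W' :
  form (G (phi x)) (W *m J) W' = - form (G (phi x)) W (W' *m J).
Proof.
rewrite -[in RHS](model_metric_J c kap Qsym JQ JJ Jskew) mulJJ//.
by rewrite formNr opprK.
Qed.

(** [J] is skew for the metric, so [xi x *m J] is orthogonal to [xi x] and taking the tangential
    part loses nothing. *)
Lemma structure_vectorP x : V x -> U x *m P x = - (xi x *m J).
Proof.
move=> Vx; rewrite [RHS](tangent_normal _ Vx).
have -> : form (G (phi x)) (- (xi x *m J)) (xi x) = 0.
  have : form (G (phi x)) (xi x *m J) (xi x) = - form (G (phi x)) (xi x *m J) (xi x).
    by rewrite {1}metricJ model_metricC.
  move=> /eqP; rewrite -subr_eq0 opprK -mulr2n mulrn_eq0 => /eqP e0.
  by rewrite formNl e0 oppr0.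
by rewrite scale0r addr0.
Qed.

Lemma form_structure_vector x u : V x ->
  form (g x) u (U x) = form (G (phi x)) (u *m P x *m J) (xi x).
Proof.
by move=> Vx; rewrite form_induced (structure_vectorP Vx) formNr metricJ.
Qed.

Lemma tangent_J x u : V x ->
  u *m P x *m J = u *m S x *m P x + form (g x) u (U x) *: xi x.
Proof.
move=> Vx; rewrite (form_structure_vector _ Vx) mul_structure_tensor.
exact: tangent_normal.
Qed.

Lemma form_structure_tensor x u v : V x ->
  form (g x) (u *m S x) v = form (G (phi x)) (u *m P x *m J) (v *m P x).
Proof. by move=> Vx; rewrite mul_structure_tensor form_tangential. Qed.

Lemma inducedC x u v : form (g x) u v = form (g x) v u.
Proof. exact: form_sym (induced_sym x). Qed.

Lemma structure_skew x u v : V x ->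
  form (g x) (u *m S x) v = - form (g x) u (v *m S x).
Proof.
move=> Vx; rewrite (inducedC x u) !(form_structure_tensor _ _ Vx) metricJ.
by rewrite [in RHS]model_metricC.
Qed.

(** Apply [J] to the decomposition of [u *m P x *m J], use that [J] squares to -1, and compare
    tangential parts. *)
Lemma structure_sq x u : V x ->
  u *m S x *m S x = - u + form (g x) u (U x) *: U x.
Proof.
move=> Vx; have e := tangent_J (u *m S x) Vx.
have f := congr1 (mulmx^~ J) (tangent_J u Vx).
rewrite mulJJ// mulmxDl e -scalemxAl in f.
have xJ : xi x *m J = - (U x *m P x) by rewrite structure_vectorP// opprK.
rewrite xJ in f.
have [|E _] := @tangent_normal_eq x (u *m S x *m S x) (- u + form (g x) u (U x) *: U x)
    (form (g x) (u *m S x) (U x)) 0 Vx; last exact: E.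
rewrite scale0r addr0 mulmxDl mulNmx f -scalemxAl.
by rewrite scalerN subrK.
Qed.

Lemma structure_vector_eqs x : V x ->
  U x *m S x = 0 /\ form (g x) (U x) (U x) = 1.
Proof.
move=> Vx; have := tangent_J (U x) Vx.
rewrite structure_vectorP// mulNmx mulJJ// opprK => e.
apply: (tangent_normal_eq Vx).
by rewrite -e mul0mx add0r scale1r.
Qed.

Lemma smooth_tangential (W : 'rV[R]_n -> 'rV[R]_N) :
  smooth_mx V W -> smooth_mx V (fun x => tangential G phi x (W x)).
Proof.
move=> sW; apply: (smooth_mulmx Vo); last first.
  by apply: (smooth_invmx Vo smooth_induced) => x; exact: induced_unit.
apply: (smooth_mulmx Vo); last exact: smooth_mx_tr smooth_dmap.
exact: (smooth_mulmx Vo sW smooth_model_metric).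
Qed.

Lemma smooth_second_fundamental u v :
  smooth_on V (fun x => second_fundamental x u v).
Proof.
apply: (smooth_metric_form J c Qsym Vo sphi pot0) => //.
by apply: (smooth_along J Vo sphi pot0); exact: smooth_mx_derive.
Qed.

Lemma smooth_shape : smooth_mx V A.
Proof.
apply: (smooth_mulmx Vo); last first.
  by apply: (smooth_invmx Vo smooth_induced) => x; exact: induced_unit.
move=> i j.
apply: (smooth_eq_on Vo) (smooth_second_fundamental (delta_mx 0 i) (delta_mx 0 j)).
by move=> y Vy; rewrite -form_second_form// form_delta.
Qed.

Lemma smooth_structure_tensor : smooth_mx V S.
Proof.
move=> i j; under eq_fun do rewrite mxE.
apply: smooth_tangential; apply: (smooth_mulmxr Vo).
exact: (smooth_mulmxl Vo _ smooth_dmap).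
Qed.

Lemma smooth_structure_vector : smooth_mx V U.
Proof.
by apply: smooth_tangential; apply: (smooth_mxN Vo); exact: (smooth_mulmxr Vo).
Qed.

Local Notation Gam := (conn_mx g).

Lemma smooth_conn_mx u : smooth_mx V (Gam u).
Proof.
move=> i j; under eq_fun do rewrite mxE.
apply: (@smooth_mx_eq_on _ _ _ Vo _ _
  (fun x => tangential G phi x (nab u ('D_(delta_mx 0 i) phi) x))).
  by move=> y Vy; rewrite conn_induced.
apply: smooth_tangential.
by apply: (smooth_along J Vo sphi pot0); exact: smooth_mx_derive.
Qed.

Lemma conn_mx_torsion x u v : V x -> v *m Gam u x = u *m Gam v x.
Proof.
move=> Vx; rewrite !mul_conn_mx (conn_induced u v Vx) (conn_induced v u Vx).
by rewrite (along_phi_sym u v Vx).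
Qed.

Lemma gauss_formula_mx x u v : V x ->
  nab u ('D_v phi) x = v *m Gam u x *m P x + form (g x) (u *m A x) v *: xi x.
Proof.
by move=> Vx; rewrite mul_conn_mx (form_shape u v Vx); exact: gauss_formula.
Qed.

Lemma derive_induced x u : V x ->
  'D_u g x = Gam u x *m g x + g x *m (Gam u x)^T.
Proof.
move=> Vx; apply/matrixP => i j; rewrite -!form_delta.
pose di := delta_mx (0 : 'I_1) i : 'rV[R]_n; pose dj := delta_mx (0 : 'I_1) j : 'rV[R]_n.
have sD w := smooth_mx_derive Vo w sphi.
rewrite -(derive_form_fixed Vo di dj u smooth_induced Vx).
transitivity ('D_u (fun y => form (G (phi y)) ('D_di phi y) ('D_dj phi y)) x).
  apply: (derive_eq_on Vo) Vx => y Vy; rewrite form_induced.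
  by rewrite (mul_dmap di Vy) (mul_dmap dj Vy).
rewrite (derive_metric_along _ (sD di) (sD dj) Vx).
rewrite (gauss_formula_mx u di Vx) (gauss_formula_mx u dj Vx).
rewrite -(mul_dmap di Vx) -(mul_dmap dj Vx).
rewrite formDl formDr formZl formZr (model_metricC x (xi x)).
rewrite !(xi_normal _ Vx) !mulr0 !addr0 -!form_induced.
by rewrite /form mulmxDr mulmxDl entryD trmx_mul !mulmxA.
Qed.

(** Differentiate [U P = - xi J] along the hypersurface: since [J] is parallel, the right side is
    given by Weingarten, and its tangential part is the claim. *)
Lemma cov_structure_vector x u : V x ->
  'D_u U x + U x *m Gam u x = u *m A x *m S x.
Proof.
move=> Vx; have sU := smooth_structure_vector.
have := along_tangent u sU Vx.
have := @along_eq_on u (fun y => U y *m P y) (fun y => - (xi y *m J)) x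
  structure_vectorP Vx => ->.
have -> : nab u (fun y => - (xi y *m J)) x = u *m A x *m P x *m J.
  have sxiJ := smooth_mulmxr Vo J sxi.
  have := along_J Q kap JJ phi Vo u sxi Vx.
  rewrite (weingarten u Vx) mulNmx => /(congr1 -%R); rewrite opprK => <-.
  by rewrite /along (derive_mxN u sxiJ Vx) opprD model_connN.
rewrite (tangent_J _ Vx) -mul_conn_mx => /(tangent_normal_eq Vx)[-> _].
by [].
Qed.

Lemma cov_structure_tensor x u w : V x ->
  w *m covder g u S x =
  form (g x) w (U x) *: (u *m A x) - form (g x) (u *m A x) w *: U x.
Proof.
move=> Vx; have sS := smooth_structure_tensor; have sDw := smooth_mx_derive Vo w sphi.
pose a y := form (g y) w (U y).
have sa : smooth_on V a.
  by apply: (smooth_form Vo smooth_induced _ smooth_structure_vector); exact: smooth_mx_cst.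
have sDwJ := smooth_mulmxr Vo J sDw.
have := along_tangent u (smooth_mulmxl Vo w sS) Vx.
(* The image of [w S] is [J dphi(w)] minus its normal component [a xi]. In this form the derivative
   needs only the Gauss and Weingarten formulas and the parallelism of [J]. *)
rewrite (@along_eq_on u _ (fun y => - a y *: xi y + 'D_w phi y *m J) x _ Vx); last first.
  move=> y Vy; have := tangent_J w Vy; rewrite (mul_dmap w Vy) => ->.
  by rewrite scaleNr addrCA addNr addr0.
rewrite (along_linear u (smoothN Vo sa) sxi sDwJ Vx) (along_J Q kap JJ phi Vo u sDw Vx).
rewrite (weingarten u Vx) (gauss_formula_mx u w Vx) mulmxDl (tangent_J _ Vx).
rewrite -scalemxAl.
have -> : xi x *m J = - (U x *m P x) by rewrite (structure_vectorP Vx) opprK.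
rewrite (derive_mulmxl Vo w u sS Vx) -mul_conn_mx => e.
have [|E _] := @tangent_normal_eq x
  (a x *: (u *m A x) + w *m Gam u x *m S x - form (g x) (u *m A x) w *: U x)
  (w *m 'D_u S x + w *m S x *m Gam u x)
  ('D_u (fun y => - a y) x + form (g x) (w *m Gam u x) (U x))
  (second_fundamental x u (w *m S x)) Vx.
  rewrite -e !mulmxDl !mulNmx -!scalemxAl scalerN !scaleNr opprK scalerDl.
  apply/rowP => k; rewrite !entryE; ring.
rewrite /covder mulmxBr mulmxDr ![in LHS]mulmxA -E /a.
by apply/rowP => k; rewrite !entryE; ring.
Qed.

Lemma derive_second_fundamental x u v w : V x ->
  'D_u (fun y => second_fundamental y v w) x =
  form (g x) (v *m covder g u A x + v *m Gam u x *m A x) w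
  + form (g x) (v *m A x) (w *m Gam u x).
Proof.
move=> Vx; have sA := smooth_shape; have svA := smooth_mulmxl Vo v sA.
rewrite (@derive_eq_on _ _ _ Vo _ _ (fun y => form (g y) (v *m A y) w) _ _ _ Vx); last first.
  by move=> y Vy; rewrite (form_shape v w Vy).
rewrite (derive_form Vo smooth_induced svA (smooth_mx_cst Vo w) u Vx).
rewrite (derive_cst w) form0r addr0 (derive_mulmxl Vo v u sA Vx) (derive_induced u Vx).
have -> : form (Gam u x *m g x + g x *m (Gam u x)^T) (v *m A x) w =
    form (g x) (v *m A x *m Gam u x) w + form (g x) (v *m A x) (w *m Gam u x).
  by rewrite /form mulmxDr mulmxDl entryD trmx_mul !mulmxA.
have -> : v *m covder g u A x + v *m Gam u x *m A x =
    v *m 'D_u A x + v *m A x *m Gam u x.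
  rewrite /covder; move: (A x) ('D_u A x) (Gam u x) => B D M.
  by rewrite mulmxBr mulmxDr !mulmxA subrK.
by rewrite formDl; ring.
Qed.

Lemma derive_conn_mx x u v w : V x ->
  'D_u (fun y => w *m Gam v y) x = w *m 'D_u (Gam v) x.
Proof. by move=> Vx; exact: derive_mulmxl (smooth_conn_mx v) Vx. Qed.

Lemma along_along_phi x u v w : V x ->
  nab u (nab v ('D_w phi)) x =
  (w *m 'D_u (Gam v) x + w *m Gam v x *m Gam u x
   - form (g x) (v *m A x) w *: (u *m A x)) *m P x
  + (form (g x) (u *m A x) (w *m Gam v x)
     + (form (g x) (v *m covder g u A x + v *m Gam u x *m A x) w
        + form (g x) (v *m A x) (w *m Gam u x))) *: xi x.
Proof.
move=> Vx; have sG := smooth_mulmxl Vo w (smooth_conn_mx v).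
have sP := smooth_dmap; have ssf := smooth_second_fundamental v w.
rewrite (@along_eq_on u _
  (fun y => second_fundamental y v w *: xi y + w *m Gam v y *m P y) x _ Vx); last first.
  by move=> y Vy; rewrite addrC mul_conn_mx; exact: gauss_formula.
rewrite (along_linear u ssf sxi (smooth_mulmx Vo sG sP) Vx).
rewrite (derive_second_fundamental u v w Vx).
rewrite (along_tangent u sG Vx) (weingarten u Vx) (derive_conn_mx u v w Vx).
rewrite -(mul_conn_mx g u) -(form_shape u _ Vx) -(form_shape v w Vx).
move: (form (g x) (v *m covder g u A x + v *m Gam u x *m A x) w) => s1.
move: (form (g x) (v *m A x) w) (form (g x) (u *m A x) (w *m Gam v x)) => s2 s3.
move: (form (g x) (v *m A x) (w *m Gam u x)) => s4; move: (u *m A x) (w *m 'D_u (Gam v) x) => Au D.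
move: (w *m Gam v x *m Gam u x) => M.
rewrite scalerN mulmxBl mulmxDl -scalemxAl scalerDl.
by apply/rowP => k; rewrite !entryE; ring.
Qed.

(* Tangential and normal part of the ambient curvature applied to [w *m P x]. *)
Lemma gauss_codazzi x u v w : V x ->
  w *m riem_mx g u v x =
    form (g x) (v *m A x) w *: (u *m A x) - form (g x) (u *m A x) w *: (v *m A x)
    + c *: (form (g x) v w *: u - form (g x) u w *: v
            - form (g x) (w *m S x) v *: (u *m S x)
            + form (g x) (w *m S x) u *: (v *m S x)
            - (2 * form (g x) (u *m S x) v) *: (w *m S x))
  /\ form (g x) (v *m covder g u A x - u *m covder g v A x) w =
    c * (- form (g x) (w *m S x) v * form (g x) u (U x)
         + form (g x) (w *m S x) u * form (g x) v (U x)
         - 2 * form (g x) (u *m S x) v * form (g x) w (U x)).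
Proof.
move=> Vx; have sDw := smooth_mx_derive Vo w sphi.
have := along_curvature cc Qsym JQ JJ Jskew Vo sphi pot0 u v sDw Vx.
rewrite (along_along_phi u v w Vx) (along_along_phi v u w Vx).
rewrite -(mul_dmap u Vx) -(mul_dmap v Vx) -(mul_dmap w Vx) /model_curv.
rewrite -!form_induced -!(form_structure_tensor _ _ Vx) !(tangent_J _ Vx).
set N1 := form (g x) (u *m A x) (w *m Gam v x) + _.
set N2 := form (g x) (v *m A x) (w *m Gam u x) + _ => e.
have [|E1 E2] := @tangent_normal_eq x
  (w *m 'D_u (Gam v) x + w *m Gam v x *m Gam u x
   - form (g x) (v *m A x) w *: (u *m A x)
   - (w *m 'D_v (Gam u) x + w *m Gam u x *m Gam v x
   - form (g x) (u *m A x) w *: (v *m A x)))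
  (c *: (form (g x) v w *: u - form (g x) u w *: v
            - form (g x) (w *m S x) v *: (u *m S x)
            + form (g x) (w *m S x) u *: (v *m S x)
            - (2 * form (g x) (u *m S x) v) *: (w *m S x)))
  (N1 - N2)
  (c * (- form (g x) (w *m S x) v * form (g x) u (U x)
         + form (g x) (w *m S x) u * form (g x) v (U x)
         - 2 * form (g x) (u *m S x) v * form (g x) w (U x))) Vx.
  rewrite mulmxBl scalerBl addrACA -opprD e -!scalemxAl !(mulmxDl, mulmxBl, mulNmx) -!scalemxAl.
  by apply/rowP => k; rewrite !entryE; ring.
split.
  rewrite /riem_mx -E1 !(mulmxDr, mulmxN) !(mulmxA w) {E1 E2 e N1 N2}.
  move: (w *m 'D_u (Gam v) x) (w *m 'D_v (Gam u) x) => D1 D2.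
  move: (w *m Gam v x *m Gam u x) (w *m Gam u x *m Gam v x) => M1 M2.
  move: (form (g x) (v *m A x) w) (form (g x) (u *m A x) w) => s1 s2.
  move: (u *m A x) (v *m A x) => Au Av.
  by apply/rowP => k; rewrite !entryE; ring.
(* Torsion-freeness identifies [v *m Gam u x] with [u *m Gam v x]; the remaining connection terms
   are symmetric in [u] and [v], so only the covariant derivatives of [A] survive in [N1 - N2]. *)
rewrite -E2 /N1 /N2 (conn_mx_torsion u v Vx) !formDl formNl.
by move: (form _ _ _) (form _ _ _) (form _ _ _) => *; ring.
Qed.

Lemma codazzi x u v : V x ->
  v *m covder g u A x - u *m covder g v A x =
  c *: (form (g x) u (U x) *: (v *m S x) - form (g x) v (U x) *: (u *m S x)
        - (2 * form (g x) (u *m S x) v) *: U x).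
Proof.
move=> Vx; apply: (form_nondeg (induced_unit Vx)) => w.
have [_ ->] := gauss_codazzi u v w Vx.
rewrite formZl !formDl !formNl !formZl (structure_skew w v Vx) (structure_skew w u Vx).
rewrite (inducedC x w (v *m S x)) (inducedC x w (u *m S x)) (inducedC x w (U x)); ring.
Qed.

End HypersurfaceEquations.

(** * Covariant derivatives of endomorphism fields *)

Section CovariantCalculus.
Variables (R : realType) (n : nat) (g : 'rV[R]_n -> 'M[R]_n) (V : set 'rV[R]_n).
Hypothesis Vo : open V.
Local Notation Gam := (conn_mx g).
Local Notation cov := (covder g).
Hypothesis sGam : forall u, smooth_mx V (Gam u).
Hypothesis torsion : forall x u v, V x -> v *m Gam u x = u *m Gam v x.
Implicit Types (x u v w : 'rV[R]_n) (T : 'rV[R]_n -> 'M[R]_n).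

Lemma cov_lineardir a u v T x : smooth_mx V T -> V x ->
  cov (a *: u + v) T x = a *: cov u T x + cov v T x.
Proof.
move=> sT Vx; rewrite /covder conn_mx_linear (derive_mx_adddir Vo _ _ sT Vx).
rewrite (derive_mx_scaledir _ _ sT Vx); move: ('D_u T x) ('D_v T x) => A B.
rewrite mulmxDl mulmxDr -scalemxAl -scalemxAr.
by apply/matrixP => i j; rewrite !entryE; ring.
Qed.

Lemma covDdir u v T x : smooth_mx V T -> V x ->
  cov (u + v) T x = cov u T x + cov v T x.
Proof. by move=> sT Vx; have := cov_lineardir 1 u v sT Vx; rewrite !scale1r. Qed.

Lemma cov0dir T x : smooth_mx V T -> V x -> cov 0 T x = 0.
Proof.
by move=> sT Vx; apply: (addIr (cov 0 T x)); rewrite -covDdir// !add0r.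
Qed.

Lemma cov_sumdir (I : Type) (r : seq I) (k : I -> R) (w : I -> 'rV[R]_n) T x :
  smooth_mx V T -> V x ->
  cov (\sum_(i <- r) k i *: w i) T x = \sum_(i <- r) k i *: cov (w i) T x.
Proof.
move=> sT Vx; elim: r => [|i r IH]; first by rewrite !big_nil cov0dir.
by rewrite !big_cons cov_lineardir// IH.
Qed.

Lemma smooth_cov u T : smooth_mx V T -> smooth_mx V (cov u T).
Proof.
move=> sT; apply: (smooth_mxD Vo); last first.
  by apply: (smooth_mxN Vo); exact: (smooth_mulmx Vo (sGam u) sT).
by apply: (smooth_mxD Vo); [exact: smooth_mx_derive|exact: (smooth_mulmx Vo sT (sGam u))].
Qed.

Lemma derive_cov u v T x : smooth_mx V T -> V x ->
  'D_u (cov v T) x = 'D_u ('D_v T) x + ('D_u T x *m Gam v x + T x *m 'D_u (Gam v) x)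
   - ('D_u (Gam v) x *m T x + Gam v x *m 'D_u T x).
Proof.
move=> sT Vx; have sTG := smooth_mulmx Vo sT (sGam v).
have sGT := smooth_mulmx Vo (sGam v) sT; have sDT := smooth_mx_derive Vo v sT.
rewrite -(derive_mulmx Vo u sT (sGam v) Vx) -(derive_mulmx Vo u (sGam v) sT Vx).
rewrite -(derive_mxN u sGT Vx) -(derive_mxD u sDT sTG Vx).
by rewrite -(derive_mxD u (smooth_mxD Vo sDT sTG) (smooth_mxN Vo sGT) Vx).
Qed.

Lemma ricci_identity u v T x : smooth_mx V T -> V x ->
  cov u (cov v T) x - cov v (cov u T) x =
  T x *m riem_mx g u v x - riem_mx g u v x *m T x.
Proof.
move=> sT Vx.
have E a b : cov a (cov b T) x = 'D_a (cov b T) x + cov b T x *m Gam a x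
   - Gam a x *m cov b T x by [].
rewrite (etrans (E u v) (congr1 (fun D => D + cov v T x *m Gam u x
   - Gam u x *m cov v T x) (derive_cov u v sT Vx))).
rewrite (etrans (E v u) (congr1 (fun D => D + cov u T x *m Gam v x
   - Gam v x *m cov u T x) (derive_cov v u sT Vx))).
have -> : 'D_v ('D_u T) x = 'D_u ('D_v T) x by exact: (derive_mx_comm Vo u v sT Vx).
rewrite /covder /riem_mx.
move: ('D_u ('D_v T) x) ('D_u (Gam v) x) ('D_v (Gam u) x) => Tuv Gvu Guv.
move: ('D_u T x) ('D_v T x) (T x) (Gam u x) (Gam v x) => Tu Tv B Gu Gv.
rewrite !(mulmxDl, mulmxDr, mulmxBl, mulmxBr, mulNmx, mulmxN) !mulmxA.
by apply/matrixP => i j; rewrite !entryE; ring.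
Qed.

(** The tensorial second derivative: a constant field [v] is not parallel, and [v *m Gam u x] is its
    covariant derivative along [u]. *)
Definition covder2 u v T x : 'M[R]_n := cov u (cov v T) x - cov (v *m Gam u x) T x.

Local Notation cov2 := covder2.

Lemma cov2_comm u v T x : smooth_mx V T -> V x ->
  cov2 u v T x - cov2 v u T x = T x *m riem_mx g u v x - riem_mx g u v x *m T x.
Proof.
move=> sT Vx; rewrite /covder2 (torsion v u Vx) -(ricci_identity u v sT Vx).
move: (cov _ (cov _ T) x) (cov _ (cov _ T) x) (cov _ T x) => *.
by rewrite opprB addrA subrK.
Qed.

Lemma covM u T1 T2 x : smooth_mx V T1 -> smooth_mx V T2 -> V x ->
  cov u (fun y => T1 y *m T2 y) x = cov u T1 x *m T2 x + T1 x *m cov u T2 x.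
Proof.
move=> s1 s2 Vx; rewrite /covder (derive_mulmx Vo u s1 s2 Vx).
move: ('D_u T1 x) ('D_u T2 x) (T1 x) (T2 x) (Gam u x) => D1 D2 A B M.
rewrite !(mulmxDl, mulmxDr, mulmxBl, mulmxBr, mulNmx, mulmxN) !mulmxA.
by apply/matrixP => i j; rewrite !entryE; ring.
Qed.

Lemma covD u T1 T2 x : smooth_mx V T1 -> smooth_mx V T2 -> V x ->
  cov u (fun y => T1 y + T2 y) x = cov u T1 x + cov u T2 x.
Proof.
move=> s1 s2 Vx; rewrite /covder (derive_mxD u s1 s2 Vx) mulmxDl mulmxDr.
move: ('D_u T1 x) ('D_u T2 x) => D1 D2.
by apply/matrixP => i j; rewrite !entryE; ring.
Qed.

Lemma covZ u (a : 'rV[R]_n -> R) T x : smooth_on V a -> smooth_mx V T -> V x ->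
  cov u (fun y => a y *: T y) x = 'D_u a x *: T x + a x *: cov u T x.
Proof.
move=> sa sT Vx; rewrite /covder (derive_mxZ Vo u sa sT Vx) -scalemxAl -scalemxAr.
move: ('D_u T x) ('D_u a x) => D d.
by apply/matrixP => i j; rewrite !entryE; ring.
Qed.

Lemma cov_eq_on u T1 T2 x : (forall y, V y -> T1 y = T2 y) -> V x ->
  cov u T1 x = cov u T2 x.
Proof. by move=> T12 Vx; rewrite /covder (derive_eq_on Vo u T12 Vx) (T12 _ Vx). Qed.

Lemma cov2M u v T1 T2 x : smooth_mx V T1 -> smooth_mx V T2 -> V x ->
  cov2 u v (fun y => T1 y *m T2 y) x =
  cov2 u v T1 x *m T2 x + T1 x *m cov2 u v T2 x
  + (cov v T1 x *m cov u T2 x + cov u T1 x *m cov v T2 x).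
Proof.
move=> s1 s2 Vx; have c1 := smooth_cov v s1; have c2 := smooth_cov v s2.
rewrite /covder2 (covM _ s1 s2 Vx).
rewrite (@cov_eq_on u (cov v (fun y => T1 y *m T2 y))
  (fun y => cov v T1 y *m T2 y + T1 y *m cov v T2 y) x _ Vx); last first.
  by move=> y Vy; exact: covM.
rewrite (covD u (smooth_mulmx Vo c1 s2) (smooth_mulmx Vo s1 c2) Vx).
rewrite (covM u c1 s2 Vx) (covM u s1 c2 Vx).
move: (cov u (cov v T1) x) (cov u (cov v T2) x) (cov u T1 x) (cov u T2 x) => A1 A2 B1 B2.
move: (cov v T1 x) (cov v T2 x) (cov (v *m _) T1 x) (cov (v *m _) T2 x) => C1 C2 D1 D2.
rewrite mulmxBl mulmxBr.
by apply/matrixP => i j; rewrite !entryE; ring.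
Qed.

(** [cov u T] differs from ['D_u T] by a commutator, which has trace zero. *)
Lemma derive_trace_cov u T x : smooth_mx V T -> V x ->
  'D_u (fun y => \tr (T y)) x = \tr (cov u T x).
Proof.
move=> sT Vx; rewrite (derive_mxtrace Vo u sT Vx) /covder !raddfD /= raddfN /=.
by rewrite (mxtrace_mulC (T x)) addrK.
Qed.

Lemma derive2_trace_cov u v T x : smooth_mx V T -> V x ->
  'D_u ('D_v (fun y => \tr (T y))) x = \tr (cov u (cov v T) x).
Proof.
move=> sT Vx; rewrite -(derive_trace_cov u (smooth_cov v sT) Vx).
by apply: (derive_eq_on Vo) Vx => y Vy; exact: derive_trace_cov.
Qed.

(* The Leibniz rule for [y |-> v *m cov u T y], with [u] and [v] constant. *)
Lemma derive_mul_cov w u v T x : smooth_mx V T -> V x ->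
  'D_w (fun y => v *m cov u T y) x + v *m cov u T x *m Gam w x =
  v *m cov2 w u T x + v *m Gam w x *m cov u T x + v *m cov (u *m Gam w x) T x.
Proof.
move=> sT Vx; rewrite (derive_mulmxl Vo v w (smooth_cov u sT) Vx) /covder2.
have -> : cov w (cov u T) x = 'D_w (cov u T) x + cov u T x *m Gam w x
   - Gam w x *m cov u T x by [].
move: ('D_w (cov u T) x) (cov u T x) (cov _ T x) (Gam w x) => D C C' M.
rewrite !(mulmxDl, mulmxDr, mulmxBl, mulmxBr, mulNmx, mulmxN) !mulmxA.
by apply/rowP => j; rewrite !entryE; ring.
Qed.

Section Metric.
Hypotheses (sg : smooth_mx V g) (gsym : forall x, (g x)^T = g x).
Hypothesis gunit : forall x, V x -> g x \in unitmx.
Hypothesis dg : forall x u, V x ->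
  'D_u g x = Gam u x *m g x + g x *m (Gam u x)^T.

Definition selfadjoint_on T : Prop :=
  forall x, V x -> T x *m g x = g x *m (T x)^T.

(** Differentiate [T g = g T^T], replace the derivative of [g] by metric compatibility, and use the
    relation itself to move [T] across [g] in the connection terms. *)
Lemma selfadjoint_cov u T : smooth_mx V T -> selfadjoint_on T ->
  selfadjoint_on (cov u T).
Proof.
move=> sT aT x Vx; have sTt := smooth_mx_tr sT.
have e : 'D_u (fun y => T y *m g y) x = 'D_u (fun y => g y *m (T y)^T) x.
  exact: (derive_eq_on Vo u aT Vx).
rewrite (derive_mulmx Vo u sT sg Vx) (derive_mulmx Vo u sg sTt Vx) (dg u Vx) in e.
rewrite (derive_mx_tr u sT Vx) in e.
have a := aT x Vx; move: e a; rewrite /covder.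
move: ('D_u T x) (T x) (Gam u x) (g x) => D B M h e a.
rewrite !raddfD /= raddfN /= !trmx_mul.
move: e; rewrite !(mulmxDl, mulmxDr, mulmxBl, mulmxBr, mulNmx, mulmxN) !mulmxA.
have -> : M *m h *m B^T = M *m B *m h by rewrite -!mulmxA a.
have -> : B *m h *m M^T = h *m B^T *m M^T by rewrite a.
move=> e; apply/matrixP => i j; have := congr1 (fun X : 'M[R]_n => X i j) e.
by rewrite !entryE; lra.
Qed.

Lemma form_selfadjoint T x u v : selfadjoint_on T -> V x ->
  form (g x) (u *m T x) v = form (g x) u (v *m T x).
Proof.
by move=> aT Vx; rewrite /form -(mulmxA u) (aT _ Vx) trmx_mul !mulmxA.
Qed.

Lemma selfadjoint_cov2 u v T : smooth_mx V T -> selfadjoint_on T ->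
  selfadjoint_on (cov2 u v T).
Proof.
move=> sT aT x Vx; have sc := smooth_cov v sT.
rewrite /covder2 mulmxBl (selfadjoint_cov u sc (selfadjoint_cov v sT aT) Vx).
rewrite (selfadjoint_cov _ sT aT Vx).
by move: (cov u _ x) (cov _ T x) => B C; rewrite linearB /= mulmxBr.
Qed.

Lemma form_grad (f : 'rV[R]_n -> R) x v : smooth_on V f -> V x ->
  form (g x) (grad g f x) v = 'D_v f x.
Proof.
move=> sf Vx; rewrite /grad /form mulmxKV; last exact: gunit.
(* Viewing [f] as a matrix of size one makes the linearity of matrix derivatives in the direction
   available. *)
pose F y : 'rV[R]_1 := \row_(j < 1) f y.
have sF : smooth_mx V F by move=> i j; under eq_fun do rewrite mxE.
have -> : 'D_v f x = 'D_v F x 0 0.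
  by rewrite (derive_entry _ _ _ sF Vx); under [in RHS]eq_fun do rewrite mxE.
rewrite [in RHS](row_sum_delta v) (derive_mx_sumdir Vo _ _ _ sF Vx) summxE mxE.
apply: eq_bigr => i _; rewrite !entryE (derive_entry _ _ _ sF Vx) !mxE mulrC.
by under [in RHS]eq_fun do rewrite mxE.
Qed.

Lemma smooth_grad (f : 'rV[R]_n -> R) : smooth_on V f -> smooth_mx V (grad g f).
Proof.
move=> sf; apply: (smooth_mulmx Vo); last exact: (smooth_invmx Vo sg gunit).
by move=> i j; under eq_fun do rewrite mxE; exact: smooth_derive.
Qed.

Lemma form_nabla_grad (f : 'rV[R]_n -> R) x u v : smooth_on V f -> V x ->
  form (g x) (nabla g (cst u) (grad g f) x) v =
  'D_u ('D_v f) x - 'D_(v *m Gam u x) f x.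
Proof.
move=> sf Vx; have sG := smooth_grad sf.
rewrite /nabla /cst -mul_conn_mx.
have -> : 'D_u ('D_v f) x = 'D_u (fun y => form (g y) (grad g f y) v) x.
  by apply: (derive_eq_on Vo) Vx => y Vy; rewrite form_grad.
rewrite (derive_form Vo sg sG (smooth_mx_cst Vo v) u Vx) (derive_cst v) form0r.
rewrite -(form_grad _ sf Vx) (dg u Vx).
move: ('D_u (grad g f) x) (grad g f x) (Gam u x) (g x) => D r M h.
rewrite /form !(mulmxDl, mulmxDr) !entryD trmx_mul !mulmxA.
by move: (_ 0 0) (_ 0 0) (_ 0 0) => *; ring.
Qed.

Lemma form_nabla_grad_trace T x u v : smooth_mx V T -> V x ->
  form (g x) (nabla g (cst u) (grad g (fun y => \tr (T y))) x) v =
  \tr (cov2 u v T x).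
Proof.
move=> sT Vx; rewrite (form_nabla_grad u v (smooth_mxtrace Vo sT) Vx).
rewrite (derive2_trace_cov u v sT Vx) (derive_trace_cov _ sT Vx).
rewrite /covder2; move: (cov u _ x) (cov _ T x) => B C.
by rewrite linearB.
Qed.

End Metric.

(* The rows of [F] form an orthonormal basis of the tangent space at [x]. *)
Section OrthonormalSums.
Variables (x : 'rV[R]_n) (F : 'M[R]_n).
Hypotheses (gsymx : (g x)^T = g x) (F_orth : F *m g x *m F^T = 1%:M).
Local Notation b i := (row i F).

Lemma orthonormal_expand u : \sum_i form (g x) (b i) u *: b i = u.
Proof.
have uF : F \in unitmx by have := F_orth; rewrite -mulmxA => /mulmx1_unit[].
have E : g x *m F^T *m F = 1%:M.
  apply: (can_inj (mulKmx uF)); rewrite mulmx1 -[RHS]mul1mx -F_orth.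
  by rewrite !mulmxA.
transitivity (u *m (g x *m F^T *m F)); last by rewrite E mulmx1.
rewrite mulmxA [RHS]mulmx_sum_row; apply: eq_bigr => i _; congr (_ *: _).
rewrite (form_sym _ _ gsymx) /form mulmxA !mxE; apply: eq_bigr => k _.
by rewrite !mxE.
Qed.

Lemma orthonormal_sum u (T : 'M[R]_n) : \sum_i form (g x) (b i) u *: (b i *m T) = u *m T.
Proof.
rewrite -[in RHS](orthonormal_expand u) mulmx_suml; apply: eq_bigr => i _.
by rewrite scalemxAl.
Qed.

Lemma orthonormal_form u v :
  \sum_i form (g x) (b i) u * form (g x) (b i) v = form (g x) u v.
Proof.
rewrite -[in RHS](orthonormal_expand u) form_suml; apply: eq_bigr => i _.
by rewrite formZl.
Qed.

Lemma orthonormal_trace (T : 'M[R]_n) :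
  \sum_i form (g x) (b i *m T) (b i) = \tr T.
Proof.
have uF : F \in unitmx by have := F_orth; rewrite -mulmxA => /mulmx1_unit[].
transitivity (\tr (F *m T *m g x *m F^T)).
  apply: eq_bigr => i _; rewrite /form -!row_mul !mxE; apply: eq_bigr => k _.
  by rewrite !mxE.
rewrite -!mulmxA mxtrace_mulC -!mulmxA.
suff -> : g x *m (F^T *m F) = 1%:M by rewrite mulmx1.
apply: (can_inj (mulKmx uF)); rewrite mulmx1 -[RHS]mul1mx -F_orth.
by rewrite !mulmxA.
Qed.

End OrthonormalSums.

End CovariantCalculus.

(** * Simons' formula *)

Section Simons.
Variables (R : realType) (n : nat) (c : R) (V : set 'rV[R]_n).
Variables (g A S : 'rV[R]_n -> 'M[R]_n) (U : 'rV[R]_n -> 'rV[R]_n).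
Hypothesis Vo : open V.
Local Notation Gam := (conn_mx g).
Local Notation cov := (covder g).
Local Notation cov2 := (covder2 g).
Local Notation q x := (form (g x)).
Hypotheses (sg : smooth_mx V g) (sGam : forall u, smooth_mx V (Gam u)).
Hypotheses (sA : smooth_mx V A) (sS : smooth_mx V S) (sU : smooth_mx V U).
Hypothesis gsym : forall x, (g x)^T = g x.
Hypothesis gunit : forall x, V x -> g x \in unitmx.
Hypothesis torsion : forall x u v, V x -> v *m Gam u x = u *m Gam v x.
Hypothesis dg : forall x u, V x ->
  'D_u g x = Gam u x *m g x + g x *m (Gam u x)^T.
Hypothesis Asym : forall x u v, V x -> q x (u *m A x) v = q x u (v *m A x).
Hypothesis Sskew : forall x u v, V x -> q x (u *m S x) v = - q x u (v *m S x).
Hypothesis Ssq : forall x u, V x -> u *m S x *m S x = - u + q x u (U x) *: U x.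
Hypothesis Uunit : forall x, V x -> q x (U x) (U x) = 1.
Hypothesis covU : forall x u, V x ->
  'D_u U x + U x *m Gam u x = u *m A x *m S x.
Hypothesis covS : forall x u w, V x -> w *m cov u S x =
  q x w (U x) *: (u *m A x) - q x (u *m A x) w *: U x.
Hypothesis codazzi_eq : forall x u v, V x ->
  v *m cov u A x - u *m cov v A x =
  c *: (q x u (U x) *: (v *m S x) - q x v (U x) *: (u *m S x)
        - (2 * q x (u *m S x) v) *: U x).
Hypothesis gauss_eq : forall x u v w, V x ->
  w *m riem_mx g u v x =
    q x (v *m A x) w *: (u *m A x) - q x (u *m A x) w *: (v *m A x)
    + c *: (q x v w *: u - q x u w *: v - q x (w *m S x) v *: (u *m S x)
            + q x (w *m S x) u *: (v *m S x)
            - (2 * q x (u *m S x) v) *: (w *m S x)).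
Implicit Types (x u v w z : 'rV[R]_n) (Y Z : 'rV[R]_n -> 'rV[R]_n).

(** The counterpart of [covder] for vector fields, with the direction [w] held constant. *)
Definition covv w Y x : 'rV[R]_n := 'D_w Y x + Y x *m Gam w x.

Lemma metricC x u v : q x u v = q x v u.
Proof. exact: form_sym (gsym x). Qed.

Lemma derive_q w Y Z x : smooth_mx V Y -> smooth_mx V Z -> V x ->
  'D_w (fun y => q y (Y y) (Z y)) x = q x (covv w Y x) (Z x) + q x (Y x) (covv w Z x).
Proof.
move=> sY sZ Vx; rewrite (derive_form Vo sg sY sZ w Vx) (dg w Vx) /covv.
move: ('D_w Y x) ('D_w Z x) (Y x) (Z x) (Gam w x) (g x) => y' z' y z M h.
rewrite !formDl !formDr.
have -> : form (M *m h + h *m M^T) y z = form h (y *m M) z + form h y (z *m M).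
  by rewrite /form mulmxDr mulmxDl entryD trmx_mul !mulmxA.
by move: (form _ _ _) (form _ (y *m M) _) (form h y' z) (form h y z') => *; ring.
Qed.

Lemma covvD w Y Z x : smooth_mx V Y -> smooth_mx V Z -> V x ->
  covv w (fun y => Y y + Z y) x = covv w Y x + covv w Z x.
Proof.
by move=> sY sZ Vx; rewrite /covv (derive_mxD w sY sZ Vx) mulmxDl addrACA.
Qed.

Lemma covvN w Y x : smooth_mx V Y -> V x -> covv w (fun y => - Y y) x = - covv w Y x.
Proof. by move=> sY Vx; rewrite /covv (derive_mxN w sY Vx) mulNmx opprD. Qed.

Lemma covvZ w (a : 'rV[R]_n -> R) Y x : smooth_on V a -> smooth_mx V Y -> V x ->
  covv w (fun y => a y *: Y y) x = 'D_w a x *: Y x + a x *: covv w Y x.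
Proof.
move=> sa sY Vx; rewrite /covv (derive_mxZ Vo w sa sY Vx) -scalemxAl.
by rewrite scalerDr addrA.
Qed.

Lemma covvM w v (T : 'rV[R]_n -> 'M[R]_n) x : smooth_mx V T -> V x ->
  covv w (fun y => v *m T y) x = v *m cov w T x + v *m Gam w x *m T x.
Proof.
move=> sT Vx; rewrite /covv (derive_mulmxl Vo v w sT Vx) /covder.
move: ('D_w T x) (T x) (Gam w x) => D B M.
by rewrite mulmxBr mulmxDr !mulmxA subrK.
Qed.

Lemma covv_cst w v x : covv w (cst v) x = v *m Gam w x.
Proof. by rewrite /covv derive_cst add0r. Qed.

Lemma covv_eq_on w Y Z x : (forall y, V y -> Y y = Z y) -> V x ->
  covv w Y x = covv w Z x.
Proof. by move=> YZ Vx; rewrite /covv (derive_eq_on Vo w YZ Vx) (YZ _ Vx). Qed.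

Lemma A_selfadjoint : selfadjoint_on g V A.
Proof.
move=> x Vx; apply/matrixP => i j; rewrite -!form_delta.
have := Asym (delta_mx 0 i) (delta_mx 0 j) Vx.
by rewrite /form trmx_mul !mulmxA.
Qed.

(** Both sides of the Codazzi equation are differentiated covariantly along [w]; on the right this
    uses the derivatives of [U] and [S]. *)
Lemma codazzi_derivative w u v x : V x ->
  v *m cov2 w u A x - u *m cov2 w v A x =
  c *: (q x u (w *m A x *m S x) *: (v *m S x)
        - q x v (w *m A x *m S x) *: (u *m S x)
        - (2 * q x (u *m S x) v) *: (w *m A x *m S x)
        + (3 * (q x v (U x) * q x (w *m A x) u
                - q x u (U x) * q x (w *m A x) v)) *: U x).
Proof.
move=> Vx.
have sK (a b : 'rV[R]_n) : smooth_mx V (fun y => b *m cov a A y).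
  by apply: (smooth_mulmxl Vo); exact: smooth_cov.
have sC a := smooth_mx_cst Vo (a : 'rV[R]_n).
have sbS (a : 'rV[R]_n) := smooth_mulmxl Vo a sS.
have saU a : smooth_on V (fun y => q y a (U y)).
  exact: (smooth_form Vo sg (sC a) sU).
have sSa : smooth_on V (fun y => 2 * q y (u *m S y) v).
  exact: (smoothM Vo (smooth_cst Vo (2 : R)) (smooth_form Vo sg (sbS u) (sC v))).
have DaU a : 'D_w (fun y => q y a (U y)) x = q x (a *m Gam w x) (U x) + q x a (w *m A x *m S x).
  by have := derive_q w (sC a) sU Vx; rewrite covv_cst /covv (covU w Vx).
have DSa : 'D_w (fun y => 2 * q y (u *m S y) v) x =
    2 * (q x (u *m cov w S x + u *m Gam w x *m S x) v + q x (u *m S x) (v *m Gam w x)).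
  have := smooth_deriveM w (smooth_cst Vo (2 : R)) (smooth_form Vo sg (sbS u) (sC v)) Vx.
  rewrite derive_cst mul0r add0r => ->; congr (_ * _).
  by rewrite (derive_q w (sbS u) (sC v) Vx) covv_cst (covvM w u sS Vx).
have L : covv w (fun y => v *m cov u A y - u *m cov v A y) x =
    v *m cov2 w u A x - u *m cov2 w v A x
    + (v *m Gam w x *m cov u A x - u *m cov (v *m Gam w x) A x)
    + (v *m cov (u *m Gam w x) A x - u *m Gam w x *m cov v A x).
  rewrite (covvD w (sK u v) (smooth_mxN Vo (sK v u)) Vx) (covvN w (sK v u) Vx).
  have Lu : covv w (fun y => v *m cov u A y) x = _ := derive_mul_cov Vo sGam w u v sA Vx.
  have Lv : covv w (fun y => u *m cov v A y) x = _ := derive_mul_cov Vo sGam w v u sA Vx.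
  rewrite {}Lu {}Lv.
  move: (v *m cov2 w u A x) (u *m cov2 w v A x) => X1 X2.
  move: (v *m Gam w x *m cov u A x) (u *m Gam w x *m cov v A x) => X3 X4.
  move: (v *m cov (u *m Gam w x) A x) (u *m cov (v *m Gam w x) A x) => X5 X6.
  by apply/rowP => k; rewrite !entryE; ring.
have s1 := smooth_mxZ Vo (saU u) (sbS v).
have s2 := smooth_mxZ Vo (saU v) (sbS u).
have s3 := smooth_mxZ Vo sSa sU.
have s12 := smooth_mxD Vo s1 (smooth_mxN Vo s2).
have s123 := smooth_mxD Vo s12 (smooth_mxN Vo s3).
have Rr : covv w (fun y => v *m cov u A y - u *m cov v A y) x =
    c *: ((q x (u *m Gam w x) (U x) + q x u (w *m A x *m S x)) *: (v *m S x)
      + q x u (U x) *: (v *m cov w S x + v *m Gam w x *m S x)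
      - ((q x (v *m Gam w x) (U x) + q x v (w *m A x *m S x)) *: (u *m S x)
      + q x v (U x) *: (u *m cov w S x + u *m Gam w x *m S x))
      - ((2 * (q x (u *m cov w S x + u *m Gam w x *m S x) v
               + q x (u *m S x) (v *m Gam w x))) *: U x
         + (2 * q x (u *m S x) v) *: (w *m A x *m S x))).
  rewrite (@covv_eq_on w _ (fun y => cst c y *: (q y u (U y) *: (v *m S y)
    - q y v (U y) *: (u *m S y) - (2 * q y (u *m S y) v) *: U y)) x _ Vx); last first.
    by move=> y Vy; exact: codazzi_eq.
  rewrite (covvZ w (smooth_cst Vo c) s123 Vx) derive_cst scale0r add0r; congr (_ *: _).
  rewrite (covvD w s12 (smooth_mxN Vo s3) Vx) (covvD w s1 (smooth_mxN Vo s2) Vx).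
  rewrite (covvN w s2 Vx) (covvN w s3 Vx).
  rewrite (covvZ w (saU u) (sbS v) Vx) (covvZ w (saU v) (sbS u) Vx) (covvZ w sSa sU Vx).
  by rewrite (DaU u) (DaU v) DSa (covvM w u sS Vx) (covvM w v sS Vx) /covv (covU w Vx).
(* The connection terms of [L] are the Codazzi defect at two other pairs of vectors; they cancel the
   connection terms of [Rr]. *)
rewrite L (codazzi_eq u (v *m Gam w x) Vx) (codazzi_eq (u *m Gam w x) v Vx) in Rr.
(* Here the multiples of [w *m A x] cancel, while the multiples of [U x] occur once from the
   derivatives of [v S] and [u S] and twice from the scalar in front of [U]: hence the coefficient
   3. *)
rewrite (covS w u Vx) (covS w v Vx) in Rr.
rewrite !(formDl, formNl, formZl) in Rr.
rewrite (metricC x (U x) v) in Rr.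
move: Rr.
move: (v *m cov2 w u A x) (u *m cov2 w v A x) => X1 X2 Rr.
apply/rowP => k; have := congr1 (fun X : 'rV[R]_n => X 0 k) Rr.
rewrite !entryE => e; lra.
Qed.

Section AtPoint.
Variables (x : 'rV[R]_n) (F : 'M[R]_n).
Hypotheses (Vx : V x) (F_orth : F *m g x *m F^T = 1%:M).
Local Notation b i := (row i F).
Local Notation f := (\tr (A x)).
Local Notation f2 := (\tr (A x *m A x)).
Local Notation f3 := (\tr (A x *m A x *m A x)).

Let expand := orthonormal_expand (gsym x) F_orth.
Let osum := orthonormal_sum (gsym x) F_orth.
Let oform := orthonormal_form (gsym x) F_orth.
Let otrace := orthonormal_trace F_orth.

Lemma trace_structure : \tr (S x) = 0.
Proof.
rewrite -otrace big1 // => i _; apply/eqP.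
have := Sskew (b i) (b i) Vx; rewrite (metricC x (b i)) => /eqP.
by rewrite -subr_eq0 opprK -mulr2n mulrn_eq0.
Qed.

(** With [A] self-adjoint and [S] skew, the trace equals its own opposite. *)
Lemma trace_shape_structure : \tr (A x *m S x) = 0.
Proof.
have e : \tr (A x *m S x) = - \tr (S x *m A x).
  rewrite -!otrace -sumrN; apply: eq_bigr => i _; rewrite !mulmxA.
  rewrite (Sskew _ _ Vx) (Asym _ _ Vx) (metricC x (b i)).
  by [].
move: e; rewrite (mxtrace_mulC (S x)) => /eqP.
by rewrite -subr_eq0 opprK -mulr2n mulrn_eq0 => /eqP.
Qed.

Definition hess_trace v : 'rV[R]_n :=
  nabla g (cst v) (grad g (fun y => \tr (A y))) x.

Lemma form_hess_trace v z : q x (hess_trace v) z = \tr (cov2 v z A x).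
Proof. exact: (form_nabla_grad_trace Vo sGam sg gunit dg v z sA Vx). Qed.

Lemma form_shape_adj u v : q x (u *m A x) v = q x u (v *m A x).
Proof. exact: Asym. Qed.

Lemma form_structure_adj u v : q x (u *m S x) v = - q x u (v *m S x).
Proof. exact: Sskew. Qed.

(* The covariant derivative of the Codazzi defect is traceless. *)
Lemma cov2_divergence v : \sum_i b i *m cov2 v (b i) A x = hess_trace v.
Proof.
apply: (form_nondeg (gunit Vx)) => z.
rewrite form_hess_trace -otrace form_suml.
have sa2 u w := selfadjoint_cov2 Vo sGam sg dg u w sA A_selfadjoint.
(* The defect paired with [b i], arranged so that each summand contracts through [oform] or
   [otrace]. The total is 3<vAS, zS> + 3<z, U><vA, U> - 3<vA, z>, up to [c] and a multiple of tr S;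
   it vanishes by the formula for the square of [S]. *)
pose d i := c * (q x (b i) (v *m A x *m S x) * q x (b i) (z *m S x)
  + - q x z (v *m A x *m S x) * q x (b i *m S x) (b i)
  + 2 * (q x (b i) (z *m S x) * q x (b i) (v *m A x *m S x))
  + 3 * q x z (U x) * (q x (b i) (v *m A x) * q x (b i) (U x))
  + - (3 * q x (v *m A x) z) * (q x (b i) (U x) * q x (b i) (U x))).
transitivity (\sum_i (q x (b i *m cov2 v z A x) (b i) + d i)).
  apply: eq_bigr => i _.
  rewrite (form_selfadjoint _ _ (sa2 v (b i)) Vx).
  have := codazzi_derivative v (b i) z Vx => /eqP; rewrite subr_eq addrC => /eqP ->.
  rewrite formDr (metricC x (b i) (b i *m _)); congr (_ + _).
  rewrite formZr !formDr !formNr !formZr /d (metricC x (b i) (b i *m S x)) (form_structure_adj (b i) z).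
  rewrite (metricC x (v *m A x) (b i)); ring.
rewrite big_split /= -[RHS]addr0; congr (_ + _).
rewrite -mulr_sumr !big_split /= -!mulr_sumr !oform otrace trace_structure.
have e : q x (v *m A x *m S x) (z *m S x) =
    q x (v *m A x) z - q x (v *m A x) (U x) * q x z (U x).
  have := form_structure_adj (v *m A x *m S x) z; rewrite (Ssq _ Vx) formDl formNl formZl.
  by rewrite (metricC x (U x)) => /(congr1 -%R); rewrite opprK => <-; ring.
rewrite (metricC x (z *m S x)) e (Uunit Vx) (metricC x z (U x)); ring.
Qed.

(** One summand after the exchanges Codazzi, then Ricci. Each term is kept in a shape that an
    orthonormal sum contracts, which explains forms such as [r *m 1%:M]. The coefficients 2c = c + c
    and 4c = 2c + 2c collect equal contributions of the Codazzi derivative and of the curvature. *)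
Lemma simons_term i v : let r := b i in
  v *m cov2 r r A x = r *m cov2 v r A x
  + (q x r (v *m A x *m A x) *: (r *m A x)
  + - (q x (r *m (A x *m A x)) r *: (v *m A x))
  + c *: (q x r (v *m A x) *: r)
  + - c *: (q x (r *m A x) r *: v)
  + (2 * c) *: (q x r (v *m S x *m A x) *: (r *m S x))
  + (2 * c) *: (q x (r *m (A x *m S x)) r *: (v *m S x))
  + (4 * c) *: (q x r (v *m S x) *: (r *m (A x *m S x)))
  + - (q x r (v *m A x) *: (r *m (A x *m A x)))
  + q x (r *m A x) r *: (v *m A x *m A x)
  + - c *: (q x r v *: (r *m A x))
  + c *: (q x (r *m 1%:M) r *: (v *m A x))
  + - (3 * c) *: (q x r (v *m S x) *: (r *m (S x *m A x)))
  + - c *: (q x (r *m S x) r *: (v *m S x *m A x))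
  + (3 * c * q x v (U x)) *: (q x (r *m A x) r *: U x)
  + - (3 * c) *: ((q x r (U x) * q x r (v *m A x)) *: U x)).
Proof.
move=> r.
have e1 := codazzi_derivative r r v Vx.
have e2 : r *m cov2 r v A x - r *m cov2 v r A x =
    r *m A x *m riem_mx g r v x - r *m riem_mx g r v x *m A x.
  by rewrite -mulmxBr (cov2_comm Vo sGam torsion r v sA Vx) mulmxBr !mulmxA.
rewrite (gauss_eq r v (r *m A x) Vx) (gauss_eq r v r Vx) in e2.
rewrite !mulmxA mulmx1.
move: e1 e2; move: (v *m cov2 r r A x) (r *m cov2 r v A x) (r *m cov2 v r A x) => X1 X2 X3.
rewrite !(mulmxDl, mulmxBl, mulNmx) -!scalemxAl !(mulmxDl, mulmxBl, mulNmx) -!scalemxAl.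
(* From here on adjoints bring every scalar either to [r] paired with a vector free of [r], or to a
   diagonal entry of an endomorphism. *)
have -> : q x (r *m A x *m S x) v = - q x r (v *m S x *m A x).
  by rewrite form_structure_adj form_shape_adj.
have -> : q x v (r *m A x *m S x) = - q x r (v *m S x *m A x).
  by rewrite metricC form_structure_adj form_shape_adj.
have -> : q x (v *m A x) (r *m A x) = q x r (v *m A x *m A x).
  by rewrite metricC form_shape_adj.
have -> : q x (r *m A x) (r *m A x) = q x (r *m A x *m A x) r by rewrite [RHS]form_shape_adj.
have -> : q x v (r *m A x) = q x r (v *m A x) by rewrite metricC form_shape_adj.
have -> : q x r (r *m A x *m S x) = q x (r *m A x *m S x) r by rewrite metricC.
have -> : q x (v *m A x) r = q x r (v *m A x) by rewrite metricC.
have -> : q x (r *m S x) v = - q x r (v *m S x) by rewrite form_structure_adj.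
have -> : q x r (r *m A x) = q x (r *m A x) r by rewrite metricC.
have -> : q x (r *m A x) v = q x r (v *m A x) by rewrite form_shape_adj.
rewrite (metricC x v r).
move=> e1 e2; apply/rowP => k.
have := congr1 (fun X : 'rV[R]_n => X 0 k) e1.
have := congr1 (fun X : 'rV[R]_n => X 0 k) e2.
rewrite !entryE => {}e1 {}e2.
have -> : X1 0 k = X3 0 k + (X2 0 k - X3 0 k) + (X1 0 k - X2 0 k) by ring.
rewrite e1 e2; ring.
Qed.

(** The cubic terms cancel, as do those with tr S or tr AS. The coefficient 6c is 2c + 4c; in
    [n + 3], [n] is the trace of the identity and 3 comes from - 3c S S A, whose square of [S] also
    yields the term in <U, v> AU. *)
Lemma simons_vector v : v *m (\sum_i cov2 (b i) (b i) A x) = hess_trace v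
  - ((3 * c) *: (q x (U x *m A x - f *: U x) v *: U x + q x (U x) v *: (U x *m A x))
     - (6 * c) *: (v *m S x *m A x *m S x) + (c * f) *: v
     + (f2 - c * (n + 3)%:R) *: (v *m A x) - f *: (v *m A x *m A x)).
Proof.
rewrite mulmx_sumr (eq_bigr _ (fun i _ => simons_term i v)) big_split /=.
rewrite cov2_divergence; congr (_ + _).
rewrite !big_split /= !sumrN -!scaler_sumr -!scaler_suml !osum !otrace expand oform.
rewrite trace_structure trace_shape_structure mxtrace1 !mulmxA.
rewrite (Ssq v Vx) mulmxDl mulNmx -scalemxAl natrD.
rewrite !(formDl, formNl, formZl) (metricC x (U x) v) form_shape_adj.
rewrite (metricC x (U x) (v *m A x)).
move: (v *m A x *m A x *m A x) => v3.
by apply/rowP => k; rewrite !entryE; ring.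
Qed.

Lemma simons_trace :
  \tr (A x *m \sum_i cov2 (b i) (b i) A x) =
  \sum_i q x (hess_trace (b i *m A x)) (b i)
  - (6 * c * q x (U x *m A x) (U x *m A x) - 3 * c * f * q x (U x *m A x) (U x)
     - 6 * c * \tr (S x *m A x *m S x *m A x) + c * f ^+ 2
     + (f2 - c * (n + 3)%:R) * f2 - f * f3).
Proof.
rewrite -[LHS]otrace.
(* The curvature part of [simons_vector] at [v = b i *m A x], paired with [b i]. Its first and third
   terms both sum to a multiple of <AU, AU>, which turns 3c into 6c. *)
pose t i := - (3 * c) * (q x (b i) (U x *m A x *m A x) * q x (b i) (U x))
  + (3 * c * f) * (q x (b i) (U x *m A x) * q x (b i) (U x))
  + - (3 * c) * (q x (b i) (U x *m A x) * q x (b i) (U x *m A x))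
  + (6 * c) * q x (b i *m (A x *m S x *m A x *m S x)) (b i)
  + - (c * f) * q x (b i *m A x) (b i)
  + - (f2 - c * (n + 3)%:R) * q x (b i *m (A x *m A x)) (b i)
  + f * q x (b i *m (A x *m A x *m A x)) (b i).
transitivity (\sum_i (q x (hess_trace (b i *m A x)) (b i) + t i)).
  apply: eq_bigr => i _; rewrite mulmxA simons_vector formDl; congr (_ + _).
  rewrite /t !mulmxA !(formDl, formNl, formZl).
  rewrite (metricC x (U x) (b i *m A x)) (metricC x (U x *m A x) (b i *m A x)) !form_shape_adj.
  rewrite (metricC x (U x) (b i)) -!form_shape_adj (metricC x (U x *m A x) (b i)) ?form_shape_adj.
  ring.
rewrite big_split /=; congr (_ + _).
rewrite /t !big_split /= -!mulr_sumr !(oform, otrace).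
rewrite (form_shape_adj (U x *m A x)).
have -> : \tr (A x *m S x *m A x *m S x) = \tr (S x *m A x *m S x *m A x).
  by rewrite -!mulmxA mxtrace_mulC !mulmxA.
ring.
Qed.

End AtPoint.
End Simons.

(** Recovers the endomorphism [u |-> nabla_u (grad f)] from the matrix whose trace defines
    [laplacian]. *)
Lemma mul_matrix_linear (R : comNzRingType) (p q : nat) (L : 'rV[R]_p -> 'rV[R]_q) u :
  (forall a v w, L (a *: v + w) = a *: L v + L w) ->
  u *m (\matrix_i L (delta_mx 0 i)) = L u.
Proof.
move=> Llin; have L0 : L 0 = 0.
  have := Llin 1 0 0; rewrite scaler0 addr0 scale1r => /eqP.
  by rewrite -subr_eq0 opprD addNKr oppr_eq0 => /eqP.
have Lsum (I : Type) (r : seq I) (k : I -> R) (w : I -> 'rV[R]_p) :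
    L (\sum_(i <- r) k i *: w i) = \sum_(i <- r) k i *: L (w i).
  by elim: r => [|i r IH]; rewrite ?big_nil// !big_cons Llin IH.
rewrite [in RHS](row_sum_delta u) Lsum mulmx_sum_row.
by apply: eq_bigr => i _; rewrite rowK.
Qed.

(** * From operators on vector fields to matrix covariant derivatives *)

Section OperatorFormulas.
Variables (R : realType) (n : nat) (g : 'rV[R]_n -> 'M[R]_n) (V : set 'rV[R]_n).
Hypothesis Vo : open V.
Local Notation Gam := (conn_mx g).
Local Notation cov := (covder g).
Local Notation cov2 := (covder2 g).
Hypothesis sGam : forall u, smooth_mx V (Gam u).
Hypotheses (sg : smooth_mx V g) (gunit : forall x, V x -> g x \in unitmx).
Hypothesis dg : forall x u, V x ->
  'D_u g x = Gam u x *m g x + g x *m (Gam u x)^T.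
Implicit Types (x u v w : 'rV[R]_n) (Y Z : 'rV[R]_n -> 'rV[R]_n).
Implicit Types (T : 'rV[R]_n -> 'M[R]_n).

Definition mulop T : ('rV[R]_n -> 'rV[R]_n) -> 'rV[R]_n -> 'rV[R]_n :=
  fun Y y => Y y *m T y.

Lemma nablaE Y Z x : nabla g Y Z x = 'D_(Y x) Z x + Z x *m Gam (Y x) x.
Proof. by rewrite /nabla mul_conn_mx. Qed.

Lemma nabla_linear Y a u v x : smooth_mx V Y -> V x ->
  nabla g (cst (a *: u + v)) Y x = a *: nabla g (cst u) Y x + nabla g (cst v) Y x.
Proof.
move=> sY Vx; rewrite !nablaE /cst (derive_mx_adddir Vo _ _ sY Vx).
rewrite (derive_mx_scaledir _ _ sY Vx) conn_mx_linear mulmxDr -scalemxAr.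
rewrite scalerDr; exact: addrACA.
Qed.

Lemma nabla_endE Y T Z x : smooth_mx V T -> smooth_mx V Z -> V x ->
  nabla_end g Y (mulop T) Z x = Z x *m cov (Y x) T x.
Proof.
move=> sT sZ Vx; rewrite /nabla_end /mulop !nablaE (derive_mulmx Vo _ sZ sT Vx).
rewrite /covder; move: ('D_(Y x) Z x) ('D_(Y x) T x) => D1 D2.
move: (Z x) (T x) (Gam (Y x) x) => z B M.
rewrite !(mulmxDl, mulmxDr, mulmxN) !mulmxA.
by apply/rowP => k; rewrite !entryE; ring.
Qed.

Lemma cov_field_sum Y T x : smooth_mx V T -> V x ->
  cov (Y x) T x = \sum_k Y x 0 k *: cov (delta_mx 0 k) T x.
Proof.
by move=> sT Vx; rewrite {1}(row_sum_delta (Y x)) (cov_sumdir g Vo _ _ _ sT Vx).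
Qed.

Lemma smooth_scale_sum (I : Type) (r : seq I) p q (a : I -> 'rV[R]_n -> R)
    (F : I -> 'rV[R]_n -> 'M[R]_(p, q)) :
  (forall i, smooth_on V (a i)) -> (forall i, smooth_mx V (F i)) ->
  smooth_mx V (fun y => \sum_(i <- r) a i y *: F i y).
Proof.
move=> sa sF i j; under eq_fun do rewrite summxE.
apply: (smooth_sum Vo) => k _; under eq_fun do rewrite entryE.
by apply: (smoothM Vo); [exact: sa|exact: sF].
Qed.

(** A variable direction is expanded in coordinates, leaving derivatives in constant directions with
    smooth coefficients. *)
Lemma smooth_cov_field Y T : smooth_mx V Y -> smooth_mx V T ->
  smooth_mx V (fun y => cov (Y y) T y).
Proof.
move=> sY sT; apply: (@smooth_mx_eq_on _ _ _ Vo _ _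
  (fun y => \sum_k Y y 0 k *: cov (delta_mx 0 k) T y)).
  by move=> y Vy; rewrite (cov_field_sum Y sT Vy).
by apply: smooth_scale_sum => k; [exact: sY|exact: (smooth_cov Vo sGam)].
Qed.

Lemma smooth_nabla Y Z : smooth_mx V Y -> smooth_mx V Z -> smooth_mx V (nabla g Y Z).
Proof.
move=> sY sZ; apply: (@smooth_mx_eq_on _ _ _ Vo _ _
  (fun y => \sum_k Y y 0 k *: ('D_(delta_mx 0 k) Z y + Z y *m Gam (delta_mx 0 k) y))).
  move=> y Vy.
  have := @mul_matrix_linear _ _ _ (fun u => nabla g (cst u) Z y) (Y y)
    (fun a u v => nabla_linear a u v sZ Vy).
  rewrite mulmx_sum_row => eY; apply: etrans eY; apply: eq_bigr => k _.
  by rewrite rowK nablaE.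
apply: smooth_scale_sum => k; first exact: sY.
by apply: (smooth_mxD Vo); [exact: smooth_mx_derive|exact: (smooth_mulmx Vo sZ (sGam _))].
Qed.

Lemma cov_scale_sum u (I : Type) (r : seq I) (a : I -> 'rV[R]_n -> R)
    (F : I -> 'rV[R]_n -> 'M[R]_n) x :
  (forall i, smooth_on V (a i)) -> (forall i, smooth_mx V (F i)) -> V x ->
  cov u (fun y => \sum_(i <- r) a i y *: F i y) x =
  \sum_(i <- r) ('D_u (a i) x *: F i x + a i x *: cov u (F i) x).
Proof.
move=> sa sF Vx; elim: r => [|i r IH].
  under eq_fun do rewrite big_nil.
  by rewrite big_nil /covder derive_cst mulmx0 mul0mx addr0 subr0.
under eq_fun do rewrite big_cons.
rewrite big_cons -IH (covD g u (smooth_mxZ Vo (sa i) (sF i)) (smooth_scale_sum _ sa sF) Vx).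
by rewrite (covZ g Vo u (sa i) (sF i) Vx).
Qed.

(** Expanded in coordinates, the left side and the same expression with [Y] frozen at [x] differ
    only by the derivatives of the coefficients of [Y]. *)
Lemma cov_cov_field u Y T x : smooth_mx V Y -> smooth_mx V T -> V x ->
  cov u (fun y => cov (Y y) T y) x = cov ('D_u Y x) T x + cov u (cov (Y x) T) x.
Proof.
move=> sY sT Vx; pose d k := delta_mx (0 : 'I_1) k : 'rV[R]_n.
have sc k := smooth_cov Vo sGam (d k) sT.
have E1 y : V y -> cov (Y y) T y = \sum_k Y y 0 k *: cov (d k) T y.
  by move=> Vy; exact: cov_field_sum.
have E2 y : V y -> cov (Y x) T y = \sum_k cst (Y x 0 k) y *: cov (d k) T y.
  by move=> Vy; exact: (cov_field_sum (cst (Y x)) sT Vy).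
rewrite (cov_eq_on g Vo u E1 Vx) (cov_eq_on g Vo u E2 Vx).
rewrite (cov_scale_sum u _ (fun k => sY 0 k) sc Vx).
rewrite (cov_scale_sum u _ (fun k => smooth_cst Vo (Y x 0 k)) sc Vx).
rewrite (cov_field_sum (cst ('D_u Y x)) sT Vx) -big_split; apply: eq_bigr => k _ /=.
rewrite /cst (derive_entry u 0 k sY Vx); congr (_ + _).
by rewrite (derive_cst (Y x 0 k)) scale0r add0r.
Qed.

Lemma nabla_end2E Y T Z x : smooth_mx V Y -> smooth_mx V T -> smooth_mx V Z -> V x ->
  nabla_end g Y (nabla_end g Y (mulop T)) Z x =
  Z x *m (cov ('D_(Y x) Y x) T x + cov (Y x) (cov (Y x) T) x).
Proof.
move=> sY sT sZ Vx; have sC := smooth_cov_field sY sT.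
rewrite -(cov_cov_field (Y x) sY sT Vx).
transitivity (nabla_end g Y (mulop (fun y => cov (Y y) T y)) Z x); last first.
  exact: (nabla_endE Y sC sZ Vx).
(* The inner operator is a matrix multiplication only on [V] and for smooth fields; openness of [V]
   suffices to differentiate the identity, and [nabla g Y Z] is again smooth. *)
have e y : V y -> nabla_end g Y (mulop T) Z y = mulop (fun y => cov (Y y) T y) Z y.
  by move=> Vy; exact: nabla_endE.
rewrite {1}/nabla_end -[in RHS]/(nabla_end g Y _ Z x) [RHS]/nabla_end.
rewrite (nabla_endE Y sT (smooth_nabla sY sZ) Vx) !nablaE.
rewrite (derive_eq_on Vo (Y x) e Vx) (e x Vx).
by rewrite -(nablaE Y Z).
Qed.

(** The coordinate derivative of [e i] along itself appears in both terms of the definition and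
    cancels; what remains is minus the tensorial second derivative, depending on the frame only at
    [x]. *)
Lemma trace_laplacianE (e : 'I_n -> 'rV[R]_n -> 'rV[R]_n) T Z x :
  (forall i, smooth_mx V (e i)) -> smooth_mx V T -> smooth_mx V Z -> V x ->
  trace_laplacian g e (mulop T) Z x =
  - (Z x *m \sum_i cov2 (e i x) (e i x) T x).
Proof.
move=> se sT sZ Vx; rewrite /trace_laplacian mulmx_sumr -sumrN; apply: eq_bigr => i _.
rewrite (nabla_endE _ sT sZ Vx) (nabla_end2E (se i) sT sZ Vx) nablaE.
rewrite (covDdir g Vo _ _ sT Vx) /covder2.
move: (cov ('D_(e i x) (e i) x) T x) (cov (e i x *m _) T x) (cov _ (cov _ T) x) => B C D.
by rewrite -mulmxBr -mulmxN opprB opprD addrACA subrr add0r.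
Qed.

(** The trace in [laplacian] is taken in coordinates; being independent of the basis, it can be
    evaluated on the orthonormal rows of [F]. *)
Lemma laplacian_trace (F : 'M[R]_n) T x :
  smooth_mx V T -> V x -> F *m g x *m F^T = 1%:M ->
  laplacian g (fun y => \tr (T y)) x =
  - \sum_i \tr (cov2 (row i F) (row i F) T x).
Proof.
move=> sT Vx F_orth; rewrite /laplacian; congr (- _).
rewrite -(orthonormal_trace F_orth); apply: eq_bigr => i _.
have sG := smooth_grad Vo sg gunit (smooth_mxtrace Vo sT).
rewrite (@mul_matrix_linear _ _ _ (fun u => nabla g (cst u) (grad g (fun y => \tr (T y))) x)
  (row i F) (fun a u v => nabla_linear a u v sG Vx)).
exact: (form_nabla_grad_trace Vo sGam sg gunit dg _ _ sT Vx).
Qed.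

Lemma half_laplacian_trace_sq (F : 'M[R]_n) T x :
  smooth_mx V T -> V x -> F *m g x *m F^T = 1%:M ->
  2^-1 * laplacian g (fun y => \tr (T y *m T y)) x =
  - \tr (T x *m \sum_i cov2 (row i F) (row i F) T x)
  - \sum_i \tr (cov (row i F) T x *m cov (row i F) T x).
Proof.
move=> sT Vx F_orth; rewrite (laplacian_trace (smooth_mulmx Vo sT sT) Vx F_orth).
have -> : \tr (T x *m \sum_i cov2 (row i F) (row i F) T x) =
    \sum_i \tr (T x *m cov2 (row i F) (row i F) T x).
  by rewrite mulmx_sumr raddf_sum.
rewrite mulrN -opprD; congr (- _); rewrite -big_split mulr_sumr /=.
apply: eq_bigr => i _.
rewrite (cov2M Vo sGam _ _ sT sT Vx).
move: (cov2 _ _ _ _) (cov _ _ _) (T x) => B C D.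
rewrite !mxtraceD (mxtrace_mulC B); lra.
Qed.

(** Each derivative of a self-adjoint field is self-adjoint, so its squared norm is the trace of its
    square. *)
Lemma norm2_nabla_endE (e : 'I_n -> 'rV[R]_n -> 'rV[R]_n) (F : 'M[R]_n) T x :
  (forall i, smooth_mx V (e i)) -> (forall i, row i F = e i x) ->
  smooth_mx V T -> selfadjoint_on g V T -> V x -> F *m g x *m F^T = 1%:M ->
  norm2_nabla_end g e (mulop T) x =
  \sum_i \tr (cov (row i F) T x *m cov (row i F) T x).
Proof.
move=> se Fe sT aT Vx F_orth; rewrite /norm2_nabla_end exchange_big.
apply: eq_bigr => j _; rewrite -(orthonormal_trace F_orth); apply: eq_bigr => i _.
rewrite (nabla_endE _ sT (se i) Vx) -/(form (g x) _ _) !Fe mulmxA.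
by rewrite [RHS](form_selfadjoint _ _ (selfadjoint_cov Vo sg dg _ sT aT) Vx).
Qed.

End OperatorFormulas.

Lemma smooth_on_subset (R : realType) (E W : normedModType R) (V V' : set E)
    (f : E -> W) : V' `<=` V -> smooth_on V f -> smooth_on V' f.
Proof.
move=> VV sf k; move: (sf k); elim: k f {sf} => [|k IH] f /=.
  by move=> cf x V'x; apply: cf; exact: VV.
move=> [df kf]; split=> [x v V'x|v]; first by apply: df; exact: VV.
by apply: IH; exact: kf.
Qed.

(** * The affine charts of complex space forms as instances of the projective model *)

Section AffineCharts.
Variables (R : realType) (c : R) (m : nat) (j : 'I_m.+1).
Local Notation C := R[i].

(** The signature of [herm]. In the chart [j], the weight of [j] becomes the constant [kap] of the
    potential and the other weights form [chart_form], each occurring for a real and an imaginary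
    part. *)
Definition herm_weight (k : 'I_m.+1) : R := if k == ord0 then c else 1.

Definition chart_form : 'M[R]_(m + m) :=
  let d := \row_l herm_weight (lift j l) in diag_mx (row_mx d d).

Local Notation Q := chart_form.
Local Notation J := (Jmx R m).
Local Notation kap := (herm_weight j).

Lemma JmxJ : J *m J = - 1%:M.
Proof.
rewrite /Jmx mulmx_block !mul0mx !mulmx0 !mul1mx !mulmx1 !add0r !addr0.
by rewrite (@scalar_mx_block _ m m 1) opp_block_mx oppr0.
Qed.

Lemma Jmx_skew : J^T = - J.
Proof.
rewrite /Jmx tr_block_mx opp_block_mx !trmx0 !oppr0 opprK trmx1.
by rewrite linearN /= trmx1.
Qed.

Lemma chart_form_sym : Q^T = Q.
Proof. exact: tr_diag_mx. Qed.

Lemma chart_form_J : J *m Q = Q *m J.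
Proof.
rewrite /chart_form diag_mx_row /Jmx !mulmx_block.
by rewrite !(mul0mx, mulmx0, mul1mx, mulmx1, add0r, addr0, mulNmx, mulmxN).
Qed.

Lemma hermE (z w : 'rV[C]_m.+1) :
  herm c z w = \sum_k (herm_weight k)%:C * (z 0 k * (w 0 k)^*).
Proof.
rewrite /herm big_ord_recl /herm_weight eqxx mulrA; congr (_ + _).
by apply: eq_bigr => k _; rewrite mul1r.
Qed.

Lemma form_chart (v w : 'rV[R]_(m + m)) : form Q v w =
  \sum_(l < m) herm_weight (lift j l) *
    (v 0 (lshift m l) * w 0 (lshift m l) + v 0 (rshift m l) * w 0 (rshift m l)).
Proof.
rewrite /form /chart_form mul_mx_diag mxE big_split_ord /= -big_split /=.
apply: eq_bigr => l _; rewrite !mxE !(unsplitK (inl _)) !(unsplitK (inr _)) /=.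
rewrite !mxE; ring.
Qed.

Lemma mulJmx (v : 'rV[R]_(m + m)) : v *m J = row_mx (- rsubmx v) (lsubmx v).
Proof.
rewrite -{1}[v]hsubmxK /Jmx mul_row_block !mulmx0 mulmx1 mulmxN mulmx1.
by rewrite add0r addr0.
Qed.

Lemma mulJmxl (v : 'rV[R]_(m + m)) l : (v *m J) 0 (lshift m l) = - v 0 (rshift m l).
Proof. by rewrite mulJmx row_mxEl !mxE. Qed.

Lemma mulJmxr (v : 'rV[R]_(m + m)) l : (v *m J) 0 (rshift m l) = v 0 (lshift m l).
Proof. by rewrite mulJmx row_mxEr !mxE. Qed.

(** Separates the coordinate [j] from the rest; the imaginary part of the Hermitian form is its real
    part twisted by [J]. *)
Lemma herm_hcoord a b (v w : 'rV[R]_(m + m)) :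
  herm c (hcoord j a v) (hcoord j b w) =
  kap%:C * (a * b^*) + (form Q v w +i* (- form Q (v *m J) w)).
Proof.
rewrite hermE (bigD1_ord j) //= !mxE unlift_none; congr (_ + _).
rewrite !form_chart -sumrN.
elim/big_rec3: _ => [//|l x y z _ ->].
rewrite !mulJmxl !mulJmxr !mxE liftK.
move: (herm_weight _) (v 0 _) (v 0 _) (w 0 _) (w 0 _) => h v1 v2 w1 w2.
by apply/eqP; rewrite eq_complex /=; apply/andP; split; apply/eqP; ring.
Qed.

Lemma herm_hcoord0r a (v w : 'rV[R]_(m + m)) :
  herm c (hcoord j a v) (hcoord j 0 w) = form Q v w +i* (- form Q (v *m J) w).
Proof.
rewrite herm_hcoord; case: a => a1 a2.
by apply/eqP; rewrite eq_complex /=; apply/andP; split; apply/eqP; ring.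
Qed.

Lemma herm_hcoord0l b (v w : 'rV[R]_(m + m)) :
  herm c (hcoord j 0 v) (hcoord j b w) = form Q v w +i* (- form Q (v *m J) w).
Proof.
rewrite herm_hcoord; case: b => b1 b2.
by apply/eqP; rewrite eq_complex /=; apply/andP; split; apply/eqP; ring.
Qed.

Lemma herm_hcoord1 (z : 'rV[R]_(m + m)) :
  herm c (hcoord j 1 z) (hcoord j 1 z) = (potential Q kap z)%:C.
Proof.
rewrite herm_hcoord /potential.
have -> : form Q (z *m J) z = 0.
  apply/eqP; have := model_Jskew chart_form_J Jmx_skew z z.
  rewrite (form_sym z _ chart_form_sym) => /eqP.
  by rewrite -subr_eq0 opprK -mulr2n mulrn_eq0.
by apply/eqP; rewrite eq_complex /=; apply/andP; split; apply/eqP; ring.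
Qed.

Lemma Re_div_real (x : C) (r : R) : complex.Re (x / r%:C) = complex.Re x / r.
Proof. by rewrite -fmorphV; case: x => a b /=; ring. Qed.

Lemma CQmetricE : CQmetric c j = model_metric Q J c kap.
Proof.
apply/funext => z; apply/matrixP => a b; rewrite mxE -[RHS]form_delta.
rewrite (form_model_metric _ _ _ chart_form_sym); congr (_ * _).
set v := delta_mx 0 a; set w := delta_mx 0 b.
rewrite herm_hcoord1 -rmorphXn /= raddfB /= !Re_div_real !herm_hcoord0l herm_hcoord0r.
rewrite (form_sym z w chart_form_sym).
have -> : form Q (z *m J) w = - form Q (w *m J) z.
  by rewrite (model_Jskew chart_form_J Jmx_skew) (form_sym z _ chart_form_sym).
rewrite /dlogpot /=.
move: (potential _ _ _) => r; rewrite -exprVn; ring.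
Qed.

Lemma hcoord_Re_Im (w : 'rV[C]_m.+1) : w 0 j = 1 ->
  hcoord j 1 (row_mx (\row_k complex.Re (w 0 (lift j k)))
                     (\row_k complex.Im (w 0 (lift j k)))) = w.
Proof.
move=> wj; apply/rowP => k; rewrite mxE; case: unliftP => [k' ->|->] //.
by rewrite row_mxEl row_mxEr !mxE; case: (w 0 _).
Qed.

Lemma hcoord_CQchart (L : {vspace 'rV[R[i]]_m.+1}) : vpick L 0 j != 0 ->
  hcoord j 1 (CQchart j L) = (vpick L 0 j)^-1 *: vpick L.
Proof. by move=> Lj; apply: hcoord_Re_Im; rewrite mxE mulVf. Qed.

(** The normalised generator of [L] is a nonzero vector of [L] and the potential is its Hermitian
    square, so the sign condition defining [CQ] keeps it away from zero. *)
Lemma potential_CQchart (L : {vspace 'rV[R[i]]_m.+1}) : CQdom c j L ->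
  potential Q kap (CQchart j L) != 0.
Proof.
move=> [[_ Lpos] Lj]; set z := (vpick L 0 j)^-1 *: vpick L.
have zL : z \in L by rewrite memvZ ?memv_pick.
have z0 : z != 0.
  apply/negP => /eqP z0; have : z 0 j = 0 by rewrite z0 mxE.
  by rewrite mxE mulVf// => /eqP; rewrite oner_eq0.
have := Lpos z zL z0; rewrite /z -hcoord_CQchart// herm_hcoord1 /=.
by apply: contraTneq => ->; rewrite mulr0 ltxx.
Qed.

End AffineCharts.


Theorem mainTheorem6 (R : realType) (c : R) (hc : c = 1 \/ c = -1)
    (m n : nat) (hm : (0 < m)%N) (hn : n = (2 * m - 1)%N)
    (M : topologicalType) (atlas : set (chart R M n))
    (hM : smooth_manifold atlas)
    (F : M -> {vspace 'rV[R[i]]_m.+1}) (hF : immersion c F atlas)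
    (a : chart R M n) (ha : atlas a) (j : 'I_m.+1)
    (V : set 'rV[R]_n) (hVo : open V) (hV : V `<=` local_dom c F a j)
    (xi : 'rV[R]_n -> 'rV[R]_(m + m))
    (hxi : unit_normal (CQmetric c j) (local_map F a j) xi V)
    (e : 'I_n -> 'rV[R]_n -> 'rV[R]_n)
    (he : orthonormal_frame
            (induced_metric (CQmetric c j) (local_map F a j)) V e) :
  let g := induced_metric (CQmetric c j) (local_map F a j) in
  let A := shape_operator (CQmetric c j) (local_map F a j) xi in
  let S := structure_tensor (CQmetric c j) (Jmx R m) (local_map F a j) in
  let U := structure_vector (CQmetric c j) (Jmx R m) (local_map F a j) xi in
  let opA := fun (Y : 'rV[R]_n -> 'rV[R]_n) y => Y y *m A y in
  let ft := fun k y => \tr (A y ^+ k) in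
  let f := ft 1%N in
  (forall X : 'rV[R]_n -> 'rV[R]_n, smooth_on V X -> forall x, V x ->
     trace_laplacian g e opA X x =
       (3 * c) *: (inner g x (U x *m A x - f x *: U x) (X x) *: U x
                   + inner g x (U x) (X x) *: (U x *m A x))
       - (6 * c) *: (X x *m S x *m A x *m S x)
       + (c * f x) *: X x
       + (ft 2%N x - c * (n + 3)%:R) *: (X x *m A x)
       - f x *: (X x *m A x *m A x)
       - nabla g X (grad g f) x) /\
  (forall x, V x ->
     2^-1 * laplacian g (ft 2%N) x =
       6 * c * inner g x (U x *m A x) (U x *m A x)
       - 3 * c * f x * inner g x (U x *m A x) (U x)
       - 6 * c * \tr (S x *m A x *m S x *m A x)
       + c * f x ^+ 2
       + (ft 2%N x - c * (n + 3)%:R) * ft 2%N x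
       - f x * ft 3%N x
       - norm2_nabla_end g e opA x
       - \sum_i hess g f x (e i x *m A x) (e i x)).
Proof.
move=> g A S U opA ft f.
have cc : c * c = 1 by case: hc => ->; rewrite ?mulrNN mulr1.
pose Q := chart_form c j; pose J := Jmx R m; pose kap := herm_weight c j.
pose phi := local_map F a j.
have Qsym : Q^T = Q := chart_form_sym c j.
have JQ : J *m Q = Q *m J := chart_form_J c j.
have JJ : J *m J = - 1%:M := JmxJ R m.
have Jskew : J^T = - J := Jmx_skew R m.
(* Positivity of [m] makes the truncated subtraction in [n = 2 * m - 1] a true one. *)
have codim1 : n.+1 = (m + m)%N.
  by rewrite hn mul2n -addnn subn1 prednK// addn_gt0 hm.
have [_ _ hcharts _ _] := hM.
have sphi : smooth_mx V phi.
  have [_ sl _] := hF.2 a j ha.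
  by apply: (smooth_on_mx hVo); exact: smooth_on_subset hV sl.
have sxi : smooth_mx V xi by exact: (smooth_on_mx hVo hxi.1).
have pot0 x : V x -> potential Q kap (phi x) != 0.
  move=> /hV[p [ap Fp] <-]; apply: potential_CQchart.
  by have [_ _ inv _ _] := hcharts a ha; rewrite inv.
pose G := model_metric Q J c kap.
have GE : CQmetric c j = G := CQmetricE c j.
have gE : g = induced_metric G phi by rewrite /g GE.
have AE : A = shape_operator G phi xi by rewrite /A GE.
have SE : S = structure_tensor G J phi by rewrite /S GE.
have UE : U = structure_vector G J phi xi by rewrite /U GE.
have xi_unit x : V x -> form (G (phi x)) (xi x) (xi x) = 1.
  by move=> Vx; have [_ /(_ x Vx)[+ _]] := hxi; rewrite GE.
have xi_normal x (u : 'rV[R]_n) : V x -> form (G (phi x)) (u *m dmap phi x) (xi x) = 0.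
  by move=> Vx; have [_ /(_ x Vx)[_ +]] := hxi; rewrite GE => /(_ u).
(* With the frame vectors as rows, orthonormality reads [Fm g Fm^T = 1], which gives at once the
   invertibility of [g] and the contraction rules. *)
pose Fm x : 'M[R]_n := \matrix_i e i x.
have rowF i x : row i (Fm x) = e i x by rewrite rowK.
have F_orth x : V x -> Fm x *m induced_metric G phi x *m (Fm x)^T = 1%:M.
  move=> Vx; apply/matrixP => i k.
  rewrite [RHS]mxE -(he.2 x i k Vx) -/g gE.
  by rewrite /inner -!rowF -row_mul !mxE; apply: eq_bigr => l _; rewrite !mxE.
have se i : smooth_mx V (e i) by exact: (smooth_on_mx hVo (he.1 i)).
have sA : smooth_mx V A.
  rewrite AE; exact: (smooth_shape Qsym JQ JJ Jskew codim1 hVo sphi sxi pot0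
    xi_unit xi_normal F_orth).
have sg : smooth_mx V g.
  by rewrite gE; exact: (smooth_induced J c Qsym hVo sphi pot0).
have sS : smooth_mx V S.
  by rewrite SE; exact: (smooth_structure_tensor Qsym hVo sphi pot0 F_orth).
have sU : smooth_mx V U.
  by rewrite UE; exact: (smooth_structure_vector Qsym hVo sphi sxi pot0 F_orth).
have sGam u : smooth_mx V (conn_mx g u).
  rewrite gE; exact: (smooth_conn_mx Qsym JQ JJ Jskew codim1 hVo sphi pot0
    xi_unit xi_normal F_orth).
have gsym x : (g x)^T = g x by rewrite gE; exact: (induced_sym J c kap Qsym phi x).
have gunit x : V x -> g x \in unitmx.
  by rewrite gE; exact: (induced_unit F_orth).
have torsion x (u v : 'rV[R]_n) : V x -> v *m conn_mx g u x = u *m conn_mx g v x.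
  by rewrite gE; exact: (conn_mx_torsion Qsym JQ JJ Jskew codim1 hVo sphi pot0
    xi_unit xi_normal F_orth).
have dg x u : V x -> 'D_u g x = conn_mx g u x *m g x + g x *m (conn_mx g u x)^T.
  by rewrite gE; exact: (derive_induced Qsym JQ JJ Jskew codim1 hVo sphi pot0
    xi_unit xi_normal F_orth).
have Asym x u v : V x -> form (g x) (u *m A x) v = form (g x) u (v *m A x).
  by rewrite gE AE; exact: (shape_sym Qsym JQ JJ Jskew codim1 hVo sphi pot0
    xi_unit xi_normal F_orth).
have Sskew x u v : V x -> form (g x) (u *m S x) v = - form (g x) u (v *m S x).
  by rewrite gE SE; exact: (structure_skew Qsym JQ JJ Jskew codim1
    xi_unit xi_normal F_orth).
have Ssq x u : V x -> u *m S x *m S x = - u + form (g x) u (U x) *: U x.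
  by rewrite gE SE UE; exact: (structure_sq Qsym JQ JJ Jskew codim1
    xi_unit xi_normal F_orth).
have Uunit x : V x -> form (g x) (U x) (U x) = 1.
  by rewrite gE UE => Vx; have [] := structure_vector_eqs Qsym JQ JJ Jskew codim1
    xi_unit xi_normal F_orth Vx.
have covU x u : V x -> 'D_u U x + U x *m conn_mx g u x = u *m A x *m S x.
  by rewrite gE UE AE SE; exact: (cov_structure_vector Qsym JQ JJ Jskew codim1 hVo
    sphi sxi pot0 xi_unit xi_normal F_orth).
have covS x u w : V x -> w *m covder g u S x =
    form (g x) w (U x) *: (u *m A x) - form (g x) (u *m A x) w *: U x.
  by rewrite gE UE AE SE; exact: (cov_structure_tensor Qsym JQ JJ Jskew codim1 hVo
    sphi sxi pot0 xi_unit xi_normal F_orth).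
have codazziE x u v : V x -> v *m covder g u A x - u *m covder g v A x =
    c *: (form (g x) u (U x) *: (v *m S x) - form (g x) v (U x) *: (u *m S x)
          - (2 * form (g x) (u *m S x) v) *: U x).
  by rewrite gE UE AE SE; exact: (codazzi cc Qsym JQ JJ Jskew codim1 hVo
    sphi sxi pot0 xi_unit xi_normal F_orth).
have gaussE x u v w : V x -> w *m riem_mx g u v x =
    form (g x) (v *m A x) w *: (u *m A x) - form (g x) (u *m A x) w *: (v *m A x)
    + c *: (form (g x) v w *: u - form (g x) u w *: v
            - form (g x) (w *m S x) v *: (u *m S x)
            + form (g x) (w *m S x) u *: (v *m S x)
            - (2 * form (g x) (u *m S x) v) *: (w *m S x)).
  rewrite gE AE SE => Vx.
  by have [] := gauss_codazzi cc Qsym JQ JJ Jskew codim1 hVo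
    sphi sxi pot0 xi_unit xi_normal F_orth u v w Vx.
have F_orth' x : V x -> Fm x *m g x *m (Fm x)^T = 1%:M by rewrite gE; exact: F_orth.
have ft2 : ft 2%N = fun y => \tr (A y *m A y) by [].
have ft3 y : ft 3%N y = \tr (A y *m A y *m A y) by rewrite -mulmxA.
have sumF x : \sum_i covder2 g (e i x) (e i x) A x =
    \sum_i covder2 g (row i (Fm x)) (row i (Fm x)) A x.
  by apply: eq_bigr => i _; rewrite rowF.
split.
  move=> X sX x Vx.
  rewrite (trace_laplacianE hVo sGam se sA (smooth_on_mx hVo sX) Vx) sumF.
  (* The trace Laplacian is minus the sum of second derivatives, so [opprB] restores the signs of
     the curvature terms and makes the Hessian term negative. *)
  rewrite (simons_vector hVo sg sGam sA sS sU gsym gunit torsion dg Asym Sskew Ssq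
    Uunit covU covS codazziE gaussE Vx (F_orth' x Vx)) opprB.
  by [].
move=> x Vx; rewrite ft2 ft3.
rewrite (half_laplacian_trace_sq hVo sGam sg gunit dg sA Vx (F_orth' x Vx)).
rewrite (norm2_nabla_endE hVo sg dg se (fun i => rowF i x) sA
  (A_selfadjoint Asym) Vx (F_orth' x Vx)).
rewrite (simons_trace hVo sg sGam sA sS sU gsym gunit torsion dg Asym Sskew Ssq
    Uunit covU covS codazziE gaussE Vx (F_orth' x Vx)).
have -> : \sum_i hess g f x (e i x *m A x) (e i x) =
    \sum_i form (g x) (hess_trace g A x (row i (Fm x) *m A x)) (row i (Fm x)).
  by apply: eq_bigr => i _; rewrite rowF.
by rewrite opprB [LHS]addrAC.
Qed.
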